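(* Let $d\in\mathbb N$, $1\le p<\infty$ and $r>0$. For any cubature formula $(\Lambda,X_m)$ with respect to an $(n,n-1)$-net $X_m$ we have $$ \Lambda(\mathbf W^r_p,X_m) \gg 2^{-rn}n^{(d-1)/2}. $$
   Context: $\mathbb T^d=[0,2\pi)^d$ (functions are $2\pi$-periodic in each variable) carries the normalized Lebesgue measure $d\mu=(2\pi)^{-d}d\mathbf x$; $\|\cdot\|_p$ is the norm of $L_p(\mathbb T^d)$, and $(f\ast g)(\mathbf x)=(2\pi)^{-d}\int_{\mathbb T^d}f(\mathbf y)g(\mathbf x-\mathbf y)\,d\mathbf y$. A cubature formula $(\Lambda,X_m)$ is given by knots $X_m=\{\xi^1,\dots,\xi^m\}\subset\mathbb T^d$ and weights $\lambda_1,\dots,\lambda_m$: $\Lambda(f,X_m):=\sum_{j=1}^m\lambda_jf(\xi^j)$. For a class $\mathbf W$, $$\Lambda(\mathbf W,X_m):=\sup_{f\in\mathbf W}\Big|\int_{\mathbb T^d}f\,d\mu-\Lambda(f,X_m)\Big| ,$$ the supremum being over continuous $f\in\mathbf W$ (so that point values make sense). For $\mathbf s\in\mathbb N_0^d$ ($\mathbb N_0=\{0,1,2,\dots\}$, $\|\mathbf s\|_1=s_1+\dots+s_d$) put $w(\mathbf s,\mathbf x):=\prod_{j=1}^d\sin(2^{s_j}x_j)$ and $W(\mathbf s):=\{\mathbf x: w(\mathbf s,\mathbf x)=0\}$. A set of knots $X_m=\{\xi^i\}_{i=1}^m$ is an $(n,l)$-net if $|X_m\setminus W(\mathbf s)|\le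 2^l$ for all $\mathbf s$ with $\|\mathbf s\|_1=n$. For $r>0$ let $F_r(x):=1+2\sum_{k=1}^\infty k^{-r}\cos(kx-r\pi/2)$ (univariate), $F_r(\mathbf x):=\prod_{j=1}^d F_r(x_j)$, and $\mathbf W^r_p:=\{f: f=\varphi\ast F_r,\ \|\varphi\|_p\le 1\}$. $\gg$ means that the left side is at least $c$ times the right side, with $c>0$ independent of $n\in\mathbb N$, $m$, the net $X_m$ and the weights (it may depend on $r,p,d$). *)

(* Defs.v *)
From HB Require Import structures.
From mathcomp Require Import all_boot all_order all_algebra.
From mathcomp Require Import all_classical all_reals all_analysis.

Set Implicit Arguments.
Unset Strict Implicit.
Unset Printing Implicit Defensive.

Import Order.TTheory GRing.Theory Num.Theory.
Import numFieldNormedType.Exports.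

Local Open Scope classical_set_scope.
Local Open Scope card_scope.
Local Open Scope ring_scope.

(* Points of R^d are d-tuples: these carry the product sigma-algebra of the
   Borel sets of R. *)
Notation euclidean R d := (d.-tuple (measurableTypeR R)).

Section torus_measure.
Variable R : realType.

Lemma two_pi_gt0 : 0 < 2 * pi :> R.
Proof. by rewrite mulr_gt0 ?pi_gt0. Qed.

Definition pcons d (x : measurableTypeR R * euclidean R d) : euclidean R d.+1 :=
  [tuple of x.1 :: x.2].

Lemma measurable_pcons d : measurable_fun [set: _] (@pcons d).
Proof. by apply: measurable_cons; [exact: measurable_fst | exact: measurable_snd]. Qed.

HB.instance Definition _ d :=
  isMeasurableFun.Build _ _ _ _ (@pcons d) (@measurable_pcons d).

(* (2 pi)^-d times the Lebesgue measure of the cube [0, 2 pi]^d, as a measure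
   on R^d: the d-fold product of the uniform probability on [0, 2 pi]. *)
Fixpoint torus_prob d : probability (euclidean R d) R :=
  if d is d'.+1
  then distribution (uniform_prob two_pi_gt0 \x torus_prob d')%E (@pcons d')
  else \d_([tuple] : euclidean R 0).

End torus_measure.

Section classes.
Variables (R : realType) (d : nat).
Implicit Types (f phi : euclidean R d -> R) (W : set (euclidean R d -> R)).

Local Notation mu := (torus_prob R d).

Definition torus : set (euclidean R d) :=
  [set x | forall j, 0 <= tnth x j < 2 * pi].

Definition periodic f :=
  forall (j : 'I_d) (x : euclidean R d),
    f [tuple tnth x i + (2 * pi) *+ (i == j) | i < d] = f x.

(* Tuples carry no topology in the library, row vectors do. *)
Definition continuous_on_space f :=
  continuous (fun v : 'rV[R]_d => f [tuple v ord0 i | i < d]).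

Definition convolution f g (x : euclidean R d) : R :=
  \int[mu]_y (f y * g [tuple tnth x i - tnth y i | i < d]).

(* For 0 < r the series converges for all x outside 2 pi Z, a null set. *)
Definition F1 (r x : R) : R :=
  1 + 2 * limn (fun N =>
    \sum_(1 <= k < N) k%:R `^ (- r) * cos (k%:R * x - r * pi / 2)).

Definition F (r : R) (x : euclidean R d) : R := \prod_(j < d) F1 r (tnth x j).

(* Elements of L_p are identified when equal almost everywhere, hence the
   equation f = phi * F_r is an almost everywhere one. *)
Definition Wclass (r p : R) : set (euclidean R d -> R) :=
  [set f | periodic f /\
    exists phi, [/\ periodic phi, measurable_fun [set: euclidean R d] phi,
      ('N[mu]_p%:E [EFin \o phi] <= 1)%E &
      {ae mu, forall x, f x = convolution phi (F r) x}]].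

Definition cubature m (xi : 'I_m -> euclidean R d) (lambda : 'I_m -> R) f : R :=
  \sum_(j < m) lambda j * f (xi j).

Definition cubature_error W m (xi : 'I_m -> euclidean R d) (lambda : 'I_m -> R) :
    \bar R :=
  ereal_sup [set `|\int[mu]_x f x - cubature xi lambda f|%:E
            | f in W `&` continuous_on_space].

Definition w (s : 'I_d -> nat) (x : euclidean R d) : R :=
  \prod_(j < d) sin (2 ^+ s j * tnth x j).

Definition zeros_w (s : 'I_d -> nat) : set (euclidean R d) := [set x | w s x = 0].

Definition is_net (n l : nat) (X : set (euclidean R d)) :=
  X `<=` torus /\
  forall s : 'I_d -> nat, (\sum_(j < d) s j)%N = n ->
    X `\` zeros_w s #<= `I_(2 ^ l).

End classes.

(* Main.v *)
(* Split the torus, for each s with |s|_1 = n, into 2^(n+d) boxes with sides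
   pi / 2^(s_j). A knot outside W(s) lies in the interior of one box, so an
   (n, n-1)-net leaves at least 2^n boxes free of knots. On each free box put a
   product of translates of a bump whose Fourier coefficients are powers of sinc
   (it is an iterated average, hence compactly supported and of mean 2^-s_j), and
   let f be the sum over the free boxes and over N ~ n^(d-1) vectors s whose first
   d-1 coordinates are multiples of a constant kap. Then f vanishes at the knots
   and its integral is at least N.

   f is the convolution with F_r of the sum phi of the corresponding products of
   r-th derivatives. Cut these derivatives into dyadic frequency blocks. For one s
   and one choice of blocks the sum over the boxes is bounded uniformly by
   C 2^(rn), with geometric decay away from the scale s: this is a weighted
   Cauchy-Schwarz and Parseval estimate on an equidistant grid. For a fixed
   relative position of the blocks the s-sums are lacunary in the first d-1
   coordinates, so iterating the two-smoothness of L_(2q) gives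
   |phi|_(2q) <= C 2^(rn) N^(1/2) with 2q = 2^l >= p. Normalizing phi yields the
   error N / (2^(rn) N^(1/2)) up to a constant. *)
Require Import Defs.
From mathcomp Require Import all_boot all_order all_algebra.
From mathcomp Require Import all_classical all_reals all_analysis.
From mathcomp Require Import measurable_realfun ring lra zify.

Import Order.TTheory GRing.Theory Num.Theory.
Import numFieldNormedType.Exports.

Local Open Scope classical_set_scope.
Local Open Scope ring_scope.

(** The free boxes form an arbitrary subset of the grid, so no cancellation between boxes of one
    scale is available: at one scale all estimates take absolute values and enlarge the sum to the
    full grid. Cancellation is used only between scales, where it needs frequency localization,
    which compactly supported bumps lack; hence the blocks. Below the scale of the bump a block
    gains from the factor k^r, which uses r > 0; above it the sinc power has to beat both k^r and
    the loss from refining the grid, so its exponent grows with r. Since s_1 + ... + s_d = n, only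
    d-1 coordinates are free. The N scales contribute N to the mean but, being nearly orthogonal,
    only sqrt N to the norm; the ratio sqrt N is the factor n^((d-1)/2). The moments have even order
    so that the first-order term of their expansion is a trigonometric polynomial, which integrates
    to zero by counting frequencies. The order is a power of two so that Jensen's inequality follows
    by repeated squaring. Every smaller p is covered because the torus has total mass 1. *)

(** * Elementary sine bounds and Abel summation *)

Section trig_aux.
Variable R : realType.

(** Since sin(y/2) = 2 sin(y/4) cos(y/4), it suffices that on [0, pi/4] the cosine and, by the mean
    value theorem, the quotient sin u / u are at least cos(pi/4), whose square is 1/2. *)
Lemma sin_half_gt (y : R) : 0 <= y <= pi -> y / 4 <= sin (y / 2).
Proof.
move=> /andP[y0 ypi]; have pi0 := pi_gt0 R.
have c4 : cos (pi / 4) ^+ 2 = 2^-1 :> R.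
  have := @cos_mulr2n R (pi / 4); rewrite (_ : pi / 4 *+ 2 = pi / 2); last first.
    by rewrite -mulr_natl; field.
  by rewrite cos_pihalf => h; lra.
have c40 : 0 < cos (pi / 4) :> R by apply: cos_gt0_pihalf; apply/andP; split; lra.
have cge (u : R) : 0 <= u <= pi / 4 -> cos (pi / 4) <= cos u.
  move=> /andP[u0 u4]; have [->//|u4'] := eqVneq u (pi / 4).
  rewrite ltW// ltr_cos ?in_itv/= ?u0 ?lt_neqAle ?u4' ?u4//=; first lra.
  by apply/andP; split; lra.
have sge (u : R) : 0 <= u <= pi / 4 -> u * cos (pi / 4) <= sin u.
  move=> /andP[u0 u4].
  have [c] := @MVT_segment R sin cos 0 u u0 (fun x _ => is_derive_sin x)
    (continuous_subspaceT (@continuous_sin R)).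
  rewrite in_itv/= => /andP[c0 cu]; rewrite sin0 !subr0 => ->.
  rewrite mulrC ler_wpM2r// cge// c0 (le_trans cu)//.
have -> : y / 2 = (y / 4) *+ 2 by rewrite -(mulr_natl (y / 4)); field.
rewrite sin_mulr2n -(mulr_natl (cos _ * _)).
have h : 0 <= y / 4 <= pi / 4 by apply/andP; split; lra.
have h1 := cge _ h; have h2 := sge _ h.
have : cos (pi / 4) * (y / 4 * cos (pi / 4)) <= cos (y / 4) * sin (y / 4).
  by apply: ler_pM => //; [exact: ltW|rewrite mulr_ge0 ?(ltW c40)//; lra].
rewrite (_ : cos (pi / 4) * (y / 4 * cos (pi / 4)) = y / 4 * cos (pi / 4) ^+ 2); last by ring.
by rewrite c4 => h3; lra.
Qed.

Lemma sin_half_ge (y : R) : 0 <= y <= 2 * pi -> Num.min y (2 * pi - y) / 4 <= sin (y / 2).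
Proof.
move=> /andP[y0 y2]; have [ypi|piy] := leP y pi.
  apply: (le_trans _ (sin_half_gt y _)); last by rewrite y0.
  by rewrite ler_wpM2r// ge_min lexx.
have -> : sin (y / 2) = sin ((2 * pi - y) / 2).
  have -> : (2 * pi - y) / 2 = pi - y / 2 by field.
  by rewrite sinB sinpi cospi mul0r mulN1r sub0r opprK.
apply: (le_trans _ (sin_half_gt _ _)); last by apply/andP; split; lra.
by rewrite ler_wpM2r// ge_min lexx orbT.
Qed.

Lemma sin_mul_cos (x y : R) : 2 * sin x * cos y = sin (y + x) - sin (y - x).
Proof. by rewrite sinD sinB; ring. Qed.

Lemma cauchy_tail (u b : nat -> R) :
  (forall N M, (N <= M)%N -> `|u M - u N| <= b N) -> b @ \oo --> 0 ->
  u @ \oo --> limn u /\ forall N, `|limn u - u N| <= b N.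
Proof.
move=> ub b0; have cu : cvgn u.
  apply/cauchy_cvgP/cauchy_ballP => e e0; rewrite near_simpl.
  have [N _ hN] : \forall n \near \oo, b n < e / 2.
    by apply: (cvgr_lt 0 b0); rewrite divr_gt0.
  exists ([set n | (N <= n)%N], [set n | (N <= n)%N]).
    by split; exists N.
  move=> [n m] /= [Nn Nm]; rewrite /ball /=.
  have -> : u n - u m = (u n - u N) - (u m - u N) by ring.
  rewrite (le_lt_trans (ler_normB _ _))//.
  have h1 := ub _ _ Nn; have h2 := ub _ _ Nm; have h3 := hN N (leqnn _).
  by rewrite /= in h3; lra.
split => // N.
have : `|u n - u N| @[n --> \oo] --> `|limn u - u N|.
  by apply: cvg_norm; apply: cvgB => //; exact: cvg_cst.
move=> /cvg_lim <- //; apply: limr_le.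
  by apply/cvg_ex; exists `|limn u - u N|; apply: cvg_norm; apply: cvgB => //; exact: cvg_cst.
by exists N => // n /= Nn; exact: ub.
Qed.

Lemma abel_sum (a c : nat -> R) (m : nat) :
  \sum_(k < m.+1) a k * c k =
  \sum_(k < m) (a k - a k.+1) * (\sum_(j < k.+1) c j) + a m * \sum_(j < m.+1) c j.
Proof.
elim: m => [|m IH]; first by rewrite big_ord0 !big_ord1 add0r.
rewrite big_ord_recr /= IH [in RHS]big_ord_recr /= [in X in _ = _ + X]big_ord_recr /=; ring.
Qed.

(** Abel summation writes both sums with the nonnegative coefficients [a k - a k.+1] and the last
    [a], so partial sums of [c] may be replaced by a majorant. A constant [b] yields tail bounds, a
    growing one the behaviour at the singularity. *)
Lemma abel_bound (a c b : nat -> R) (m : nat) :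
  (forall k, a k.+1 <= a k) -> (forall k, 0 <= a k) -> b 0%N = 0 ->
  (forall k, `|\sum_(j < k) c j| <= b k) ->
  `|\sum_(k < m) a k * c k| <= \sum_(k < m) a k * (b k.+1 - b k).
Proof.
move=> ad a0 b0 cb; case: m => [|m]; first by rewrite !big_ord0 normr0.
rewrite (abel_sum a c) (abel_sum a (fun k => b k.+1 - b k)).
have bs k : \sum_(j < k) (b j.+1 - b j) = b k.
  by rewrite -(big_mkord xpredT (fun j => b j.+1 - b j)) telescope_sumr// b0 subr0.
rewrite (le_trans (ler_normD _ _))//; apply: lerD; last first.
  by rewrite normrM ger0_norm// ler_wpM2l// bs.
rewrite (le_trans (ler_norm_sum _ _ _))//; apply: ler_sum => k _.
by rewrite normrM ger0_norm ?subr_ge0// ler_wpM2l ?subr_ge0// bs.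
Qed.

End trig_aux.

(** * Even moments of bounded functions *)

Lemma Rintegral_bigsum (d : measure_display) (T : measurableType d) (R : realType)
    (mu : measure T R) (I : Type) (s : seq I) (Q : pred I) (F : I -> T -> R) :
  (forall i, Q i -> mu.-integrable setT (EFin \o F i)) ->
  mu.-integrable setT (EFin \o (fun x => \sum_(i <- s | Q i) F i x)) /\
  \int[mu]_x (\sum_(i <- s | Q i) F i x) = \sum_(i <- s | Q i) \int[mu]_x F i x.
Proof.
move=> iF; elim: s => [|i s [IHi IHs]].
  rewrite big_nil (_ : (fun _ => _) = cst 0); last by apply/funext => x; rewrite big_nil.
  by split; [exact: integrable0|rewrite /Rintegral integral0].
rewrite big_cons; have [Qi|Qi] := boolP (Q i).
  have -> : (fun x => \sum_(k <- i :: s | Q k) F k x) =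
      (fun x => F i x + \sum_(j <- s | Q j) F j x).
    by apply/funext => x; rewrite big_cons Qi.
  split; last by rewrite RintegralD ?IHs//; exact: iF.
  by apply: eq_integrable (integrableD measurableT (iF i Qi) IHi).
have -> // : (fun x => \sum_(k <- i :: s | Q k) F k x) = (fun x => \sum_(j <- s | Q j) F j x).
by apply/funext => x; rewrite big_cons (negbTE Qi).
Qed.

(** By induction: the next remainder is (s + g) times the present one plus (n+2) s^(n+1) g^2. The
    square in the constant is generous, so that (n+2)^2 + (n+2) <= (n+3)^2 closes the induction. *)
Lemma exprD_taylor2 (R : realDomainType) (n : nat) (s g : R) :
  `|(s + g) ^+ n.+2 - s ^+ n.+2 - n.+2%:R * s ^+ n.+1 * g| <=
  n.+2%:R ^+ 2 * (g ^+ 2 * (`|s| + `|g|) ^+ n).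
Proof.
elim: n => [|n IHn].
  rewrite expr0 mulr1 (_ : _ - _ = g ^+ 2); last by ring.
  rewrite ger0_norm ?sqr_ge0// -{1}[g ^+ 2]mul1r ler_wpM2r ?sqr_ge0//.
  by rewrite -natrX (ler_nat _ 1).
set X := (X in `|X| <= _) in IHn.
have -> : (s + g) ^+ n.+3 - s ^+ n.+3 - n.+3%:R * s ^+ n.+2 * g =
    (s + g) * X + n.+2%:R * s ^+ n.+1 * g ^+ 2.
  rewrite /X !exprS -[n.+3%:R]natr1; ring.
have sg0 : 0 <= `|s| + `|g| by rewrite addr_ge0.
apply: (@le_trans _ _ ((`|s| + `|g|) *
    (n.+2%:R ^+ 2 * (g ^+ 2 * (`|s| + `|g|) ^+ n)) +
    n.+2%:R * (`|s| + `|g|) ^+ n.+1 * g ^+ 2)).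
  apply: le_trans (ler_normD _ _) _; apply: lerD.
    by rewrite normrM; apply: ler_pM => //; rewrite ler_normD.
  rewrite normrM [`|g ^+ 2|]ger0_norm ?sqr_ge0// ler_wpM2r ?sqr_ge0//.
  rewrite normrM normr_nat ler_wpM2l// normrX lerXn2r ?nnegrE//.
  by rewrite lerDl.
rewrite ![(`|s| + `|g|) ^+ n.+1]exprS.
set Y := (`|s| + `|g|) ^+ n.
have Y0 : 0 <= (`|s| + `|g|) * Y * g ^+ 2.
  by rewrite mulr_ge0 ?sqr_ge0// mulr_ge0// exprn_ge0.
apply: (@le_trans _ _ ((n.+2%:R ^+ 2 + n.+2%:R) * ((`|s| + `|g|) * Y * g ^+ 2))).
  rewrite le_eqVlt; apply/orP; left; apply/eqP; ring.
apply: (@le_trans _ _ (n.+3%:R ^+ 2 * ((`|s| + `|g|) * Y * g ^+ 2))).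
  rewrite ler_wpM2r// -natrX -natrD -natrX ler_nat; nia.
by rewrite le_eqVlt; apply/orP; left; apply/eqP; ring.
Qed.

Lemma normD_exp_le (R : realDomainType) (k : nat) (s g : R) :
  (`|s| + `|g|) ^+ (2 * k) <= 4 ^+ k * (s ^+ (2 * k) + g ^+ (2 * k)).
Proof.
have four : 2 ^+ (2 * k) = 4 ^+ k :> R by rewrite exprM -natrX.
have sq x : `|x| ^+ (2 * k) = x ^+ (2 * k) :> R.
  by rewrite !exprM real_normK ?num_real.
have ge0 (x : R) : 0 <= x ^+ (2 * k) by rewrite exprM exprn_ge0// sqr_ge0.
have [sg|gs] := leP `|s| `|g|.
- apply: (@le_trans _ _ ((2 * `|g|) ^+ (2 * k))).
    rewrite lerXn2r ?nnegrE ?addr_ge0 ?mulr_ge0//.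
    by rewrite (_ : 2 * `|g| = `|g| + `|g|) ?lerD2r//; ring.
  by rewrite exprMn four ler_wpM2l ?exprn_ge0// sq lerDr.
- apply: (@le_trans _ _ ((2 * `|s|) ^+ (2 * k))).
    rewrite lerXn2r ?nnegrE ?addr_ge0 ?mulr_ge0//.
    by rewrite (_ : 2 * `|s| = `|s| + `|s|) ?lerD2l ?ltW//; ring.
  by rewrite exprMn four ler_wpM2l ?exprn_ge0// sq lerDl.
Qed.

(** The first-order term is kept exactly, because its integral is going to vanish; only the
    remainder is estimated. *)
Lemma exprD_even_le (R : realDomainType) (k : nat) (s g : R) :
  (s + g) ^+ (2 * k).+2 <= s ^+ (2 * k).+2
    + (2 * k).+2%:R * (s ^+ (2 * k).+1 * g)
    + (2 * k).+2%:R ^+ 2 * 4 ^+ k * (s ^+ (2 * k) * g ^+ 2 + g ^+ (2 * k).+2).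
Proof.
have := exprD_taylor2 _ (2 * k) s g; rewrite ler_norml => /andP[_].
have := normD_exp_le _ k s g.
set X := (2 * k).+2%:R; set Z := (_ + _) ^+ _ => hZ.
have {hZ} hZ : X ^+ 2 * (g ^+ 2 * Z) <=
    X ^+ 2 * (g ^+ 2 * (4 ^+ k * (s ^+ (2 * k) + g ^+ (2 * k)))).
  by rewrite ler_wpM2l ?sqr_ge0// ler_wpM2l ?sqr_ge0.
move=> /le_trans/(_ hZ); rewrite lerBlDr lerBlDr => /le_trans; apply.
rewrite le_eqVlt; apply/orP; left; apply/eqP.
by rewrite !(exprS _ (2 * k).+1) !(exprS _ (2 * k)); ring.
Qed.

Lemma sqr_wsum_le (R : realFieldType) (I : finType) (l y : I -> R) :
  (forall i, 0 <= l i) -> \sum_i l i = 1 ->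
  (\sum_i l i * y i) ^+ 2 <= \sum_i l i * y i ^+ 2.
Proof.
move=> l0 l1; set m := \sum_i l i * y i.
rewrite -subr_ge0.
have -> : \sum_i l i * y i ^+ 2 - m ^+ 2 = \sum_i l i * (y i - m) ^+ 2.
  have -> : \sum_i l i * (y i - m) ^+ 2 =
      \sum_i (l i * y i ^+ 2 - 2 * m * (l i * y i) + m ^+ 2 * l i).
    by apply: eq_bigr => i _; ring.
  rewrite big_split sumrB/= -!mulr_sumr l1 -/m; ring.
by apply: sumr_ge0 => i _; rewrite mulr_ge0// sqr_ge0.
Qed.

(** Jensen's inequality by iterating the variance inequality. The step from exponent 1 to 2 is
    separate, because squaring an inequality needs nonnegative sides and the first power has no
    sign. *)
Lemma exp2n_wsum_le (R : realFieldType) (I : finType) (l y : I -> R) (k : nat) :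
  (forall i, 0 <= l i) -> \sum_i l i = 1 ->
  (\sum_i l i * y i) ^+ (2 ^ k) <= \sum_i l i * y i ^+ (2 ^ k).
Proof.
move=> l0 l1; elim: k => [|k IHk]; first by rewrite expn0 expr1.
case: k IHk => [_|k IHk].
  by rewrite expn1; apply: sqr_wsum_le.
rewrite (expnSr 2 k.+1) exprM.
apply: (@le_trans _ _ ((\sum_i l i * y i ^+ (2 ^ k.+1)) ^+ 2)).
  rewrite lerXn2r ?nnegrE// ?sumr_ge0// => [|i _].
    by rewrite expnS exprM exprn_ge0// sqr_ge0.
  by rewrite mulr_ge0// expnS exprM exprn_ge0// sqr_ge0.
apply: le_trans (sqr_wsum_le _ _ _ _ l0 l1) _.
by apply: ler_sum => i _; rewrite exprM.
Qed.

(** These functions form a ring and are integrable for every probability, so that integrability side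
    conditions depend only on the shape of an expression. *)
Definition bounded_mfun d (T : measurableType d) (R : realType) (f : T -> R) :=
  measurable_fun [set: T] f /\ exists M : R, forall x, `|f x| <= M.

Section bounded_mfun.
Context d (T : measurableType d) (R : realType) (P : probability T R).
Implicit Types f g : T -> R.

Lemma bmf_cst (c : R) : bounded_mfun d T R (fun=> c).
Proof. by split => //; exists `|c|. Qed.

Lemma bmfD f g : bounded_mfun d T R f -> bounded_mfun d T R g ->
  bounded_mfun d T R (fun x => f x + g x).
Proof.
move=> [mf [M fM]] [mg [N gN]]; split; first exact: measurable_funD.
by exists (M + N) => x; rewrite (le_trans (ler_normD _ _))// lerD.
Qed.

Lemma bmfM f g : bounded_mfun d T R f -> bounded_mfun d T R g ->
  bounded_mfun d T R (fun x => f x * g x).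
Proof.
move=> [mf [M fM]] [mg [N gN]]; split; first exact: measurable_funM.
by exists (M * N) => x; rewrite normrM ler_pM.
Qed.

Lemma bmfZ (c : R) f : bounded_mfun d T R f -> bounded_mfun d T R (fun x => c * f x).
Proof. by move=> ?; apply: bmfM => //; exact: bmf_cst. Qed.

Lemma bmfX f n : bounded_mfun d T R f -> bounded_mfun d T R (fun x => f x ^+ n).
Proof.
move=> bf; elim: n => [|n IHn].
  by under eq_fun do rewrite expr0; exact: bmf_cst.
by under eq_fun do rewrite exprS; exact: bmfM.
Qed.

Lemma bmf_sum (I : Type) (s : seq I) (Q : pred I) (F : I -> T -> R) :
  (forall i, Q i -> bounded_mfun d T R (F i)) ->
  bounded_mfun d T R (fun x => \sum_(i <- s | Q i) F i x).
Proof.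
move=> bF; elim: s => [|i s IHs].
  by under eq_fun do rewrite big_nil; exact: bmf_cst.
have [Qi|Qi] := boolP (Q i).
  by under eq_fun do rewrite big_cons Qi; apply: bmfD => //; exact: bF.
by under eq_fun do rewrite big_cons (negbTE Qi).
Qed.

Lemma bmf_integrable f : bounded_mfun d T R f -> P.-integrable setT (EFin \o f).
Proof.
move=> [mf [M fM]]; apply: measurable_bounded_integrable => //.
- by rewrite (le_lt_trans (probability_le1 _ _))// ltry.
exists `|M|; split; first by rewrite num_real.
move=> y My x _ /=; apply: (le_trans (fM x)).
by rewrite ltW// (le_lt_trans _ My)// ler_norm.
Qed.

Lemma bmf_RintegralD f g : bounded_mfun d T R f -> bounded_mfun d T R g ->
  \int[P]_x (f x + g x) = \int[P]_x f x + \int[P]_x g x.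
Proof. by move=> bf bg; rewrite RintegralD//; exact: bmf_integrable. Qed.

Lemma bmf_RintegralZ (c : R) f : bounded_mfun d T R f ->
  \int[P]_x (c * f x) = c * \int[P]_x f x.
Proof. by move=> bf; rewrite RintegralZl//; exact: bmf_integrable. Qed.

Lemma bmf_Rintegral_sum (I : Type) (s : seq I) (Q : pred I) (F : I -> T -> R) :
  (forall i, Q i -> bounded_mfun d T R (F i)) ->
  \int[P]_x (\sum_(i <- s | Q i) F i x) = \sum_(i <- s | Q i) \int[P]_x F i x.
Proof.
move=> bF; apply: (Rintegral_bigsum _ _ _ _ _ _ _ _ _).2 => i Qi.
by apply: bmf_integrable; exact: bF.
Qed.

Lemma bmf_Rintegral_le f g : bounded_mfun d T R f -> bounded_mfun d T R g ->
  (forall x, f x <= g x) -> \int[P]_x f x <= \int[P]_x g x.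
Proof.
by move=> bf bg fg; apply: le_Rintegral => //; exact: bmf_integrable.
Qed.

Lemma bmf_Rintegral_cst (c : R) : \int[P]_x (fun=> c) x = c.
Proof.
rewrite Rintegral_cst//= -[RHS]mulr1; congr (_ * _).
by rewrite probability_setT.
Qed.

End bounded_mfun.

Ltac solve_bmf := repeat first
  [assumption | exact: bmf_cst | apply: bmfX | apply: bmfD | apply: bmfZ | apply: bmfM].

Section moments.
Context d (T : measurableType d) (R : realType) (P : probability T R).
Implicit Types f g : T -> R.

(** [A] bounds the square of the norm in L_(2k+2), the quantity that is additive under
    2-smoothness. *)
Definition moment_bound k f (A : R) := \int[P]_x (f x ^+ (2 * k).+2) <= A ^+ k.+1.

Definition type2_cst k : R := 3 * ((2 * k).+2%:R ^+ 2 * 4 ^+ k).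

Lemma type2_cst_ge1 k : 1 <= type2_cst k.
Proof.
have h1 : 1 <= (2 * k).+2%:R ^+ 2 :> R by rewrite -natrX ler1n; nia.
have h2 : 1 <= 4 ^+ k :> R by rewrite exprn_ege1// ler1n.
by rewrite /type2_cst; nra.
Qed.

(* The conditional mean zero of [G] kills the first-order term; this is the
   2-smoothness of L_p for an even integer p. *)
Lemma moment_bound_orthoD k (S G : T -> R) (A B : R) :
  bounded_mfun d T R S -> bounded_mfun d T R G -> 0 < A -> 0 < B ->
  \int[P]_x (S x ^+ (2 * k).+1 * G x) = 0 ->
  moment_bound k S A -> moment_bound k G B ->
  moment_bound k (fun x => S x + G x) (A + type2_cst k * B).
Proof.
move=> bS bG A0 B0 SG0 SA GB; rewrite /moment_bound.
pose C : R := (2 * k).+2%:R ^+ 2 * 4 ^+ k.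
have C1 : 1 <= C.
  have h1 : 1 <= (2 * k).+2%:R ^+ 2 :> R by rewrite -natrX ler1n; nia.
  have h2 : 1 <= 4 ^+ k :> R by rewrite exprn_ege1// ler1n.
  by rewrite /C; nra.
(* Put X = S^2/A and Y = G^2/B, whose moments of order k+1 are at most 1; X^k Y is at most the
   larger of X^(k+1) and Y^(k+1). *)
have Young x : S x ^+ (2 * k) * G x ^+ 2 <= A ^+ k * B *
    ((A ^- k.+1) * S x ^+ (2 * k).+2 + (B ^- k.+1) * G x ^+ (2 * k).+2).
  set X := S x ^+ 2 / A; set Y := G x ^+ 2 / B.
  have X0 : 0 <= X by rewrite divr_ge0 ?sqr_ge0// ltW.
  have Y0 : 0 <= Y by rewrite divr_ge0 ?sqr_ge0// ltW.
  have XY : X ^+ k * Y <= X ^+ k.+1 + Y ^+ k.+1.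
    have [xy|yx] := leP X Y.
      rewrite (@le_trans _ _ (Y ^+ k.+1))// ?lerDr ?exprn_ge0//.
      by rewrite exprSr ler_wpM2r// lerXn2r.
    rewrite (@le_trans _ _ (X ^+ k.+1))// ?lerDl ?exprn_ge0//.
    by rewrite exprSr ler_wpM2l ?exprn_ge0// ltW.
  have -> : S x ^+ (2 * k) * G x ^+ 2 = A ^+ k * B * (X ^+ k * Y).
    rewrite /X /Y expr_div_n -exprM; field.
    by rewrite ?expf_neq0 ?(gt_eqF A0) ?(gt_eqF B0).
  have -> : A ^- k.+1 * S x ^+ (2 * k).+2 + B ^- k.+1 * G x ^+ (2 * k).+2 =
      X ^+ k.+1 + Y ^+ k.+1.
    rewrite /X /Y !expr_div_n -!exprM (_ : (2 * k.+1 = (2 * k).+2)%N); last by lia.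
    by rewrite mulrC [X in _ + X]mulrC.
  by rewrite ler_wpM2l// mulr_ge0 ?exprn_ge0// ltW.
have SX n : bounded_mfun d T R (fun x => S x ^+ n) by exact: bmfX.
have GX n : bounded_mfun d T R (fun x => G x ^+ n) by exact: bmfX.
apply: (@le_trans _ _ (\int[P]_x (S x ^+ (2 * k).+2
    + ((2 * k).+2%:R * (S x ^+ (2 * k).+1 * G x)
    + C * (A ^+ k * B *
    (A ^- k.+1 * S x ^+ (2 * k).+2 + B ^- k.+1 * G x ^+ (2 * k).+2) +
    G x ^+ (2 * k).+2))))).
  apply: bmf_Rintegral_le.
  - by apply: bmfX; exact: bmfD.
  - by solve_bmf.
  - move=> x; apply: (le_trans (exprD_even_le _ _ _ _)).
    rewrite -addrA lerD2l lerD2l ler_wpM2l ?(le_trans ler01 C1)//.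
    by rewrite lerD2r.
rewrite bmf_RintegralD//; last first.
  by solve_bmf.
rewrite bmf_RintegralD//; last 2 first.
- by solve_bmf.
- by solve_bmf.
rewrite bmf_RintegralZ; last by apply: bmfM.
rewrite SG0 mulr0 add0r.
rewrite bmf_RintegralZ; last first.
  by solve_bmf.
rewrite bmf_RintegralD//; last first.
  by solve_bmf.
rewrite bmf_RintegralZ; last first.
  by solve_bmf.
rewrite bmf_RintegralD//; last 2 first.
- by apply: bmfZ.
- by apply: bmfZ.
rewrite !bmf_RintegralZ//.
set IS := \int[P]_x _; set IG := \int[P]_x _.
have A0' : 0 < A ^+ k.+1 by rewrite exprn_gt0.
have B0' : 0 < B ^+ k.+1 by rewrite exprn_gt0.
have h1 : A ^- k.+1 * IS + B ^- k.+1 * IG <= 2.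
  rewrite (_ : 2 = 1 + 1)//; apply: lerD.
    by rewrite mulrC ler_pdivrMr// mul1r.
  by rewrite mulrC ler_pdivrMr// mul1r.
have AB : 0 <= A ^+ k * B by rewrite mulr_ge0 ?exprn_ge0// ltW.
apply: (@le_trans _ _ (A ^+ k.+1 + C * (A ^+ k * B * 2 + B ^+ k.+1))).
  rewrite lerD// ler_wpM2l ?(le_trans ler01 C1)// lerD//.
  by rewrite ler_wpM2l.
(* Splitting one factor off (A + Y)^(k+1) leaves A (A + Y)^k for the main term; the 3 in Y = 3 C B
   pays for 2 A^k + B^k. *)
rewrite /type2_cst -/C; set Y := 3 * C * B.
have Y0 : 0 <= Y by rewrite !mulr_ge0 ?(le_trans ler01 C1) ?ltW.
rewrite [leRHS]exprS mulrDl.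
have AY : A ^+ k <= (A + Y) ^+ k.
  by rewrite lerXn2r ?nnegrE ?addr_ge0 ?(ltW A0)// lerDl.
have BY : B ^+ k <= (A + Y) ^+ k.
  rewrite lerXn2r ?nnegrE ?addr_ge0 ?(ltW A0) ?(ltW B0)//.
  by rewrite /Y; nra.
apply: lerD; first by rewrite exprS ler_wpM2l// ltW.
have -> : C * (A ^+ k * B * 2 + B ^+ k.+1) = C * B * (2 * A ^+ k + B ^+ k).
  by rewrite exprS; ring.
have -> : Y * (A + Y) ^+ k = C * B * (3 * (A + Y) ^+ k) by rewrite /Y; ring.
rewrite ler_wpM2l ?mulr_ge0 ?(le_trans ler01 C1) ?(ltW B0)//.
rewrite (_ : 3 * _ = 2 * (A + Y) ^+ k + (A + Y) ^+ k); last by ring.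
by rewrite lerD// ler_wpM2l.
Qed.

End moments.

Lemma bmf_shift (R : realType) (f : R -> R) (t : R) :
  bounded_mfun _ (measurableTypeR R) R f ->
  bounded_mfun _ (measurableTypeR R) R (fun y => f (y - t)).
Proof.
move=> [mf [M fM]]; split; last by exists M => y; exact: fM.
by apply: (measurableT_comp (f := f)) => //; exact: measurable_funB.
Qed.

(** * Integration on the torus *)

Section torus_integral.
Variable R : realType.

Definition uprob : probability (measurableTypeR R) R := uniform_prob (two_pi_gt0 R).

Lemma integrable_prodM d1 d2 (T1 : measurableType d1) (T2 : measurableType d2)
    (P1 : probability T1 R) (P2 : probability T2 R) (f : T1 -> R) (g : T2 -> R) :
  P1.-integrable setT (EFin \o f) -> P2.-integrable setT (EFin \o g) ->
  (P1 \x P2)%E.-integrable setT (fun z => (f z.1 * g z.2)%:E) /\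
  (\int[(P1 \x P2)%E]_z (f z.1 * g z.2)%:E =
   (\int[P1]_x f x * \int[P2]_y g y)%:E)%E.
Proof.
move=> fi gi.
have mf : measurable_fun [set: T1] f by move/integrableP : fi => [/measurable_EFinP].
have mg : measurable_fun [set: T2] g by move/integrableP : gi => [/measurable_EFinP].
have mfg : measurable_fun [set: T1 * T2] (fun z => (f z.1 * g z.2)%:E).
  apply/measurable_EFinP; apply: measurable_funM.
    exact: measurableT_comp.
  exact: measurableT_comp.
have ifg : (P1 \x P2)%E.-integrable setT (fun z => (f z.1 * g z.2)%:E).
  apply/integrable12ltyP => //=.
  under eq_integral => x _.
    under eq_integral => y _ do rewrite normrM EFinM.
    rewrite ge0_integralZl//; last first.
      by apply/measurable_EFinP; exact: measurableT_comp.
    over.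
  rewrite ge0_integralZr//; last 2 first.
  - by apply/measurable_EFinP; exact: measurableT_comp.
  - exact: integral_ge0.
  apply: lte_mul_pinfty.
  - exact: integral_ge0.
  - move/integrableP : fi => [_ h].
    rewrite ge0_fin_numE//; exact: integral_ge0.
  - by move/integrableP : gi => [_ h].
split => //.
have := integral12_prod_meas1 ifg => <-; rewrite /fubini_F/=.
under eq_integral => x _.
  under eq_integral => y _ do rewrite EFinM.
  rewrite (integralZl measurableT gi).
  over.
rewrite /= EFinM.
have -> : (\int[P2]_y g y)%:E = (\int[P2]_y (EFin \o g) y)%E.
  by rewrite fineK//; exact: integrable_fin_num.
have -> : (\int[P1]_y f y)%:E = (\int[P1]_y (EFin \o f) y)%E.
  by rewrite fineK//; exact: integrable_fin_num.
have hg : (\int[P2]_y (EFin \o g) y)%E \is a fin_num by exact: integrable_fin_num.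
by rewrite -(fineK hg) integralZr.
Qed.

Lemma torus_tensor d (h : 'I_d -> R -> R) :
  (forall j, uprob.-integrable setT (EFin \o h j)) ->
  (torus_prob R d).-integrable setT (fun x => (\prod_(j < d) h j (tnth x j))%:E) /\
  \int[torus_prob R d]_x (\prod_(j < d) h j (tnth x j)) =
    \prod_(j < d) \int[uprob]_x h j x.
Proof.
elim: d h => [|d IHd] h ih.
  under eq_fun do rewrite big_ord0.
  under eq_Rintegral do rewrite big_ord0.
  split; first by apply: bmf_integrable; exact: bmf_cst.
  by rewrite big_ord0 bmf_Rintegral_cst.
have [ig Ig] := IHd (fun j => h (lift ord0 j)) (fun j => ih (lift ord0 j)).
have [ih0 Ih0] := integrable_prodM _ _ _ _ _ _ _ _ (ih ord0) ig.
have E : (fun z : measurableTypeR R * euclidean R d =>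
    (h ord0 z.1 * \prod_(j < d) h (lift ord0 j) (tnth z.2 j))%:E) =
    (fun x : euclidean R d.+1 => (\prod_(j < d.+1) h j (tnth x j))%:E) \o @pcons R d.
  apply/funext => z /=; rewrite big_ord_recl; congr (_ * _)%:E.
  by apply: eq_bigr => j _; congr (h _ _); rewrite tnthS.
have mh : measurable_fun [set: euclidean R d.+1]
    (fun x : euclidean R d.+1 => (\prod_(j < d.+1) h j (tnth x j))%:E).
  apply/measurable_EFinP; apply: measurable_prod => j _.
  apply: (measurableT_comp (f := h j)); last exact: measurable_tnth.
  by have /integrableP[/measurable_EFinP] := ih j.
have mp := @measurable_pcons R d.
rewrite E in ih0 Ih0.
split.
  by apply: (integrable_pushforward mp mh) => //; rewrite preimage_setT.
rewrite {1}/Rintegral /= (integral_pushforward mp mh) => //; rewrite preimage_setT//.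
by rewrite Ih0 /= big_ord_recl Ig.
Qed.

End torus_integral.

(** * Periodicity and means of cosines *)

Section trig_means.
Variable R : realType.
Local Notation U := (uprob R).

Lemma cosD_nat2pi (n : nat) (x : R) : cos (x + n%:R * (2 * pi)) = cos x.
Proof.
have -> : x + n%:R * (2 * pi) = x + (pi *+ 2) *+ n.
  by rewrite -(mulr_natl (pi *+ 2) n) -(mulr_natl (pi : R) 2).
exact: (periodicn (@cosD2pi R)).
Qed.

Lemma cosD_int2pi (k : int) (x : R) : cos (x + k%:~R * (2 * pi)) = cos x.
Proof.
case: k => n; first exact: cosD_nat2pi.
rewrite NegzE mulrNz mulNr.
have := cosD_nat2pi n.+1 (x - n.+1%:R * (2 * pi)).
by rewrite subrK.
Qed.

Lemma sinD_int2pi (k : int) (x : R) : sin (x + k%:~R * (2 * pi)) = sin x.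
Proof.
have := cosD_int2pi k (x - pi / 2).
by rewrite addrAC (cosBpihalf (x + _)) (cosBpihalf x).
Qed.

Lemma continuous_cos_lin (a b : R) : continuous (fun x : R => cos (a * x + b)).
Proof.
move=> x; apply: (@continuous_comp _ _ _ (fun x => a * x + b) (@cos R)); last exact: continuous_cos.
apply: continuousD; last exact: cst_continuous.
by apply: continuousM; [exact: cst_continuous|exact: id].
Qed.

Lemma bmf_cos (a b : R) : bounded_mfun _ (measurableTypeR R) R (fun x => cos (a * x + b)).
Proof.
split; first by apply: continuous_measurable_fun; exact: continuous_cos_lin.
by exists 1 => x; rewrite ler_norml cos_geN1 cos_le1.
Qed.

Lemma cos_mean0 (k : int) (b : R) : k != 0 -> \int[U]_x cos (k%:~R * x + b) = 0.
Proof.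
move=> k0; have kR0 : k%:~R != 0 :> R by rewrite intr_eq0.
have pi2 := two_pi_gt0 R.
have mc : measurable_fun [set: measurableTypeR R] (fun x : R => 1 + cos (k%:~R * x + b)).
  by apply: measurable_funD => //; have [] := bmf_cos k%:~R b.
(* Adding 1 makes the integrand nonnegative, as [integral_uniform] requires. *)
suff : \int[U]_x (1 + cos (k%:~R * x + b)) = 1.
  rewrite bmf_RintegralD; [|exact: bmf_cst|exact: bmf_cos].
  rewrite bmf_Rintegral_cst => h; lra.
pose F (x : R) := x + k%:~R^-1 * sin (k%:~R * x + b).
have dF (x : R) : is_derive x 1 F (1 + cos (k%:~R * x + b)).
  rewrite /F; apply: is_derive_eq.
  by rewrite /GRing.scale /=; field.
rewrite /Rintegral integral_uniform; last 2 first.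
- by apply/measurable_EFinP.
- by move=> x; rewrite lee_fin -lerBlDl sub0r cos_geN1.
rewrite (@continuous_FTC2 _ _ F 0 (2 * pi))//; last 3 first.
- apply: continuous_subspaceT => x; apply: continuousD; first exact: cst_continuous.
  exact: continuous_cos_lin.
- have cF x : {for x, continuous F}.
    by apply: differentiable_continuous; apply/derivable1_diffP; have [] := dF x.
  split.
  + by move=> x _; have [] := dF x.
  + by apply: cvg_at_right_filter; exact: cF.
  + by apply: cvg_at_left_filter; exact: cF.
- by move=> x _; rewrite derive1E; apply: derive_val.
rewrite -EFinB -EFinM /= /F.
have -> : sin (k%:~R * (2 * pi) + b) = sin (k%:~R * 0 + b) :> R.
  by rewrite mulr0 add0r addrC sinD_int2pi.
set c := _^-1 * sin _.
have -> : 2 * pi + c - (0 + c) = 2 * pi :> R by ring.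
by rewrite subr0 mulVf// gt_eqF.
Qed.

End trig_means.

(** * Lacunary sums of trigonometric polynomials *)

Section trig_span.
Variable R : realType.
Local Notation U := (uprob R).

(** Finite sums of cosines with arbitrary phases and frequencies in [Q]. Only the set of frequencies
    is tracked, not the coefficients: that is all that products and vanishing means depend on. *)
Inductive trig (Q : int -> bool) : (R -> R) -> Prop :=
| trig0 h : (forall x, h x = 0) -> trig Q h
| trigS c k b g h : Q k -> trig Q g ->
    (forall x, h x = c * cos (k%:~R * x + b) + g x) -> trig Q h.

Lemma trigD Q f g h : trig Q f -> trig Q g -> (forall x, h x = f x + g x) -> trig Q h.
Proof.
move=> tf; elim: tf g h => {f} [f f0|c k b f' f Qk _ IH E] g h tg hE.
  suff -> : h = g by [].
  by apply/funext => x; rewrite hE f0 add0r.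
apply: (@trigS Q c k b (fun x => f' x + g x)) => //; first exact: (IH _ _ tg).
by move=> x; rewrite hE E addrA.
Qed.

Lemma trig_cos (Q : int -> bool) c k b : Q k -> trig Q (fun x => c * cos (k%:~R * x + b)).
Proof.
move=> Qk; apply: (@trigS Q c k b (fun=> 0)) => //; first by apply: trig0.
by move=> x; rewrite addr0.
Qed.

Lemma trig_sum Q (I : Type) (s : seq I) (P : pred I) (F : I -> R -> R) :
  (forall i, P i -> trig Q (F i)) -> trig Q (fun x => \sum_(i <- s | P i) F i x).
Proof.
move=> tF; elim: s => [|i s IHs]; first by apply: trig0 => x; rewrite big_nil.
have [Pi|Pi] := boolP (P i).
  by apply: (trigD _ _ _ _ (tF i Pi) IHs) => x; rewrite big_cons Pi.
by under eq_fun do rewrite big_cons (negbTE Pi).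
Qed.

Lemma trigM (Q1 Q2 Q : int -> bool) f g :
  (forall k l, Q1 k -> Q2 l -> Q (k + l) /\ Q (k - l)) ->
  trig Q1 f -> trig Q2 g -> trig Q (fun x => f x * g x).
Proof.
move=> QQ tf tg; elim: tf => {f} [f f0|c k b f' f Qk _ IH E].
  by apply: trig0 => x; rewrite f0 mul0r.
have tcg : trig Q (fun x => c * cos (k%:~R * x + b) * g x).
  elim: tg {IH} => {g} [g g0|c' l b' g' g Ql _ IH E'].
    by apply: trig0 => x; rewrite g0 mulr0.
  have [Qp Qm] := QQ _ _ Qk Ql.
  apply: (trigD _ _ _ _ (trig_cos Q (c * c' / 2) (k + l) (b + b') Qp)
    (trigD _ _ _ _ (trig_cos Q (c * c' / 2) (k - l) (b - b') Qm) IH (fun=> erefl))) => x.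
  rewrite /= E' rmorphD rmorphB /=.
  have -> : (k%:~R + l%:~R) * x + (b + b') = (k%:~R * x + b) + (l%:~R * x + b') by ring.
  have -> : (k%:~R - l%:~R) * x + (b - b') = (k%:~R * x + b) - (l%:~R * x + b') by ring.
  set y := _ + b; set y' := _ + b'.
  by rewrite (cosD y) (cosB y); field.
by apply: (trigD _ _ _ _ tcg IH) => x; rewrite E mulrDl.
Qed.

Lemma trig_sub (Q Q' : int -> bool) f : (forall k, Q k -> Q' k) -> trig Q f -> trig Q' f.
Proof.
move=> QQ'; elim=> {f} [f f0|c k b f' f Qk _ IH E]; first exact: trig0.
exact: (@trigS Q' c k b f' f (QQ' _ Qk)).
Qed.

Lemma trig_bmf Q f : trig Q f -> bounded_mfun _ (measurableTypeR R) R f.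
Proof.
elim=> {f} [f f0|c k b f' f _ _ IH E].
  have -> : f = fun=> 0 by apply/funext.
  exact: bmf_cst.
have -> : f = fun x => c * cos (k%:~R * x + b) + f' x by apply/funext.
by apply: bmfD => //; apply: bmfZ; exact: bmf_cos.
Qed.

Lemma trig_mean0 (Q : int -> bool) f : ~~ Q 0 -> trig Q f -> \int[U]_x f x = 0.
Proof.
move=> Q0; elim=> {f} [f f0|c k b f' f Qk tf IH E].
  by under eq_Rintegral do rewrite f0; rewrite bmf_Rintegral_cst.
under eq_Rintegral do rewrite E.
have bc := bmf_cos R k%:~R b.
rewrite bmf_RintegralD; [|exact: bmfZ|exact: (trig_bmf _ _ tf)].
rewrite IH addr0 bmf_RintegralZ// cos_mean0 ?mulr0//.
by apply: contraNneq Q0 => <-.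
Qed.

Variable d : nat.
Local Notation mu := (torus_prob R d).
Local Notation E := (euclidean R d).

(** Finite sums of tensor products whose factor in coordinate j has its frequencies in [P j]. *)
Inductive tspan (P : 'I_d -> int -> bool) : (E -> R) -> Prop :=
| tspan0 f : (forall x, f x = 0) -> tspan P f
| tspanS h g f : (forall j, trig (P j) (h j)) -> tspan P g ->
    (forall x, f x = \prod_(j < d) h j (tnth x j) + g x) -> tspan P f.

Lemma tspanD P f g h : tspan P f -> tspan P g -> (forall x, h x = f x + g x) -> tspan P h.
Proof.
move=> tf; elim: tf g h => {f} [f f0|t f' f Pt _ IH Ef] g h tg hE.
  suff -> : h = g by [].
  by apply/funext => x; rewrite hE f0 add0r.
apply: (@tspanS P t (fun x => f' x + g x)) => //; first exact: (IH _ _ tg).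
by move=> x; rewrite hE Ef addrA.
Qed.

Lemma tspan_prod P h : (forall j, trig (P j) (h j)) ->
  tspan P (fun x => \prod_(j < d) h j (tnth x j)).
Proof.
move=> Ph; apply: (@tspanS P h (fun=> 0)) => //; first exact: tspan0.
by move=> x; rewrite addr0.
Qed.

Lemma tspan_sum P (I : Type) (s : seq I) (B : pred I) (F : I -> E -> R) :
  (forall i, B i -> tspan P (F i)) -> tspan P (fun x => \sum_(i <- s | B i) F i x).
Proof.
move=> tF; elim: s => [|i s IHs]; first by apply: tspan0 => x; rewrite big_nil.
have [Bi|Bi] := boolP (B i).
  by apply: (tspanD _ _ _ _ (tF i Bi) IHs) => x; rewrite big_cons Bi.
by under eq_fun do rewrite big_cons (negbTE Bi).
Qed.

Lemma tspanM (P1 P2 P : 'I_d -> int -> bool) f g :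
  (forall j k l, P1 j k -> P2 j l -> P j (k + l) /\ P j (k - l)) ->
  tspan P1 f -> tspan P2 g -> tspan P (fun x => f x * g x).
Proof.
move=> PP tf tg; elim: tf => {f} [f f0|t f' f Pt _ IH Ef].
  by apply: tspan0 => x; rewrite f0 mul0r.
have ttg : tspan P (fun x => \prod_(j < d) t j (tnth x j) * g x).
  elim: tg {IH} => {g} [g g0|t' g' g Pt' _ IH Eg].
    by apply: tspan0 => x; rewrite g0 mulr0.
  apply: (@tspanS P (fun j x => t j x * t' j x) _ _ _ IH).
    by move=> j; apply: (trigM (P1 j) (P2 j)) => //; exact: PP.
  by move=> x; rewrite Eg mulrDr big_split.
by apply: (tspanD _ _ _ _ ttg IH) => x; rewrite Ef mulrDl.
Qed.

Lemma tspan_bmf P f : tspan P f -> bounded_mfun _ E R f.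
Proof.
elim=> {f} [f f0|t f' f Pt _ IH Ef].
  have -> : f = fun=> 0 by apply/funext.
  exact: bmf_cst.
have -> : f = fun x => \prod_(j < d) t j (tnth x j) + f' x by apply/funext.
apply: bmfD => //; split.
  apply: measurable_prod => j _.
  apply: (measurableT_comp (f := t j)); last exact: measurable_tnth.
  by have [] := trig_bmf _ _ (Pt j).
have /fin_all_exists[M hM] j : exists M : R, forall x, `|t j x| <= M.
  by have [] := trig_bmf _ _ (Pt j).
exists (\prod_(j < d) M j) => x; rewrite normr_prod.
by apply: ler_prod => j _; rewrite normr_ge0 hM.
Qed.

Lemma tspan_mean0 (P : 'I_d -> int -> bool) j f : ~~ P j 0 -> tspan P f ->
  \int[mu]_x f x = 0.
Proof.
move=> P0; elim=> {f} [f f0|t f' f Pt tf IH Ef].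
  by under eq_Rintegral do rewrite f0; rewrite bmf_Rintegral_cst.
under eq_Rintegral do rewrite Ef.
rewrite bmf_RintegralD; [|exact: (tspan_bmf _ _ (tspan_prod _ _ Pt))|exact: (tspan_bmf _ _ tf)].
rewrite IH addr0.
have [_ ->] := torus_tensor _ _ t (fun i => bmf_integrable _ _ _ U _ (trig_bmf _ _ (Pt i))).
by rewrite (bigD1 j)//= (trig_mean0 (P j))// mul0r.
Qed.

(* For [D = 0] no frequency is low, and [tspan (low_freq j 0)] only contains [0]. *)
Definition low_freq (j : 'I_d) (D : nat) (i : 'I_d) (k : int) := (i == j) ==> (`|k| < D)%N.
Definition high_freq (j : 'I_d) (D : nat) (i : 'I_d) (k : int) := (i == j) ==> (D <= `|k|)%N.

Lemma tspan_low_exp j D f m : tspan (low_freq j D) f ->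
  tspan (low_freq j (m.+1 * D)) (fun x => f x ^+ m.+1).
Proof.
move=> tf; elim: m => [|m IHm]; first by under eq_fun do rewrite expr1; rewrite mul1n.
under eq_fun do rewrite exprS.
apply: (tspanM _ _ _ _ _ _ tf IHm) => i k l; rewrite /low_freq.
by case: (i == j) => //=; lia.
Qed.

(** In coordinate j the power has frequencies below (m+1) D in absolute value and [g] has none
    there, so their product lacks the frequency 0 in that coordinate. *)
Lemma ortho_low_high j (m D : nat) f g :
  tspan (low_freq j D) f -> tspan (high_freq j (m.+1 * D)) g ->
  \int[mu]_x (f x ^+ m.+1 * g x) = 0.
Proof.
move=> tf tg.
apply: (tspan_mean0 (high_freq j 1) j); first by rewrite /high_freq eqxx.
apply: (tspanM _ _ _ _ _ _ (tspan_low_exp _ _ _ m tf) tg) => i k l.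
by rewrite /low_freq /high_freq; case: (i == j) => //=; lia.
Qed.

Lemma moment_boundW k f (A B : R) : 0 <= A -> A <= B ->
  moment_bound _ _ _ mu k f A -> moment_bound _ _ _ mu k f B.
Proof.
move=> A0 AB; rewrite /moment_bound => /le_trans; apply.
by rewrite lerXn2r// nnegrE (le_trans A0).
Qed.

(** Induction on the coordinates. For the first one the indices are added level by level: the lower
    levels are of low frequency, the new level of high frequency, and inside one level the other
    coordinates are handled by induction. In [moment_bound_orthoD] the bound for the lower levels
    enters with coefficient 1, so the factor [type2_cst] is paid once per coordinate and not once
    per level. *)
Lemma moment_bound_lacunary (I : finType) (g : I -> E -> R) (k : nat) (A : R)
    (lev : 'I_d -> I -> nat) (js : seq 'I_d) (Om : {set I}) :
  0 < A -> (forall i, bounded_mfun _ E R (g i)) ->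
  (forall i, moment_bound _ _ _ mu k (g i) A) ->
  (forall j K, j \in js -> exists D,
     (forall i, (lev j i < K)%N -> tspan (low_freq j D) (g i)) /\
     (forall i, lev j i = K -> tspan (high_freq j ((2 * k).+1 * D)) (g i))) ->
  (forall i i', i \in Om -> i' \in Om ->
     (forall j, j \in js -> lev j i = lev j i') -> i = i') ->
  (0 < #|Om|)%N ->
  moment_bound _ _ _ mu k (fun x => \sum_(i in Om) g i x)
    (type2_cst R k ^+ size js * (#|Om|%:R * A)).
Proof.
move=> A0 bg mg; have C1 := type2_cst_ge1 R k.
have C0 : 0 < type2_cst R k by exact: lt_le_trans C1.
elim: js Om => [|j js IHjs] Om lac inj Om0.
  rewrite expr0 mul1r.
  have /cards1P[i ->] : #|Om| == 1%N.
    rewrite eqn_leq Om0 andbT; apply/card_le1_eqP => i i' iOm i'Om.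
    by apply: inj.
  by under eq_fun do rewrite big_set1; rewrite cards1 mul1r.
have IHjs' (Om' : {set I}) : Om' \subset Om -> (0 < #|Om'|)%N ->
    (forall i i', i \in Om' -> i' \in Om' -> lev j i = lev j i') ->
    moment_bound _ _ _ mu k (fun x => \sum_(i in Om') g i x)
      (type2_cst R k ^+ size js * (#|Om'|%:R * A)).
  move=> sub Om'0 cst; apply: IHjs => //.
    by move=> j' K j'js; apply: lac; rewrite inE j'js orbT.
  move=> i i' iO i'O e; apply: inj; [exact: (fintype.subsetP sub)|exact: (fintype.subsetP sub)|].
  by move=> j'; rewrite inE => /predU1P[->|/e//]; exact: cst.
suff main K (Om' : {set I}) : Om' \subset Om -> (0 < #|Om'|)%N ->
    (forall i, i \in Om' -> (lev j i < K)%N) ->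
    moment_bound _ _ _ mu k (fun x => \sum_(i in Om') g i x)
      (type2_cst R k ^+ (size js).+1 * (#|Om'|%:R * A)).
  apply: (main (\max_(i in Om) lev j i).+1) => // i iO.
  by rewrite ltnS; exact: (leq_bigmax_cond (F := lev j)).
elim: K Om' => [|K IHK] Om' sub Om'0 levK.
  by move: Om'0; rewrite card_gt0 => /set0Pn[i /levK].
pose OK := [set i in Om' | lev j i == K].
pose OL := [set i in Om' | (lev j i < K)%N].
have OKs : OK \subset Om by rewrite (fintype.subset_trans _ sub)//; apply/fintype.subsetP => i; rewrite inE => /andP[].
have OLs : OL \subset Om by rewrite (fintype.subset_trans _ sub)//; apply/fintype.subsetP => i; rewrite inE => /andP[].
have eL i : (i \in OL) = (i \in Om') && (lev j i < K)%N by rewrite inE.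
have eK i : (i \in OK) = (i \in Om') && ~~ (lev j i < K)%N.
  rewrite inE; case: (boolP (i \in Om')) => //= /levK; lia.
have cO : #|Om'| = (#|OL| + #|OK|)%N.
  rewrite -!sum1_card (bigID (fun i => (lev j i < K)%N)) /=.
  by congr (_ + _)%N; apply: eq_bigl => i; rewrite ?eL ?eK.
have [OK0|OKn] := posnP #|OK|.
  apply: IHK => // i iO; have := levK i iO; rewrite ltnS leq_eqVlt => /predU1P[e|//].
  by move/eqP: OK0; rewrite cards_eq0 => /eqP/setP/(_ i); rewrite !inE iO e eqxx.
have mK := IHjs' OK OKs OKn (fun i i' =>
  ltac:(by rewrite !inE => /andP[_ /eqP ->] /andP[_ /eqP ->])).
have [OL0|OLn] := posnP #|OL|.
  have -> : Om' = OK.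
    apply/setP => i; rewrite eK; move/eqP: OL0; rewrite cards_eq0 => /eqP/setP/(_ i).
    by rewrite eL finset.in_set0; case: (i \in Om') => //= ->.
  apply: (moment_boundW _ _ _ _ _ _ mK).
    by rewrite mulr_ge0 ?exprn_ge0 ?mulr_ge0// ltW.
  by rewrite exprS -mulrA ler_peMl// mulr_ge0 ?exprn_ge0 ?mulr_ge0// ltW.
have mL := IHK OL OLs OLn (fun i => ltac:(by rewrite !inE => /andP[])).
have -> : (fun x => \sum_(i in Om') g i x) =
    (fun x => \sum_(i in OL) g i x + \sum_(i in OK) g i x).
  apply/funext => x; rewrite (bigID (fun i => (lev j i < K)%N)) /=.
  by congr (_ + _); apply: eq_bigl => i; rewrite ?eL ?eK.
have -> : type2_cst R k ^+ (size js).+1 * (#|Om'|%:R * A) =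
   type2_cst R k ^+ (size js).+1 * (#|OL|%:R * A) +
   type2_cst R k * (type2_cst R k ^+ size js * (#|OK|%:R * A)).
  by rewrite cO natrD exprS; ring.
have [D [lowD highD]] := lac j K ltac:(by rewrite inE eqxx).
apply: moment_bound_orthoD => //.
- by apply: bmf_sum.
- by apply: bmf_sum.
- by rewrite mulr_gt0 ?exprn_gt0 ?mulr_gt0 ?ltr0n.
- by rewrite mulr_gt0 ?exprn_gt0 ?mulr_gt0 ?ltr0n.
- apply: (ortho_low_high j _ D); apply: tspan_sum => i; rewrite inE => /andP[_].
    exact: lowD.
  by move/eqP; exact: highD.
Qed.

End trig_span.

(** * The kernel F1 *)

Section kernel_pointwise.
Variables (R : realType) (r : R).
Hypothesis r0 : 0 < r.

Let al (k : nat) : R := k.+1%:R `^ (- r).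
Let cs (x : R) (k : nat) : R := cos (k.+1%:R * x - r * pi / 2).

Definition F1_sum (n : nat) (x : R) : R := \sum_(k < n) al k * cs x k.

Lemma F1E x : F1 r x = 1 + 2 * limn (F1_sum ^~ x).
Proof.
rewrite /F1; congr (_ + 2 * _).
set u := fun N => \sum_(1 <= k < N) _.
have -> : F1_sum ^~ x = [sequence u n.+1]_n.
  by apply/funext => n; rewrite /= /u big_add1 big_mkord.
rewrite /lim_in; congr (get _); apply/funext => l.
by apply/esym; exact: (cvg_shiftS u (nbhs l)).
Qed.

Lemma F1_coef_ge0 k : 0 <= al k. Proof. exact: powR_ge0. Qed.

Lemma F1_coef_dec k : al k.+1 <= al k.
Proof.
rewrite /al !powRN lef_pV2 ?posrE ?powR_gt0 ?ltr0n//.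
by rewrite ge0_ler_powR ?nnegrE ?ler_nat// ltW.
Qed.

Lemma F1_coef_cvg0 : al @ \oo --> 0.
Proof.
apply/cvgrPdist_lt => e e0; near=> n.
rewrite sub0r normrN ger0_norm ?F1_coef_ge0// /al powRN.
have h : (e^-1) `^ r^-1 < n%:R by near: n; exact: nbhs_infty_gtr.
rewrite -[ltRHS]invrK ltf_pV2 ?posrE ?invr_gt0// ?powR_gt0 ?ltr0n//.
have -> : e^-1 = (e^-1 `^ r^-1) `^ r by rewrite -powRrM mulVf ?gt_eqF// powRr1// invr_ge0 ltW.
rewrite gt0_ltr_powR ?nnegrE ?powR_ge0//.
by rewrite (lt_le_trans h)// ler_nat.
Unshelve. all: by end_near. Qed.

(** Multiplication by 2 sin(x/2) makes the sum of cosines telescope; the product form avoids a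
    division by zero. *)
Lemma cs_sum_bound (x : R) (N k : nat) :
  `|sin (x / 2)| * `|\sum_(j < k) cs x (N + j)| <= 1.
Proof.
pose t (j : nat) := sin ((N + j).+1%:R * x - r * pi / 2 - x / 2).
have e : 2 * sin (x / 2) * \sum_(j < k) cs x (N + j) = t k - t 0.
  rewrite -(telescope_sumr t (leq0n k)) big_mkord mulr_sumr.
  apply: eq_bigr => j _; rewrite /cs sin_mul_cos /t addnS; congr (sin _ - _).
  by rewrite -[(N + j).+2%:R]natr1; field.
rewrite -normrM; have -> : sin (x / 2) * \sum_(j < k) cs x (N + j) = (t k - t 0) / 2.
  by rewrite -e; field.
rewrite normrM [X in _ * X]gtr0_norm ?invr_gt0// ler_pdivrMr// mul1r.
rewrite (le_trans (ler_normB _ _))// (_ : 2 = 1 + 1)// lerD//.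
  by rewrite ler_norml sin_geN1 sin_le1.
by rewrite ler_norml sin_geN1 sin_le1.
Qed.

Lemma F1_sum_tail (x : R) (N M : nat) : sin (x / 2) != 0 -> (N <= M)%N ->
  `|F1_sum M x - F1_sum N x| <= al N / `|sin (x / 2)|.
Proof.
move=> s0 NM; set s := `|sin (x / 2)|; have sp : 0 < s by rewrite normr_gt0.
have -> : F1_sum M x - F1_sum N x = \sum_(k < M - N) al (N + k) * cs x (N + k).
  rewrite /F1_sum -!(big_mkord xpredT (fun k => al k * cs x k)).
  apply/eqP; rewrite subr_eq addrC; apply/eqP.
  rewrite (big_cat_nat (leq0n N) NM)/=; congr (_ + _).
  by rewrite -{1}[N]add0n big_addn big_mkord; apply: eq_bigr => i _; rewrite addnC.
(* This majorant jumps once, from 0 to s^-1, so the bound of [abel_bound] collapses to its first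
   term. *)
pose b (k : nat) : R := if k is 0 then 0 else s^-1.
apply: (le_trans (abel_bound _ (fun k => al (N + k)) (fun k => cs x (N + k)) b _ _ _ _ _)) => //.
- by move=> k; rewrite addnS F1_coef_dec.
- move=> k; exact: F1_coef_ge0.
- case=> [|k]; first by rewrite big_ord0 normr0.
  by rewrite /b -[leRHS]div1r ler_pdivlMr// mulrC cs_sum_bound.
case: (M - N)%N => [|m]; first by rewrite big_ord0 divr_ge0 ?F1_coef_ge0// ltW.
rewrite big_ord_recl big1 ?addr0; last by move=> i _; rewrite /b/= subrr mulr0.
by rewrite /b subr0 addn0.
Qed.

Lemma F1_sum_cvg (x : R) : sin (x / 2) != 0 -> F1_sum ^~ x @ \oo --> limn (F1_sum ^~ x).
Proof.
move=> s0; apply: (cauchy_tail _ _ (fun N => al N / `|sin (x / 2)|) _ _).1.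
  by move=> N M; exact: F1_sum_tail.
rewrite -[X in _ --> X](mul0r `|sin (x / 2)|^-1).
by apply: cvgMl; exact: F1_coef_cvg0.
Qed.

(** Positivity makes the singularity |x|^(be - 1) integrable, and 2 be <= r makes the Abel sum for
    the kernel bounded. *)
Definition F1_exponent : R := Num.min r 1 / 2.
Local Notation be := F1_exponent.

Lemma F1_exponent_gt0 : 0 < be.
Proof. by rewrite divr_gt0// lt_min r0 ltr01. Qed.

Lemma F1_exponent_lt1 : be < 1.
Proof. by rewrite /be ltr_pdivrMr// mul1r (@le_lt_trans _ _ 1)// ?ltr1n// ge_min lexx orbT. Qed.

Lemma F1_exponent_le : 2 * be <= r.
Proof. by rewrite /be mulrC divfK// ge_min lexx. Qed.

(** Sums of k cosines are at most k and at most 1/s with s = |sin(x/2)|, hence at most k^be s^(be -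
    1) by interpolation. Abel summation with this majorant leaves a numerical sum that telescopes,
    which gives a bound uniform in n. *)
Lemma F1_sum_bound (n : nat) (x : R) : sin (x / 2) != 0 ->
  `|F1_sum n x| <= 2 * `|sin (x / 2)| `^ (be - 1).
Proof.
move=> s0; set s := `|sin (x / 2)|; have sp : 0 < s by rewrite normr_gt0.
have be0 := F1_exponent_gt0; have be1 := F1_exponent_lt1.
pose p (k : nat) : R := k%:R `^ be.
pose b (k : nat) : R := p k * s `^ (be - 1).
have p0 : p 0%N = 0 by rewrite /p powR0// gt_eqF.
have pS k : 1 <= p k.+1.
  have -> : 1 = 1 `^ be by rewrite powR1.
  by rewrite /p ge0_ler_powR ?nnegrE// ?ler1n// ltW.
have pm k : p k <= p k.+1.
  by rewrite /p ge0_ler_powR ?nnegrE// ?ler_nat// ltW.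
apply: (le_trans (abel_bound _ al (cs x) b n _ _ _ _)) => //.
- move=> k; exact: F1_coef_dec.
- move=> k; exact: F1_coef_ge0.
- by rewrite /b p0 mul0r.
- move=> k; set D := `|_|.
  have D0 : 0 <= D by exact: normr_ge0.
  have Dk : D <= k%:R.
    rewrite (le_trans (ler_norm_sum _ _ _))// (@le_trans _ _ (\sum_(i < k) 1))//.
      by apply: ler_sum => i _; rewrite ler_norml cos_geN1 cos_le1.
    by rewrite sumr_const card_ord.
  have Ds : D <= s^-1.
    rewrite -[leRHS]div1r ler_pdivlMr// mulrC.
    exact: (cs_sum_bound x 0 k).
  have [->|Dn] := eqVneq D 0; first by rewrite mulr_ge0// powR_ge0.
  rewrite -[leLHS]powRr1// (_ : 1 = be + (1 - be)); last by ring.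
  rewrite powRD ?Dn ?implybT// ler_pM ?powR_ge0//.
    by rewrite ge0_ler_powR ?nnegrE// ltW.
  have -> : s `^ (be - 1) = s^-1 `^ (1 - be).
    by rewrite -(powR_inv1 (ltW sp)) -powRrM; congr (_ `^ _); ring.
  by rewrite ge0_ler_powR ?nnegrE ?invr_ge0 ?(ltW sp)// subr_ge0 ltW.
have -> : \sum_(k < n) al k * (b k.+1 - b k) =
    (\sum_(k < n) al k * (p k.+1 - p k)) * s `^ (be - 1).
  by rewrite mulr_suml; apply: eq_bigr => k _; rewrite /b; ring.
rewrite ler_wpM2r ?powR_ge0//.
case: n => [|n]; first by rewrite big_ord0.
rewrite big_ord_recl /= p0 subr0 /al /p !powR1 mulr1.
suff h : \sum_(k < n) al (lift ord0 k) * (p (lift ord0 k).+1 - p (lift ord0 k)) <= 1.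
  by rewrite (_ : 2 = 1 + 1)// lerD2l.
(* Write A < B for consecutive values of [p], the powers k^be. As r >= 2 be, the coefficient is at
   most B^-2, and (B - A)/B^2 <= 1/A - 1/B. The term with [p 0 = 0] was split off beforehand. *)
apply: (@le_trans _ _ (\sum_(k < n) ((p k.+1)^-1 - (p k.+2)^-1))); last first.
  rewrite -(big_mkord xpredT (fun k => (p k.+1)^-1 - (p k.+2)^-1)).
  have -> : \sum_(0 <= k < n) ((p k.+1)^-1 - (p k.+2)^-1) =
      \sum_(0 <= k < n) (- (p k.+2)^-1 - - (p k.+1)^-1).
    by apply: eq_bigr => k _; ring.
  rewrite (telescope_sumr (fun k => - (p k.+1)^-1) (leq0n n)).
  by rewrite opprK addrC {1}/p powR1 invr1 gerDl oppr_le0 invr_ge0 powR_ge0.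
apply: ler_sum => k _; rewrite !lift0.
have A1 := pS k; have AB := pm k.+1.
set A := p k.+1 in A1 AB *; set B := p k.+2 in AB *.
have B1 : 1 <= B by exact: le_trans AB.
have A0 : 0 < A by exact: lt_le_trans A1.
have B0 : 0 < B by exact: lt_le_trans B1.
have aB : al k.+1 <= B ^- 2.
  rewrite /al powRN lef_pV2 ?posrE ?powR_gt0 ?exprn_gt0 ?ltr0n//.
  rewrite -powR_mulrn ?(ltW B0)// /B /p -powRrM.
  by rewrite ler_powR ?ler1n// mulrC F1_exponent_le.
apply: (@le_trans _ _ (B ^- 2 * (B - A))).
  by rewrite ler_wpM2r// subr_ge0.
have -> : A^-1 - B^-1 = (A * B)^-1 * (B - A).
  by field; rewrite !gt_eqF.
rewrite ler_wpM2r ?subr_ge0// lef_pV2 ?posrE ?mulr_gt0 ?exprn_gt0//.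
by rewrite expr2 ler_wpM2r// ltW.
Qed.

End kernel_pointwise.

(** * Integrability of a power singularity *)

Section uprob_integrable.
Variable R : realType.
Local Notation U := (uprob R).
Local Notation leb := (@lebesgue_measure R).

Lemma uprob_le (A : set (measurableTypeR R)) : measurable A -> (U A <= leb A)%E.
Proof.
move=> mA; have p2 := two_pi_gt0 R; have p1 := @pi_ge2 R.
apply: (@le_trans _ _ (\int[leb]_(x in A) (cst 1 x))%E); last first.
  by rewrite integral_cst// mul1e.
apply: ge0_le_integral => //=.
- by move=> x _; rewrite lee_fin uniform_pdf_ge0.
- by apply/measurable_EFinP/measurable_funTS; exact: measurable_uniform_pdf.
- move=> x _; rewrite lee_fin /uniform_pdf subr0; case: ifP => // _.
  by rewrite invf_le1//; lra.
Qed.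

Lemma uprob_itv0 : U (~` `[0, 2 * pi]%classic) = 0%E.
Proof.
rewrite /uprob /= /uniform_prob integral_uniform_pdf.
by rewrite setICl integral_set0.
Qed.

Lemma uprob_set1 (c : R) : U [set c] = 0%E.
Proof.
apply/eqP; rewrite eq_le measure_ge0 andbT.
by apply: (le_trans (uprob_le _ _)) => //; rewrite lebesgue_measure_set1.
Qed.

Lemma measurable_dist_powR (c e : R) :
  measurable_fun [set: measurableTypeR R] (fun y : R => `|y - c| `^ e).
Proof.
apply: (measurableT_comp (f := @powR R ^~ e)); first exact: measurable_powR.
apply: (measurableT_comp (f := @Num.norm R R)) => //.
exact: measurable_funB.
Qed.

(** On the shell 2^-(i+1) <= |y - c| < 2^-i the integrand is at most z^(i+1) with z = 2^(1 - g) < 2,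
    and the ball of radius 2^-i has measure at most 2 * 2^-i; the series of products is geometric of
    ratio z/2. *)
Lemma integrable_dist_powR (c g : R) : 0 < g < 1 ->
  U.-integrable setT (fun y => (`|y - c| `^ (g - 1))%:E).
Proof.
move=> /andP[g0 g1]; apply/integrableP; split.
  by apply/measurable_EFinP; exact: measurable_dist_powR.
pose z := 2 `^ (1 - g).
have z0 : 0 < z by rewrite powR_gt0.
have z2 : z < 2.
  have <- : z * 2 `^ g = 2.
    by rewrite /z -powRD ?subrK ?powRr1// pnatr_eq0 implybT.
  rewrite ltr_pMr//.
  have : 1 `^ g < 2 `^ g :> R by rewrite gt0_ltr_powR ?nnegrE// ltr1n.
  by rewrite powR1.
pose B (i : nat) := ball c (2 ^- i) : set (measurableTypeR R).
have mB i : measurable (B i) by exact: measurable_ball.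
pose f (i : nat) (y : measurableTypeR R) := (z ^+ i.+1 * \1_(B i) y)%:E.
have f0 i y : (0 <= f i y)%E by rewrite lee_fin mulr_ge0// exprn_ge0// ltW.
have mf i : measurable_fun setT (f i).
  by apply/measurable_EFinP; apply: measurable_funM => //; exact: measurable_indic.
apply: (@le_lt_trans _ _ (\int[U]_y (cst 1%E y + \sum_(i <oo) f i y))%E).
  apply: ge0_le_integral => //.
  - by apply: measurableT_comp => //; apply/measurable_EFinP; exact: measurable_dist_powR.
  - apply: emeasurable_funD => //; apply: ge0_emeasurable_sum => //.
  - move=> y _; rewrite gee0_abs ?lee_fin ?powR_ge0//.
    have S0 : (0 <= \sum_(i <oo) f i y)%E by apply: nneseries_ge0.
    have [y1|y1] := leP 1 `|y - c|.
      apply: (@le_trans _ _ 1%E); last by rewrite leeDl.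
      rewrite lee_fin (_ : g - 1 = - (1 - g)); last by ring.
      rewrite powRN invf_le1 ?powR_gt0 ?(lt_le_trans _ y1)//.
      by rewrite -[leLHS](powRr0 `|y - c|) ler_powR//; lra.
    (* At the singular point itself the power is 0 by convention. *)
    have [y0|y0] := eqVneq `|y - c| 0.
      rewrite y0 powR0; last by rewrite subr_eq0 lt_eqF.
      by rewrite adde_ge0.
    have yp : 0 < `|y - c| by rewrite lt_neqAle eq_sym y0 normr_ge0.
    have ex : exists i, 2 ^- i.+1 <= `|y - c|.
      have := @cvg_geometric R 1 2^-1 ltac:(by rewrite ger0_norm ?invr_ge0// invf_lt1// ltr1n).
      move=> /(cvgr_lt 0)/(_ _ yp)[N _ /(_ N.+1)] h; exists N.
      by rewrite ltW// -exprVn; have := h (leqnSn _); rewrite /= mul1r.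
    pose i := ex_minn ex.
    have [hi mi] : 2 ^- i.+1 <= `|y - c| /\ `|y - c| < 2 ^- i.
      rewrite /i; case: ex_minnP => m hm mm; split => //.
      case: m hm mm => [|m] hm mm; first by rewrite expr0 invr1.
      by rewrite ltNge; apply/negP => /mm; rewrite ltnn.
    apply: (@le_trans _ _ (f i y)).
      rewrite /f indicE mem_set ?mulr1; last by rewrite /B /ball/= distrC.
      rewrite lee_fin (_ : g - 1 = - (1 - g)); last by ring.
      rewrite powRN -powR_inv1 ?powR_ge0// powRAC powR_inv1//.
      rewrite /z -powR_mulrn ?powR_ge0// powRAC powR_mulrn//.
      rewrite ge0_ler_powR ?nnegrE ?invr_ge0 ?exprn_ge0//; first lra.
      by rewrite -[leRHS]invrK lef_pV2 ?posrE ?invr_gt0 ?exprn_gt0.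
    apply: (@le_trans _ _ (\sum_(i <oo) f i y)%E); last by rewrite leeDr.
    apply: (@le_trans _ _ (\sum_(0 <= j < i.+1) f j y)%E).
      by rewrite big_nat_recr//= leeDr// sume_ge0.
    exact: nneseries_lim_ge.
rewrite ge0_integralD//; last by apply: ge0_emeasurable_sum.
  apply: lte_add_pinfty; first by rewrite integral_cst// mul1e (le_lt_trans (probability_le1 U _))// ltry.
  rewrite integral_nneseries//.
  apply: (@le_lt_trans _ _ (2 * z / (1 - z / 2))%:E); last exact: ltry.
  apply: lime_le; first by apply: is_cvg_nneseries => n _ _; exact: integral_ge0.
  apply: nearW => n.
  apply: (@le_trans _ _ (\sum_(0 <= i < n) (2 * z * (z / 2) ^+ i)%:E)%E); last first.
    rewrite sumEFin lee_fin; apply: (@geometric_le_lim _ n (2 * z) (z / 2)).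
    - by rewrite mulr_ge0// ltW.
    - by rewrite divr_gt0.
    - by rewrite ger0_norm ?divr_ge0 ?ltW//; lra.
  apply: lee_sum => i _; rewrite /f.
  under eq_integral do rewrite EFinM.
  rewrite ge0_integralZl//; last 2 first.
  - by apply/measurable_EFinP; exact: measurable_indic.
  - by rewrite lee_fin exprn_ge0// ltW.
  rewrite integral_indic// setIT.
  apply: (@le_trans _ _ ((z ^+ i.+1)%:E * (2 ^- i *+ 2)%:E)%E).
    apply: lee_pmul => //; first by rewrite lee_fin exprn_ge0// ltW.
    apply: (le_trans (uprob_le _ _)) => //.
    by rewrite lebesgue_measure_ball.
  rewrite -EFinM lee_fin (mulr2n (2 ^- i)) expr_div_n exprS.
  by rewrite le_eqVlt; apply/orP; left; apply/eqP; ring.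
by move=> y _; apply: nneseries_ge0.
Qed.

End uprob_integrable.

(** * Measurability of the kernel and an integrable majorant *)

Section kernel_convolution.
Variables (R : realType).
Local Notation U := (uprob R).

Lemma Rintegral_dominated d (T : measurableType d) (P : probability T R)
    (f_ : nat -> T -> R) (f g : T -> R) :
  (forall n, measurable_fun [set: T] (f_ n)) -> measurable_fun [set: T] f ->
  {ae P, forall x, f_ ^~ x @ \oo --> f x} ->
  P.-integrable setT (EFin \o g) ->
  {ae P, forall x, forall n, `|f_ n x| <= g x} ->
  P.-integrable setT (EFin \o f) /\
  (fun n => \int[P]_x f_ n x) @ \oo --> \int[P]_x f x.
Proof.
move=> mf_ mf f_f ig f_g.
have [||||fi _ fc] := @dominated_convergence _ _ _ P setT measurableT
  (fun n => EFin \o f_ n) (EFin \o f) (EFin \o g) _ _ _ ig _.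
- by move=> n; apply/measurable_EFinP.
- exact/measurable_EFinP.
- by apply: filterS f_f => x h _; apply: cvg_EFin; [exact: nearW|exact: h].
- by apply: filterS f_g => x h n _; rewrite lee_fin.
split => //.
have fe : (\int[P]_x (f x)%:E)%E = (\int[P]_x f x)%:E.
  by rewrite fineK//; exact: integrable_fin_num.
by rewrite /= fe in fc; exact: fine_cvg fc.
Qed.

Lemma modulo_2pi (x : R) : exists n : int, 0 <= x - n%:~R * (2 * pi) < 2 * pi.
Proof.
have p2 := two_pi_gt0 R; exists (Num.floor (x / (2 * pi))).
have /andP[h1 h2] := mathcomp.algebra.archimedean.Num.Theory.floor_itv (x / (2 * pi)).
rewrite ler_pdivlMr// in h1; rewrite ltr_pdivrMr// in h2.
rewrite subr_ge0 h1 /= ltrBlDl.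
by rewrite rmorphD/= mulrDl mul1r in h2.
Qed.

Lemma sin_half_sqr (x : R) : cos x = 1 - 2 * sin (x / 2) ^+ 2.
Proof.
have {1}-> : x = (x / 2) *+ 2 by rewrite (mulr2n (x / 2)); field.
by rewrite cos_mulr2n cos2sin2; ring.
Qed.

Lemma sin_half_eq0 (x : R) : 0 <= x < 2 * pi -> sin (x / 2) = 0 -> x = 0.
Proof.
move=> /andP[x0 x2] s0; have p2 := two_pi_gt0 R.
have [//|xn] := eqVneq x 0.
have := @sin_gt0_pi R (x / 2); rewrite s0 ltxx => h; exfalso.
have xp : 0 < x by rewrite lt_neqAle eq_sym xn.
by apply: notF; apply: h; apply/andP; split; lra.
Qed.

Lemma sin_half_eq0_2pi (x : R) : sin (x / 2) = 0 -> exists n : int, x = n%:~R * (2 * pi).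
Proof.
move=> s0; have [n hn] := modulo_2pi x; exists n.
apply/eqP; rewrite -subr_eq0; apply/eqP; apply: sin_half_eq0 => //.
have := sin_half_sqr x; rewrite s0 expr0n mulr0 subr0 => c1.
have := sin_half_sqr (x - n%:~R * (2 * pi)).
have -> : cos (x - n%:~R * (2 * pi)) = 1.
  by rewrite -(cosD_int2pi _ n (x - _)) subrK c1.
by move=> h; apply/eqP; rewrite -sqrf_eq0; apply/eqP; lra.
Qed.

Variable r : R.
Hypothesis r0 : 0 < r.
Local Notation th := (r * pi / 2).
Local Notation be := (F1_exponent R r).

Lemma F1_periodic (n : int) (x : R) : F1 r (x + n%:~R * (2 * pi)) = F1 r x.
Proof.
rewrite [LHS]F1E [RHS]F1E.
suff -> : F1_sum R r ^~ (x + n%:~R * (2 * pi)) = F1_sum R r ^~ x.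
  by [].
apply/funext => N; apply: eq_bigr => k _; congr (_ * _).
have -> : k.+1%:R * (x + n%:~R * (2 * pi)) - th =
    k.+1%:R * x - th + (k.+1%:Z * n)%:~R * (2 * pi).
  by rewrite intrM -pmulrn; ring.
exact: cosD_int2pi.
Qed.

Lemma measurable_sin : measurable_fun [set: measurableTypeR R] (@sin R).
Proof. exact: continuous_measurable_fun (@continuous_sin R). Qed.

Lemma measurable_F1_sum n : measurable_fun [set: measurableTypeR R] (F1_sum R r n).
Proof.
rewrite /F1_sum; have : bounded_mfun _ (measurableTypeR R) R
    (fun x => \sum_(k < n) k.+1%:R `^ (- r) * cos (k.+1%:R * x + - th)).
  by apply: bmf_sum => k _; apply: bmfZ; exact: bmf_cos.
by case.
Qed.

(** Off the multiples of 2 pi the kernel is a pointwise limit of partial sums. On these multiples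
    [limn] may be a junk value, but by periodicity it is the same value everywhere, namely that at
    0. *)
Lemma measurable_F1 : measurable_fun [set: measurableTypeR R] (F1 r).
Proof.
pose I (x : measurableTypeR R) : R := (sin (x / 2) != 0)%:R.
have mI : measurable_fun setT I.
  have -> : I = \1_((fun x : measurableTypeR R => sin (x / 2)) @^-1` (~` [set 0])).
    apply/funext => x; rewrite indicE /I; congr (nat_of_bool _)%:R.
    by apply/idP/idP; rewrite inE /= => /eqP.
  apply: measurable_indic; rewrite -[X in measurable X]setTI.
  have ms : measurable_fun setT (fun x : measurableTypeR R => sin (x / 2)).
    by apply: (measurableT_comp measurable_sin); exact: measurable_funM.
  by apply: ms => //; apply: measurableC; exact: measurable_set1.
pose L (x : measurableTypeR R) : R := limn (F1_sum R r ^~ x) * I x.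
have mL : measurable_fun setT L.
  apply: (@measurable_fun_cvg _ _ _ _ (fun n x => F1_sum R r n x * I x)).
    by move=> n; apply: measurable_funM => //; exact: measurable_F1_sum.
  move=> x _; rewrite /L /I; have [s0|s0] := eqVneq (sin (x / 2)) 0.
    by under eq_fun do rewrite mulr0; rewrite mulr0; exact: cvg_cst.
  by under eq_fun do rewrite mulr1; rewrite mulr1; exact: F1_sum_cvg.
have -> : F1 r = fun x => 1 + 2 * L x + (F1 r 0 - 1) * (1 - I x).
  apply/funext => x; rewrite /L /I; have [s0|s0] := eqVneq (sin (x / 2)) 0.
    have [n xn] := sin_half_eq0_2pi _ s0.
    have -> : F1 r x = F1 r 0 by rewrite xn -[_ * (2 * pi)]add0r F1_periodic.
    by rewrite /= mulr0 mulr0 addr0 subr0; ring.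
  by rewrite F1E /=; ring.
apply: measurable_funD.
  by apply: measurable_funD; [exact: measurable_cst|apply: measurable_funM; [exact: measurable_cst|]].
apply: measurable_funM; first exact: measurable_cst.
by apply: measurable_funB; first exact: measurable_cst.
Qed.

(** For x and y in one period, the distance of x - y to the multiples of 2 pi is attained at 0 or at
    one of its two neighbours, hence three singularities. The 4 comes from sin(v/2) >= v/4, raised
    to a negative power above -1. *)
Definition F1_majorant (x y : R) : R :=
  4 * (`|y - x| `^ (be - 1) + `|y - (x - 2 * pi)| `^ (be - 1) + `|y - (x + 2 * pi)| `^ (be - 1)).

Lemma integrable_F1_majorant x : U.-integrable setT (EFin \o F1_majorant x).
Proof.
have h c : U.-integrable setT (fun y => (`|y - c| `^ (be - 1))%:E).
  by apply: integrable_dist_powR; rewrite F1_exponent_gt0//= F1_exponent_lt1.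
have -> : EFin \o F1_majorant x = (fun y => 4%:E * ((`|y - x| `^ (be - 1))%:E +
    (`|y - (x - 2 * pi)| `^ (be - 1))%:E + (`|y - (x + 2 * pi)| `^ (be - 1))%:E))%E by [].
by apply: integrableZl => //; apply: integrableD => //; exact: integrableD.
Qed.

Lemma ae_F1_majorant (x : R) : 0 <= x < 2 * pi ->
  {ae U, forall y, sin ((x - y) / 2) != 0 /\
    `|sin ((x - y) / 2)| `^ (be - 1) <= F1_majorant x y}.
Proof.
move=> /andP[x0 x2]; have p2 := two_pi_gt0 R.
pose N : set (measurableTypeR R) := ~` `[0, 2 * pi]%classic `|` [set x] `|` [set (x - 2 * pi)] `|` [set (x + 2 * pi)].
exists N; split.
- do 3 (apply: measurableU; last exact: measurable_set1).
  by apply: measurableC; exact: measurable_itv.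
- apply/eqP; rewrite eq_le measure_ge0 andbT.
  have mU (A B : set (measurableTypeR R)) : measurable A -> measurable B ->
      U A = 0%E -> U B = 0%E -> U (A `|` B) = 0%E.
    by move=> mA mB A0 B0; rewrite null_set_setU.
  have mI : measurable (~` `[0, 2 * pi]%classic : set (measurableTypeR R)).
    by apply: measurableC; exact: measurable_itv.
  rewrite /N !mU//; do ?[exact: uprob_itv0|exact: uprob_set1|exact: measurableU].
  by do ?apply: measurableU.
move=> y; apply: contra_notP => yN.
have [y01 yx yx1 yx2] : [/\ 0 <= y <= 2 * pi, y != x, y != x - 2 * pi & y != x + 2 * pi].
  split.
  - by apply: contra_notT yN => h; do 3 left; rewrite /= in_itv/=; exact/negP.
  - by apply: contra_notN yN => /eqP ->; left; left; right.
  - by apply: contra_notN yN => /eqP ->; left; right.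
  - by apply: contra_notN yN => /eqP ->; right.
move/andP: y01 => [y0 y2] {yN}.
have be0 := F1_exponent_gt0 R r r0; have be1 := F1_exponent_lt1 R r.
have key (c v : R) : 0 < v -> v / 4 <= c -> c `^ (be - 1) <= 4 * v `^ (be - 1).
  move=> v0 vc; have c0 : 0 < c by apply: lt_le_trans vc; rewrite divr_gt0.
  have e (t : R) : 0 < t -> t `^ (be - 1) = t^-1 `^ (1 - be).
    by move=> t0; rewrite -(powR_inv1 (ltW t0)) -powRrM; congr (_ `^ _); ring.
  have cv : c^-1 <= 4 * v^-1.
    have -> : 4 * v^-1 = (v / 4)^-1 by rewrite invfM invrK mulrC.
    by rewrite lef_pV2 ?posrE// divr_gt0.
  have vi : 0 <= v^-1 by rewrite invr_ge0 ltW.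
  have be2 : 0 <= 1 - be by lra.
  rewrite !e//; apply: (@le_trans _ _ ((4 * v^-1) `^ (1 - be))).
    by apply: ge0_ler_powR; rewrite // nnegrE ?mulr_ge0// invr_ge0 ltW.
  rewrite powRM// ler_wpM2r ?powR_ge0//.
  by rewrite -[leRHS]powRr1// ler_powR ?ler1n//; lra.
have S (z v : R) : z = x - y \/ z = y - x -> 0 < z -> z < 2 * pi -> v = Num.min z (2 * pi - z) ->
    v / 4 <= `|sin ((x - y) / 2)|.
  move=> zE z0 z2 vE; have -> : `|sin ((x - y) / 2)| = `|sin (z / 2)|.
    case: zE => ->//; rewrite (_ : (x - y) / 2 = - ((y - x) / 2)); last by field.
    by rewrite sinN normrN.
  rewrite (le_trans _ (ler_norm _))// vE; apply: sin_half_ge.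
  by rewrite !ltW.
have [v [v0 vs vM]] : exists v, [/\ 0 < v, v / 4 <= `|sin ((x - y) / 2)| &
    4 * v `^ (be - 1) <= F1_majorant x y].
  have M1 (c : R) : c = `|y - x| \/ c = `|y - (x - 2 * pi)| \/ c = `|y - (x + 2 * pi)| ->
      4 * c `^ (be - 1) <= F1_majorant x y.
    rewrite /F1_majorant => h; rewrite ler_wpM2l//.
    have A1 := powR_ge0 (`|y - x|) (be - 1).
    have A2 := powR_ge0 (`|y - (x - 2 * pi)|) (be - 1).
    have A3 := powR_ge0 (`|y - (x + 2 * pi)|) (be - 1).
    by case: h => [->|[->|->]]; lra.
  have [xy|xy] := ltP y x.
    exists (Num.min (x - y) (2 * pi - (x - y))); split.
    - by rewrite lt_min; apply/andP; split; lra.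
    - by apply: (S (x - y)); [left|lra|lra|].
    apply: M1; have [_|_] := leP (x - y) (2 * pi - (x - y)).
      by left; rewrite ltr0_norm; lra.
    by right; left; rewrite gtr0_norm; lra.
  have xy' : x < y by rewrite lt_neqAle eq_sym yx.
  have yx3 : y < x + 2 * pi by rewrite lt_neqAle yx2; lra.
  exists (Num.min (y - x) (2 * pi - (y - x))); split.
  - by rewrite lt_min; apply/andP; split; lra.
  - by apply: (S (y - x)); [right|lra|lra|].
  apply: M1; have [_|_] := leP (y - x) (2 * pi - (y - x)).
    by left; rewrite gtr0_norm; lra.
  by right; right; rewrite ltr0_norm; lra.
split; last by apply: (le_trans _ vM); exact: key.
by rewrite -normr_gt0 (lt_le_trans _ vs)// divr_gt0.
Qed.

End kernel_convolution.

(** * Convolution of cosine series with the kernel *)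

Section kernel_convolution_series.
Variables (R : realType) (r : R).
Hypothesis r0 : 0 < r.
Local Notation U := (uprob R).
Local Notation th := (r * pi / 2).
Local Notation be := (F1_exponent R r).

Lemma ae_mono d (T : measurableType d) (P : probability T R) (Q1 Q2 : T -> Prop) :
  (forall y, Q1 y -> Q2 y) -> {ae P, forall y, Q1 y} -> {ae P, forall y, Q2 y}.
Proof. by move=> h; apply: filterS. Qed.

Lemma measurable_reflect (x : R) (f : measurableTypeR R -> R) :
  measurable_fun setT f -> measurable_fun setT (fun y : measurableTypeR R => f (x - y)).
Proof.
move=> mf; apply: (measurableT_comp mf).
by apply: measurable_funB; first exact: measurable_cst.
Qed.

Lemma F1_bound (x : R) : sin (x / 2) != 0 ->
  `|F1 r x| <= 1 + 4 * `|sin (x / 2)| `^ (be - 1).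
Proof.
move=> s0; rewrite F1E (le_trans (ler_normD _ _))// normr1 lerD2l normrM normr_nat.
rewrite (_ : 4 = 2 * 2); last by ring.
rewrite -mulrA ler_wpM2l//.
have h : `|F1_sum R r n x| @[n --> \oo] --> `|limn (F1_sum R r ^~ x)|.
  by apply: cvg_norm; exact: F1_sum_cvg.
have <- := cvg_lim _ h => //.
apply: limr_le; first by apply/cvg_ex; eexists; exact: h.
by apply: nearW => n; exact: F1_sum_bound.
Qed.

Definition kernel_majorant (x y : R) : R := 1 + 4 * F1_majorant R r x y.

Lemma integrable_kernel_majorant (C x : R) :
  U.-integrable setT (EFin \o (fun y => C * kernel_majorant x y)).
Proof.
have -> : EFin \o (fun y => C * kernel_majorant x y) =
    (fun y => C%:E * (cst 1%E y + 4%:E * (EFin \o F1_majorant R r x) y))%E by [].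
apply: integrableZl => //; apply: integrableD => //.
  by apply: (bmf_integrable _ _ _ U (fun=> 1)); exact: bmf_cst.
by apply: integrableZl => //; exact: integrable_F1_majorant.
Qed.

Lemma integrable_F1_mul (x : R) (g : measurableTypeR R -> R) : 0 <= x < 2 * pi ->
  bounded_mfun _ _ R g -> U.-integrable setT (EFin \o (fun y => g y * F1 r (x - y))).
Proof.
move=> hx [mg [M gM]].
have [] := Rintegral_dominated _ _ _ U (fun _ y => g y * F1 r (x - y))
    (fun y => g y * F1 r (x - y)) (fun y => M * kernel_majorant x y) => //.
- move=> _; apply: measurable_funM => //.
  by apply: measurable_reflect; exact: measurable_F1.
- apply: measurable_funM => //.
  by apply: measurable_reflect; exact: measurable_F1.
- by apply: aeW => y; exact: cvg_cst.
- exact: integrable_kernel_majorant.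
apply: (ae_mono _ _ _ _ _ _ (ae_F1_majorant R r r0 x hx)) => y [s0 sM] _.
rewrite normrM ler_pM// (le_trans (F1_bound _ s0))// /kernel_majorant.
by rewrite lerD2l ler_wpM2l.
Qed.

Lemma cos_product_mean (k : nat) (j : nat) (x a b : R) :
  \int[U]_y (cos (k%:R * y + a) * cos (j.+1%:R * (x - y) + b)) =
  if k == j.+1 then cos (k%:R * x + a + b) / 2 else 0.
Proof.
have e y : cos (k%:R * y + a) * cos (j.+1%:R * (x - y) + b) =
    2^-1 * cos ((k%:Z - j.+1%:Z)%:~R * y + (a + j.+1%:R * x + b)) +
    2^-1 * cos ((k%:Z + j.+1%:Z)%:~R * y + (a - j.+1%:R * x - b)).
  set u := k%:R * y + a; set v := j.+1%:R * (x - y) + b.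
  have -> : (k%:Z - j.+1%:Z)%:~R * y + (a + j.+1%:R * x + b) = u + v.
    by rewrite /u /v rmorphB/= -!pmulrn; ring.
  have -> : (k%:Z + j.+1%:Z)%:~R * y + (a - j.+1%:R * x - b) = u - v.
    by rewrite /u /v rmorphD/= -!pmulrn; ring.
  by rewrite (cosD u v) (cosB u v); field.
under eq_Rintegral do rewrite e.
rewrite bmf_RintegralD; do ?[by apply: bmfZ; exact: bmf_cos].
rewrite !bmf_RintegralZ; do ?[by exact: bmf_cos].
rewrite (cos_mean0 _ (k%:Z + j.+1%:Z)); last by lia.
rewrite mulr0 addr0; case: eqVneq => [->|kj].
  rewrite subrr; under eq_Rintegral do rewrite mul0r add0r.
  rewrite bmf_Rintegral_cst mulrC; congr (cos _ / 2); ring.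
by rewrite cos_mean0 ?mulr0//; apply: contra_neq kj; lia.
Qed.

Lemma cos_conv_F1_cvg (k : nat) (x a : R) : 0 <= x < 2 * pi ->
  (fun n => \int[U]_y (cos (k%:R * y + a) * (1 + 2 * F1_sum R r n (x - y)))) @ \oo -->
  \int[U]_y (cos (k%:R * y + a) * F1 r (x - y)).
Proof.
move=> hx; have [mc _] := bmf_cos R k%:R a.
have [] := Rintegral_dominated _ _ _ U
    (fun n y => cos (k%:R * y + a) * (1 + 2 * F1_sum R r n (x - y)))
    (fun y => cos (k%:R * y + a) * F1 r (x - y)) (fun y => 1 * kernel_majorant x y) => //.
- move=> n; apply: measurable_funM => //; apply: (measurable_reflect x (fun z => 1 + 2 * F1_sum R r n z)).
  apply: measurable_funD; first exact: measurable_cst.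
  by apply: measurable_funM; [exact: measurable_cst|exact: measurable_F1_sum].
- apply: measurable_funM => //.
  by apply: measurable_reflect; exact: measurable_F1.
- apply: (ae_mono _ _ _ _ _ _ (ae_F1_majorant R r r0 x hx)) => y [s0 sM].
  apply: cvgMr; rewrite F1E; apply: cvgD; first exact: cvg_cst.
  by apply: cvgMr; exact: F1_sum_cvg.
- exact: integrable_kernel_majorant.
apply: (ae_mono _ _ _ _ _ _ (ae_F1_majorant R r r0 x hx)) => y [s0 sM] n.
rewrite normrM ler_pM//; first by rewrite ler_norml cos_geN1 cos_le1.
rewrite (le_trans (ler_normD _ _))// normr1 lerD2l normrM normr_nat.
rewrite (_ : 4 = 2 * 2); last by ring.
by rewrite -mulrA ler_wpM2l// (le_trans (F1_sum_bound _ _ r0 _ _ s0))// ler_wpM2l.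
Qed.

Lemma cos_conv_F1_sum (n k : nat) (x a : R) :
  \int[U]_y (cos (k%:R * y + a) * (1 + 2 * F1_sum R r n (x - y))) =
  (if k == 0%N then cos a else 0) +
  \sum_(j < n) if k == j.+1 then k%:R `^ (- r) * cos (k%:R * x + a - th) else 0.
Proof.
have e y : cos (k%:R * y + a) * (1 + 2 * F1_sum R r n (x - y)) =
   cos (k%:R * y + a) + \sum_(j < n) (2 * j.+1%:R `^ (- r)) *
     (cos (k%:R * y + a) * cos (j.+1%:R * (x - y) + - th)).
  rewrite /F1_sum mulrDr mulr1; congr (_ + _); rewrite !mulr_sumr.
  by apply: eq_bigr => j _; ring.
under eq_Rintegral do rewrite e.
have bc (j : nat) : bounded_mfun _ (measurableTypeR R) R
    (fun y => cos (k%:R * y + a) * cos (j.+1%:R * (x - y) + - th)).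
  apply: bmfM; first exact: bmf_cos.
  have -> : (fun y => cos (j.+1%:R * (x - y) + - th)) =
    (fun y => cos (- j.+1%:R * y + (j.+1%:R * x - th))) :> (R -> R).
    by apply/funext => y; congr cos; ring.
  exact: bmf_cos.
rewrite bmf_RintegralD; [|exact: bmf_cos|by apply: bmf_sum => j _; exact: bmfZ].
congr (_ + _).
  case: k {e bc} => [|k] /=.
    by under eq_Rintegral do rewrite mul0r add0r; rewrite bmf_Rintegral_cst.
  exact: (cos_mean0 _ k.+1%:Z).
rewrite bmf_Rintegral_sum; last by move=> j _; exact: bmfZ.
apply: eq_bigr => j _; rewrite bmf_RintegralZ// cos_product_mean.
by case: eqP => [->|_]; rewrite ?mulr0//; field.
Qed.

(** By orthogonality the convolutions with the partial sums stay constant once n >= k, so the limit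
    given by dominated convergence is that constant. *)
Lemma cos_conv_F1 (k : nat) (x a : R) : 0 <= x < 2 * pi ->
  \int[U]_y (cos (k%:R * y + a) * F1 r (x - y)) =
  if k == 0%N then cos a else k%:R `^ (- r) * cos (k%:R * x + a - th).
Proof.
move=> hx; have := cos_conv_F1_cvg k x a hx.
under eq_fun do rewrite cos_conv_F1_sum.
move=> h; apply/esym; apply: (cvg_unique _ _ h) => //.
apply: cvg_near_cst; exists k => // n /= kn; case: k kn {h} => [|k] kn /=.
  by rewrite big1 ?addr0.
rewrite add0r (bigD1 (Ordinal kn))//= eqxx big1 ?addr0// => j jk.
by case: eqP => // -[e]; move/eqP: jk; case; apply: val_inj => /=.
Qed.

(* On the Fourier side, convolution with [F1 r] divides the [k]-th coefficient
   by [k ^ r] and shifts the phase back by [r pi / 2]. *)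
Lemma series_conv_F1 (c0 : R) (c a : nat -> R) (C x : R) (K : R -> R) :
  0 <= x < 2 * pi -> bounded_mfun _ (measurableTypeR R) R K ->
  (forall n, \sum_(k < n) `|c k| <= C) ->
  (forall y, (fun n => c0 + \sum_(k < n) c k * cos (k.+1%:R * y + a k)) @ \oo --> K y) ->
  (fun n => c0 + \sum_(k < n) c k * k.+1%:R `^ (- r) * cos (k.+1%:R * x + a k - th)) @ \oo -->
  \int[U]_y (K y * F1 r (x - y)).
Proof.
move=> hx [mK _] cC KK.
have bK n : bounded_mfun _ (measurableTypeR R) R
    (fun y => c0 + \sum_(k < n) c k * cos (k.+1%:R * y + a k)).
  apply: bmfD; first exact: bmf_cst.
  by apply: bmf_sum => k _; apply: bmfZ; exact: bmf_cos.
have e n : \int[U]_y ((c0 + \sum_(k < n) c k * cos (k.+1%:R * y + a k)) * F1 r (x - y)) =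
    c0 + \sum_(k < n) c k * k.+1%:R `^ (- r) * cos (k.+1%:R * x + a k - th).
  elim: n => [|n IHn].
    rewrite big_ord0 addr0; under eq_Rintegral do rewrite big_ord0 addr0.
    rewrite RintegralZl//; last first.
      have := integrable_F1_mul x (fun=> 1) hx (bmf_cst _ _ _ _).
      by under eq_fun do rewrite mul1r.
    have := cos_conv_F1 0 x 0 hx; rewrite /= cos0.
    by under eq_Rintegral do rewrite mul0r addr0 cos0 mul1r; move=> ->; rewrite mulr1.
  rewrite big_ord_recr /= addrA -IHn -(mulrA (c n)).
  have := cos_conv_F1 n.+1 x (a n) hx; rewrite /= => <-.
  rewrite -RintegralZl//; last exact: integrable_F1_mul (bmf_cos _ _ _).
  rewrite -RintegralD//; last 2 first.
  - exact: (integrable_F1_mul _ _ hx (bK n)).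
  - have : U.-integrable setT (EFin \o (fun y => c n * cos (n.+1%:R * y + a n) * F1 r (x - y))).
      by apply: integrable_F1_mul => //; apply: bmfZ; exact: bmf_cos.
    by apply: eq_integrable => // y _ /=; rewrite mulrA.
  by apply: eq_Rintegral => y _; rewrite big_ord_recr /=; ring.
under eq_fun do rewrite -e.
have [] := Rintegral_dominated _ _ _ U
    (fun n y => (c0 + \sum_(k < n) c k * cos (k.+1%:R * y + a k)) * F1 r (x - y))
    (fun y => K y * F1 r (x - y)) (fun y => (`|c0| + C) * kernel_majorant x y) => //.
- move=> n; apply: measurable_funM; first by have [] := bK n.
  by apply: measurable_reflect; exact: measurable_F1.
- apply: measurable_funM => //.
  by apply: measurable_reflect; exact: measurable_F1.
- by apply: aeW => y; apply: cvgMl; exact: KK.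
- exact: integrable_kernel_majorant.
apply: (ae_mono _ _ _ _ _ _ (ae_F1_majorant R r r0 x hx)) => y [s0 sM] n.
rewrite normrM ler_pM//; last first.
  rewrite (le_trans (F1_bound _ s0))// /kernel_majorant.
  by rewrite lerD2l ler_wpM2l.
rewrite (le_trans (ler_normD _ _))// lerD2l (le_trans (ler_norm_sum _ _ _))//.
apply: le_trans (cC n); apply: ler_sum => k _.
by rewrite normrM ler_piMr// ler_norml cos_geN1 cos_le1.
Qed.

End kernel_convolution_series.

(** * Compactly supported sinc sums *)

Section compact_support.
Variable R : realType.

(** Its value at 0 is 0, by division by zero. Series below carry their constant term separately and
    use it at positive frequencies. *)
Definition sinc (z : R) : R := sin z / z.

Lemma derive_bound_lipschitz (f df : R -> R) (a b B : R) :
  (forall x, a <= x <= b -> is_derive x 1 f (df x)) ->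
  (forall x, a <= x <= b -> `|df x| <= B) ->
  forall x y, a <= x <= b -> a <= y <= b -> `|f x - f y| <= B * `|x - y|.
Proof.
move=> fd fB; have main x y : a <= x -> y <= b -> x <= y -> `|f y - f x| <= B * `|y - x|.
  move=> ax yb xy.
  have fd' (z : R) : z \in `]x, y[ -> is_derive z 1 f (df z).
    rewrite in_itv/= => /andP[xz zy]; apply: fd.
    by rewrite (le_trans ax (ltW xz)) (le_trans (ltW zy)).
  have cf : {within `[x, y], continuous f}.
    apply: derivable_within_continuous => z.
    rewrite in_itv/= => /andP[xz zy]; have [] // := fd z _.
    by rewrite (le_trans ax xz) (le_trans zy).
  have [c] := MVT_segment xy fd' cf; rewrite in_itv/= => /andP[xc cy] ->.
  by rewrite normrM ler_wpM2r// fB// (le_trans ax xc) (le_trans cy).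
move=> x y /andP[ax xb] /andP[ay yb]; have [xy|xy] := leP x y.
  by rewrite distrC [X in _ * X]distrC; exact: main.
by apply: main => //; exact: ltW.
Qed.

Lemma dirichlet_sum (N : nat) (z : R) :
  2 * sin (z / 2) * (2^-1 + \sum_(k < N) cos (k.+1%:R * z)) = sin ((N%:R + 2^-1) * z).
Proof.
rewrite mulrDr mulr_sumr.
under eq_bigr do rewrite sin_mul_cos.
pose t (k : nat) := sin ((k%:R + 2^-1) * z).
have -> : \sum_(k < N) (sin (k.+1%:R * z + z / 2) - sin (k.+1%:R * z - z / 2)) = t N - t 0%N.
  rewrite -(telescope_sumr t (leq0n N)) big_mkord; apply: eq_bigr => k _.
  by rewrite /t -(natr1 k); congr (sin _ - sin _); field.
rewrite /t add0r (_ : 2^-1 * z = z / 2); last by ring.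
by field.
Qed.

(** Partial sums of a series whose limit on (0, 2 pi) is the constant pi/2. *)
Definition saw_sum (N : nat) (z : R) : R := z / 2 + \sum_(k < N) sin (k.+1%:R * z) / k.+1%:R.

Lemma is_derive_saw_sum (N : nat) (z : R) :
  is_derive z 1 (saw_sum N) (2^-1 + \sum_(k < N) cos (k.+1%:R * z)).
Proof.
rewrite /saw_sum; elim: N => [|N IHN].
  under [X in is_derive _ _ X]eq_fun do rewrite big_ord0 addr0.
  rewrite big_ord0 addr0; apply: is_derive_eq.
  by rewrite /GRing.scale/=; field.
under [X in is_derive _ _ X]eq_fun do rewrite big_ord_recr /= addrA.
rewrite big_ord_recr /= addrA; apply: is_deriveD.
apply: is_derive_eq; rewrite /GRing.scale/=.
by field.
Qed.

(** The derivative of the partial sum is the Dirichlet kernel sin(nu z) / (2 sin(z/2)) with nu = N +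
    1/2. Integration by parts is encoded in [E]: its correction term is O(1/nu) and cancels this
    kernel up to a derivative [dE] that is O(1/nu) too. The value pi/2 is exact at z = pi. *)
Lemma saw_sum_cvg (e : R) : 0 < e -> exists C : R, 0 <= C /\
  forall (N : nat) (z : R), e <= z <= 2 * pi - e -> `|saw_sum N z - pi / 2| <= C / N.+1%:R.
Proof.
move=> e0; have p2 := two_pi_gt0 R; have pi0 := pi_gt0 R.
pose s := e / 4; have s0 : 0 < s by rewrite divr_gt0.
have sge z : e <= z <= 2 * pi - e -> s <= sin (z / 2).
  move=> /andP[ez ze]; apply: (le_trans _ (sin_half_ge _ _ _)); last by apply/andP; split; lra.
  by rewrite ler_wpM2r// le_min ez; lra.
exists (2 * pi / s ^+ 2 + 1 + s^-1); split.
  by rewrite !addr_ge0// ?divr_ge0 ?sqr_ge0 ?invr_ge0 ?ltW.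
move=> N z hz; have /andP[ez ze] := hz.
pose nu : R := N%:R + 2^-1.
have nu0 : 0 < nu by rewrite /nu ltr_pwDr.
have nuN : N.+1%:R <= 2 * nu by rewrite /nu -natr1; have := ler0n R N; lra.
pose E (z : R) := saw_sum N z + (2 * nu)^-1 * (cos (nu * z) / sin (z / 2)).
pose dE (z : R) := - ((2 * nu)^-1 * 2^-1 * (cos (nu * z) * cos (z / 2) / sin (z / 2) ^+ 2)).
have Ed y : e <= y <= 2 * pi - e -> is_derive y 1 E (dE y).
  move=> hy; have sy : 0 < sin (y / 2) by apply: lt_le_trans (sge _ hy).
  have sy0 : sin (y / 2) != 0 by rewrite gt_eqF.
  have h1 := is_derive_saw_sum N y.
  have h2 : is_derive y 1 (fun z : R => (sin (z / 2))^-1)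
      (- (sin (y / 2) ^- 2) * (cos (y / 2) / 2)).
    apply: is_derive_eq; rewrite /GRing.scale/=; by field.
  rewrite /E; apply: is_derive_eq; rewrite /GRing.scale/= /dE.
  have -> : 2^-1 + \sum_(k < N) cos (k.+1%:R * y) = sin (nu * y) / (2 * sin (y / 2)).
    apply: (mulfI (_ : 2 * sin (y / 2) != 0)); first by rewrite mulf_neq0.
    by rewrite dirichlet_sum /nu; field.
  by field; rewrite sy0 gt_eqF.
have dEB y : e <= y <= 2 * pi - e -> `|dE y| <= (2 * nu)^-1 / s ^+ 2.
  move=> hy; have sy := sge _ hy; have sy0 : 0 < sin (y / 2) by apply: lt_le_trans sy.
  rewrite /dE normrN !normrM.
  rewrite (ger0_norm (_ : 0 <= (2 * nu)^-1)) ?invr_ge0 ?mulr_ge0 ?(ltW nu0)//.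
  rewrite -mulrA ler_wpM2l ?invr_ge0 ?mulr_ge0 ?(ltW nu0)//.
  have c1 (t : R) : `|cos t| <= 1 by rewrite ler_norml cos_geN1 cos_le1.
  rewrite (@le_trans _ _ (1 * (1 * 1 * `|(sin (y / 2) ^+ 2)^-1|)))//.
    apply: ler_pM => //; first by rewrite ger0_norm ?invr_ge0// invf_le1// ler1n.
    by rewrite ler_wpM2r// ler_pM.
  rewrite !mul1r normfV lef_pV2 ?posrE ?exprn_gt0 ?normr_gt0 ?expf_neq0 ?gt_eqF//.
  rewrite ger0_norm ?sqr_ge0// lerXn2r ?nnegrE// ltW//.
have pih : e <= pi <= 2 * pi - e by apply/andP; split; lra.
have EE := derive_bound_lipschitz E dE e (2 * pi - e) _ Ed dEB z pi hz pih.
have nui : (2 * nu)^-1 <= N.+1%:R^-1 by rewrite lef_pV2 ?posrE ?mulr_gt0 ?ltr0n.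
have nui0 : 0 <= (2 * nu)^-1 by rewrite invr_ge0 mulr_ge0// ltW.
have Ni0 : 0 <= N.+1%:R^-1 :> R by rewrite invr_ge0.
have tB (y : R) b : 0 < b -> b <= sin (y / 2) ->
    `|(2 * nu)^-1 * (cos (nu * y) / sin (y / 2))| <= N.+1%:R^-1 * b^-1.
  move=> b0 bs; have sy0 : 0 < sin (y / 2) by apply: lt_le_trans bs.
  rewrite normrM ger0_norm// ler_pM// normrM -[leRHS]mul1r ler_pM//.
    by rewrite ler_norml cos_geN1 cos_le1.
  by rewrite ger0_norm ?invr_ge0 ?(ltW sy0)// lef_pV2 ?posrE.
have sp : saw_sum N pi = pi / 2.
  rewrite /saw_sum big1 ?addr0// => k _.
  suff -> : sin (k.+1%:R * pi) = 0 :> R by rewrite mul0r.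
  elim: k.+1 => [|j IHj]; first by rewrite mul0r sin0.
  by rewrite -natr1 mulrDl mul1r sinD sinpi IHj mul0r mulr0 addr0.
have B1 := tB z s s0 (sge _ hz).
have B2 : `|(2 * nu)^-1 * (cos (nu * pi) / sin (pi / 2))| <= N.+1%:R^-1 * 1^-1.
  by apply: tB; rewrite // sin_pihalf.
have zp : `|z - pi| <= 2 * pi by rewrite ler_norml; apply/andP; split; lra.
have EE' : `|E z - E pi| <= N.+1%:R^-1 / s ^+ 2 * (2 * pi).
  apply: (le_trans EE); apply: ler_pM => //.
    by rewrite divr_ge0// sqr_ge0.
  by rewrite ler_wpM2r// invr_ge0 sqr_ge0.
set X := (2 * nu)^-1 * (cos (nu * z) / sin (z / 2)) in B1.
set Y := (2 * nu)^-1 * (cos (nu * pi) / sin (pi / 2)) in B2.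
have -> : saw_sum N z - pi / 2 = (E z - E pi) - X + Y by rewrite /E sp /X /Y; ring.
rewrite (le_trans (ler_normD _ _))// (le_trans (lerD (ler_normB _ _) (lexx _)))//.
apply: (le_trans (lerD (lerD EE' B1) B2)).
by rewrite le_eqVlt; apply/orP; left; apply/eqP; rewrite invr1; set w := N.+1%:R^-1; field; rewrite gt_eqF.
Qed.

Variable h : R.
Hypothesis h0 : 0 < h.

(** Up to normalization, the truncated Fourier series of the M-fold convolution power of the uniform
    density on [-h, h]; for M = 0 it is the Dirichlet kernel. *)
Definition bump_sum (M N : nat) (z : R) : R :=
  2^-1 + \sum_(k < N) sinc (k.+1%:R * h) ^+ M * cos (k.+1%:R * z).

Definition bump_prim (M N : nat) (z : R) : R :=
  z / 2 + \sum_(k < N) sinc (k.+1%:R * h) ^+ M * (sin (k.+1%:R * z) / k.+1%:R).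

Lemma is_derive_bump_prim (M N : nat) (z : R) : is_derive z 1 (bump_prim M N) (bump_sum M N z).
Proof.
rewrite /bump_prim /bump_sum; elim: N => [|N IHN].
  under [X in is_derive _ _ X]eq_fun do rewrite big_ord0 addr0.
  rewrite big_ord0 addr0; apply: is_derive_eq.
  by rewrite /GRing.scale/=; field.
under [X in is_derive _ _ X]eq_fun do rewrite big_ord_recr /= addrA.
rewrite big_ord_recr /= addrA; apply: is_deriveD.
apply: is_derive_eq; rewrite /GRing.scale/=.
by field.
Qed.

Lemma bump_sumS M N z :
  bump_sum M.+1 N z = (bump_prim M N (z + h) - bump_prim M N (z - h)) / (2 * h).
Proof.
have hn : h != 0 by rewrite gt_eqF.
rewrite /bump_prim /bump_sum.
have -> : (z + h) / 2 + \sum_(k < N) sinc (k.+1%:R * h) ^+ M * (sin (k.+1%:R * (z + h)) / k.+1%:R) -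
   ((z - h) / 2 + \sum_(k < N) sinc (k.+1%:R * h) ^+ M * (sin (k.+1%:R * (z - h)) / k.+1%:R)) =
   h + \sum_(k < N) sinc (k.+1%:R * h) ^+ M * (2 * sin (k.+1%:R * h) * cos (k.+1%:R * z) / k.+1%:R).
  rewrite opprD addrACA -sumrB; congr (_ + _); first by field.
  by apply: eq_bigr => k _; rewrite sin_mul_cos mulrDr mulrBr; field.
rewrite mulrDl mulr_suml; congr (_ + _); first by field.
apply: eq_bigr => k _; rewrite exprS {1}/sinc.
have kn : k.+1%:R != 0 :> R by rewrite pnatr_eq0.
have aux (t y s c : R) : t != 0 -> s / (t * h) * y * c = y * (2 * s * c / t) / (2 * h).
  by move=> tn; field; rewrite tn hn.
exact: aux.
Qed.

(* Averaging over an interval of half-width [h] enlarges the support by [h];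
   the mean value theorem turns the average into a value. *)
Lemma bump_sum_cvg0 (M : nat) (e : R) : 0 < e -> exists C : R, 0 <= C /\
  forall (N : nat) (z : R), M.+1%:R * h + e <= z <= 2 * pi - (M.+1%:R * h + e) ->
    `|bump_sum M.+1 N z| <= C / N.+1%:R.
Proof.
move=> e0; elim: M => [|M [C [C0 IH]]].
  (* The bump of order one is a difference quotient of [saw_sum]; both ends lie in (0, 2 pi), where
     the limit is constant. *)
  have [C [C0 hC]] := saw_sum_cvg e e0; exists (C / h); split; first by rewrite divr_ge0// ltW.
  move=> N z; rewrite mul1r => /andP[z1 z2]; rewrite bump_sumS.
  have pe y : bump_prim 0 N y = saw_sum N y.
    by rewrite /bump_prim /saw_sum; congr (_ + _); apply: eq_bigr => k _; rewrite expr0 mul1r.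
  rewrite !pe; set a := saw_sum _ _; set b := saw_sum _ _.
  have ha : `|a - pi / 2| <= C / N.+1%:R.
    by apply: hC; apply/andP; split; move: z1 z2 h0; clear; lra.
  have hb : `|b - pi / 2| <= C / N.+1%:R.
    by apply: hC; apply/andP; split; move: z1 z2 h0; clear; lra.
  rewrite normrM (ger0_norm (_ : 0 <= (2 * h)^-1)) ?invr_ge0 ?mulr_ge0 ?(ltW h0)//.
  rewrite ler_pdivrMr ?mulr_gt0//.
  rewrite (_ : a - b = (a - pi / 2) - (b - pi / 2)); last by ring.
  rewrite (le_trans (ler_normB _ _))// (le_trans (lerD ha hb))//.
  by rewrite le_eqVlt; apply/orP; left; apply/eqP; set w := N.+1%:R^-1; field; rewrite gt_eqF.
exists C; split => // N z /andP[z1 z2]; rewrite bump_sumS.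
have hh : z - h < z + h by move: h0; clear; lra.
have [c] := MVT hh (fun x _ => is_derive_bump_prim M.+1 N x) (derivable_within_continuous
  (fun x _ => @ex_derive _ _ _ _ _ _ _ (is_derive_bump_prim M.+1 N x))).
rewrite in_itv/= => /andP[c1 c2] ->.
have -> : z + h - (z - h) = 2 * h by ring.
rewrite mulfK ?mulf_neq0 ?gt_eqF//.
have e1 : M.+2%:R * h = M.+1%:R * h + h by rewrite -[M.+2%:R]natr1 mulrDl mul1r.
rewrite e1 in z1 z2; set t := M.+1%:R * h in z1 z2 *.
by apply: IH; rewrite -/t; apply/andP; split; move: c1 c2 z1 z2 h0; clear; lra.
Qed.

End compact_support.

(** * Trigonometric sums on equidistant grids *)

Section grid_sums.
Variable R : realType.

Lemma sum_cos_arith0 (Q : nat) (j : int) (a : R) : (0 < `|j| < Q)%N ->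
  \sum_(m < Q) cos (a + m%:R * (2 * pi * j%:~R / Q%:R)) = 0.
Proof.
move=> /andP[j0 jQ]; set b := 2 * pi * _ / _.
have Q0 : (0 < Q)%N by exact: leq_ltn_trans jQ.
have QR : 0 < Q%:R :> R by rewrite ltr0n.
have pi0 := pi_gt0 R.
have sb : sin (b / 2) != 0.
  have sp (n : nat) : (0 < n < Q)%N -> 0 < sin (pi * n%:R / Q%:R) :> R.
    move=> /andP[n0 nQ]; apply: sin_gt0_pi; rewrite divr_gt0 ?mulr_gt0 ?ltr0n//=.
    by rewrite ltr_pdivrMr// ltr_pM2l// ltr_nat.
  have -> : b / 2 = pi * j%:~R / Q%:R by rewrite /b; field; rewrite gt_eqF.
  case: j {b} j0 jQ => n /= n0 nQ; first by rewrite -pmulrn gt_eqF// sp// n0.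
  rewrite NegzE mulrNz -pmulrn mulrN mulNr sinN oppr_eq0 gt_eqF// sp//.
apply: (mulfI (_ : 2 * sin (b / 2) != 0)); first by rewrite mulf_neq0.
rewrite mulr0 mulr_sumr; under eq_bigr do rewrite sin_mul_cos.
pose t (m : nat) := sin (a + m%:R * b - b / 2).
transitivity (t Q - t 0%N).
  rewrite -(telescope_sumr t (leq0n Q)) big_mkord; apply: eq_bigr => m _.
  by rewrite /t -(natr1 m); congr (sin _ - sin _); field.
rewrite /t; have -> : a + Q%:R * b - b / 2 = a + 0%:R * b - b / 2 + j%:~R * (2 * pi).
  by rewrite /b; field; rewrite gt_eqF.
by rewrite sinD_int2pi subrr.
Qed.

Definition grid (Q : nat) (x : R) (m : nat) : R := x + 2 * pi * m%:R / Q%:R.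

Lemma grid_cos_sum0 (Q : nat) (j : int) (x a : R) : (0 < `|j| < Q)%N ->
  \sum_(m < Q) cos (j%:~R * grid Q x m + a) = 0.
Proof.
move=> jQ; rewrite -[RHS](sum_cos_arith0 Q j (j%:~R * x + a) jQ).
by apply: eq_bigr => m _; congr cos; rewrite /grid; ring.
Qed.

(** Products of two terms have the integer frequencies k - l and k + l + n0, both below Q in
    absolute value, so only k = l survives. With n0 = 2 the frequencies are those of the sum itself,
    with n0 = 1 the half-integers created by multiplication with sin(y/2). *)
Lemma grid_parseval (Q D n0 : nat) (b : nat -> R) (x th : R) :
  (0 < n0)%N -> (2 * D + n0 <= Q)%N ->
  \sum_(m < Q) (\sum_(k < D) b k * cos ((k%:R + n0%:R / 2) * grid Q x m + th)) ^+ 2 =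
  Q%:R / 2 * \sum_(k < D) b k ^+ 2.
Proof.
move=> n00 DQ.
have e (y : R) : (\sum_(k < D) b k * cos ((k%:R + n0%:R / 2) * y + th)) ^+ 2 =
    \sum_(k < D) \sum_(l < D) b k * b l / 2 *
      (cos ((k%:Z - l%:Z)%:~R * y + 0) + cos ((k%:Z + l%:Z + n0%:Z)%:~R * y + 2 * th)).
  rewrite expr2 big_distrlr /=; apply: eq_bigr => k _; apply: eq_bigr => l _.
  set u := (k%:R + _) * y + th; set v := (l%:R + _) * y + th.
  have -> : (k%:Z - l%:Z)%:~R * y + 0 = u - v by rewrite /u /v rmorphB/= -!pmulrn; field.
  have -> : (k%:Z + l%:Z + n0%:Z)%:~R * y + 2 * th = u + v.
    by rewrite /u /v !rmorphD/= -!pmulrn; field.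
  by rewrite cosB (cosD u v); field.
under eq_bigr do rewrite e.
rewrite exchange_big /= mulr_sumr; apply: eq_bigr => k _.
rewrite exchange_big /= (bigD1 k)//= [X in _ + X]big1 ?addr0; last first.
  move=> l lk; rewrite -mulr_sumr big_split /=.
  have kD := ltn_ord k; have lD := ltn_ord l.
  have kl : (k : nat) <> l by move=> kl; move/eqP: lk; apply; apply: val_inj.
  rewrite !grid_cos_sum0 ?addr0 ?mulr0//; lia.
have kD := ltn_ord k.
rewrite -mulr_sumr big_split /= [X in _ * (_ + X)]grid_cos_sum0; last by lia.
rewrite addr0 subrr; under eq_bigr do rewrite mul0r addr0 cos0.
by rewrite sumr_const card_ord; ring.
Qed.

Lemma grid_shift (Q : nat) (f : R -> R) (x : R) : (0 < Q)%N ->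
  (forall (n : int) y, f (y + n%:~R * (2 * pi)) = f y) ->
  exists x0 : R, [/\ 0 <= x0, x0 <= 2 * pi / Q%:R &
    \sum_(m < Q) f (grid Q x m) = \sum_(m < Q) f (grid Q x0 m)].
Proof.
move=> Q0 fp; have QR : 0 < Q%:R :> R by rewrite ltr0n.
have p2 := two_pi_gt0 R.
have shift n (y : R) : \sum_(m < Q) f (grid Q (grid Q y n) m) = \sum_(m < Q) f (grid Q y m).
  elim: n => [|n IHn].
    by apply: eq_bigr => m _; rewrite /grid mulr0 mul0r addr0.
  rewrite -IHn; case: Q Q0 {IHn} QR => // Q _ QR.
  rewrite big_ord_recr [RHS]big_ord_recl /= addrC; congr (_ + _).
    rewrite -[RHS](fp 1); congr f; rewrite /grid -(natr1 n).
    by move: QR; rewrite -natr1 => QR; field; rewrite gt_eqF.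
  apply: eq_bigr => m _; congr f; rewrite /grid /= /bump /= add1n -(natr1 n) -(natr1 m).
  by field; rewrite gt_eqF// natr1.
have [k /andP[k1 k2]] := modulo_2pi _ x.
pose x' := x - k%:~R * (2 * pi).
have -> : \sum_(m < Q) f (grid Q x m) = \sum_(m < Q) f (grid Q x' m).
  apply: eq_bigr => m _; rewrite -[RHS](fp k); congr f; rewrite /grid /x'; ring.
pose n := Num.trunc (x' * Q%:R / (2 * pi)).
have /andP[n1 n2] : (n%:R <= x' * Q%:R / (2 * pi) < n.+1%:R).
  by apply: truncn_itv; exact: divr_ge0 (mulr_ge0 k1 (ler0n _ _)) (ltW p2).
rewrite ler_pdivlMr// in n1; rewrite ltr_pdivrMr// in n2.
exists (x' - 2 * pi * n%:R / Q%:R); split.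
- by rewrite subr_ge0 ler_pdivrMr// mulrC.
- rewrite lerBlDr -mulrDl ler_pdivlMr//.
  by move: n2; rewrite -(natr1 n) (mulrDl n%:R) mul1r => /ltW; rewrite -/x' (mulrC n%:R) addrC.
- by rewrite -(shift n (x' - _)) [grid Q (x' - _) n]/grid subrK.
Qed.

(** As 1 + s^2 >= (1 + s)^2 / 2, the terms are dominated by telescoping differences. *)
Lemma sum_inv_sqr_le (Q : nat) (be : R) : 0 < be ->
  \sum_(i < Q) (1 + (be * i%:R) ^+ 2)^-1 <= 2 * (1 + be^-1).
Proof.
move=> be0; have b1 (i : nat) : 0 < 1 + be * i%:R.
  by rewrite ltr_pwDl// mulr_ge0// ltW.
case: Q => [|Q]; first by rewrite big_ord0 mulr_ge0// addr_ge0// invr_ge0 ltW.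
rewrite big_ord_recl mulr0 expr0n addr0 invr1.
apply: (@le_trans _ _ (1 + 2 * be^-1)); last by rewrite mulrDr mulr1 lerD2r ler1n.
rewrite lerD2l.
pose t (i : nat) := - (2 * be^-1 * (1 + be * i%:R)^-1).
apply: (@le_trans _ _ (\sum_(i < Q) (t i.+1 - t i))).
  apply: ler_sum => i _; rewrite lift0.
  have bi := b1 i; have bi1 := b1 i.+1.
  apply: (@le_trans _ _ (2 * (1 + be * i.+1%:R) ^- 2)).
    rewrite -[leLHS]mulr1 ler_pdivlMr ?exprn_gt0//.
    set s := be * _; have s0 : 0 <= s by rewrite mulr_ge0// ltW.
    have sp : 0 < 1 + s ^+ 2 by rewrite ltr_pwDl// sqr_ge0.
    rewrite mulr1 mulrC ler_pdivrMr//.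
    by have := sqr_ge0 (1 - s); rewrite !expr2; lra.
  have -> : t i.+1 - t i = 2 * ((1 + be * i%:R) * (1 + be * i.+1%:R))^-1.
    have aux (A : R) : A != 0 -> A + be != 0 -> be != 0 ->
        - (2 * be^-1 * (A + be)^-1) - - (2 * be^-1 * A^-1) = 2 * (A * (A + be))^-1.
      by move=> A0 AB0 bn0; field; rewrite A0 AB0.
    have e : 1 + be * i.+1%:R = 1 + be * i%:R + be by rewrite -(natr1 i); ring.
    by rewrite /t e aux// ?gt_eqF// -e.
  rewrite ler_wpM2l// lef_pV2 ?posrE ?mulr_gt0 ?exprn_gt0//.
  rewrite expr2 ler_wpM2r ?(ltW bi1)// lerD2l ler_wpM2l ?(ltW be0)//.
  by rewrite ler_nat.
rewrite -(big_mkord xpredT (fun i => t i.+1 - t i)) telescope_sumr//.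
rewrite /t mulr0 addr0 invr1 mulr1 opprK addrC gerDl oppr_le0.
by rewrite !mulr_ge0 ?invr_ge0 ?(ltW be0) ?(ltW (b1 _)).
Qed.

Definition grid_weight (L : R) (y : R) : R := (1 + L ^+ 2 * (2 * sin (y / 2)) ^+ 2)^-1.

Lemma grid_weight_sum (Q : nat) (L x : R) : (0 < Q)%N -> 1 <= L -> 8 * L <= Q%:R ->
  \sum_(m < Q) grid_weight L (grid Q x m) <= 5 / 2 * (Q%:R / L).
Proof.
move=> Q0 L1 LQ; have QR : 0 < Q%:R :> R by rewrite ltr0n.
have L0 : 0 < L by exact: lt_le_trans L1.
have p2 := two_pi_gt0 R.
have [|x0 [x00 x0Q ->]] := grid_shift Q (grid_weight L) x Q0.
  move=> n y; rewrite /grid_weight; congr (_^-1).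
  congr (1 + L ^+ 2 * _); rewrite !exprMn; congr (_ * _).
  have h1 := sin_half_sqr _ y; have h2 := sin_half_sqr _ (y + n%:~R * (2 * pi)).
  rewrite cosD_int2pi in h2; lra.
(* A node at distance c >= 2 pi i / Q from an end of the period has 2 sin(y/2) >= c/2 >= 2 i / Q,
   because pi >= 2. *)
pose be : R := 2 * L / Q%:R.
have be0 : 0 < be by rewrite divr_gt0// mulr_gt0.
have wle (y t : R) : 0 <= t -> t <= 2 * sin (y / 2) -> grid_weight L y <= (1 + L ^+ 2 * t ^+ 2)^-1.
  have pos (z : R) : 0 < 1 + L ^+ 2 * z ^+ 2.
    by rewrite ltr_pwDl//; apply: mulr_ge0; exact: sqr_ge0.
  move=> t0 ty; rewrite /grid_weight lef_pV2 ?posrE//.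
  by rewrite lerD2l ler_wpM2l ?sqr_ge0// lerXn2r ?nnegrE// (le_trans t0).
(* Each node is charged to the nearer end of the period; adding the bounds for both ends avoids
   splitting the sum. *)
apply: (@le_trans _ _ (\sum_(m < Q) ((1 + (be * m%:R) ^+ 2)^-1 + (1 + (be * (rev_ord m)%:R) ^+ 2)^-1))).
  apply: ler_sum => m _; set y := grid Q x0 m.
  have ym : 2 * pi * m%:R / Q%:R <= y by rewrite /y /grid lerDr.
  have ym2 : 2 * pi * (rev_ord m)%:R / Q%:R <= 2 * pi - y.
    have -> : (rev_ord m)%:R = Q%:R - m%:R - 1 :> R.
      by rewrite /= natrB ?ltn_ord// -natr1; ring.
    rewrite /y /grid; apply: (@le_trans _ _ (2 * pi - 2 * pi / Q%:R - 2 * pi * m%:R / Q%:R)).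
      by rewrite le_eqVlt; apply/orP; left; apply/eqP; field; rewrite gt_eqF.
    by lra.
  have i1 (i : nat) : 0 <= 2 * pi * i%:R / Q%:R :> R.
    exact: divr_ge0 (mulr_ge0 (ltW p2) (ler0n _ i)) (ltW QR).
  have y0 : 0 <= y by exact: le_trans (i1 _) ym.
  have y2 : y <= 2 * pi by rewrite -subr_ge0; exact: le_trans (i1 _) ym2.
  have sy := sin_half_ge _ y ltac:(by rewrite y0).
  have pi2 := @pi_ge2 R.
  have main (i : nat) (c : R) : 2 * pi * i%:R / Q%:R <= c -> 0 <= c -> c / 4 <= sin (y / 2) ->
      grid_weight L y <= (1 + (be * i%:R) ^+ 2)^-1.
    move=> ic c0 cs; apply: (le_trans (wle y (c / 2) _ _)); [by rewrite divr_ge0|lra|].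
    have pos (z : R) : 0 < 1 + z ^+ 2 by rewrite ltr_pwDl// sqr_ge0.
    rewrite -exprMn lef_pV2 ?posrE//.
    have bi : be * i%:R <= L * (c / 2).
      have -> : be * i%:R = L * ((2 * 2 * i%:R / Q%:R) / 2) by rewrite /be; field; rewrite gt_eqF.
      rewrite ler_wpM2l ?(ltW L0)// ler_wpM2r// (le_trans _ ic)//.
      by rewrite ler_wpM2r ?invr_ge0 ?(ltW QR)// ler_wpM2r//; lra.
    rewrite lerD2l lerXn2r ?nnegrE//.
      by rewrite mulr_ge0// ltW.
    by rewrite mulr_ge0 ?divr_ge0// ltW.
  have w0 (t : R) : 0 <= (1 + t ^+ 2)^-1 by rewrite invr_ge0 addr_ge0// sqr_ge0.
  move: sy; have [_|_] := leP y (2 * pi - y) => sy.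
    by rewrite (le_trans (main m y ym y0 sy))// lerDl.
  rewrite (le_trans (main (rev_ord m) (2 * pi - y) ym2 _ sy)) ?subr_ge0// lerDr.
  exact: w0.
rewrite big_split /=.
have -> : \sum_(m < Q) (1 + (be * (Q - m.+1)%:R) ^+ 2)^-1 = \sum_(m < Q) (1 + (be * m%:R) ^+ 2)^-1.
  rewrite (reindex_inj rev_ord_inj); apply: eq_bigr => m _ /=.
  by rewrite subnSK// subKn// ltnW.
have h := sum_inv_sqr_le Q be be0.
apply: (le_trans (lerD h h)).
have -> : be^-1 = Q%:R / L / 2 by rewrite /be; field; rewrite !gt_eqF.
have : 8 <= Q%:R / L by rewrite ler_pdivlMr.
by move: (Q%:R / L) => q; lra.
Qed.

End grid_sums.

(** * Absolute sums of cosine polynomials over grids *)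

Section grid_norm.
Variable R : realType.
Local Notation grid := (grid R).

Lemma trig_sum_abel (D : nat) (d : nat -> R) (th y : R) :
  d 0%N = 0 -> d D.+1 = 0 ->
  2 * sin (y / 2) * \sum_(k < D) d k.+1 * cos (k.+1%:R * y + th) =
  \sum_(k < D.+1) (d k - d k.+1) * cos ((k%:R + 1%:R / 2) * y + (th - pi / 2)).
Proof.
move=> d0 dD; pose s (k : nat) := cos ((k%:R + 1%:R / 2) * y + (th - pi / 2)).
have -> : \sum_(k < D.+1) (d k - d k.+1) * s k =
    \sum_(k < D.+1) d k * s k - \sum_(k < D.+1) d k.+1 * s k.
  by rewrite -sumrB; apply: eq_bigr => k _; rewrite mulrBl.
rewrite big_ord_recl [X in _ = _ - X]big_ord_recr /= d0 dD !mul0r add0r addr0.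
rewrite -sumrB mulr_sumr; apply: eq_bigr => k _; rewrite /bump /= add1n.
rewrite mulrCA sin_mul_cos mulrBr /s.
by congr (_ * _ - _ * _); rewrite addrA cosBpihalf; congr sin; rewrite -?(natr1 k); field.
Qed.

(* Cauchy-Schwarz with the weight 1 + (2 L sin(y/2))^2, and Parseval on the grid
   for the sum P and for 2 sin(y/2) P, whose coefficients are differences of [d]. *)
Lemma grid_norm_le (Q D L : nat) (d : nat -> R) (A th x : R) :
  0 < A -> (0 < L)%N -> (D < 2 * L)%N -> (8 * L <= Q)%N ->
  d 0%N = 0 -> d D.+1 = 0 ->
  (forall k, `|d k| <= A) -> (forall k, `|d k - d k.+1| <= A / L%:R) ->
  \sum_(m < Q) `|\sum_(k < D) d k.+1 * cos (k.+1%:R * grid Q x m + th)| <= 3 * Q%:R * A.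
Proof.
move=> A0 L0 DL LQ d0 dD dA ddA.
have LR : 0 < L%:R :> R by rewrite ltr0n.
have L1 : 1 <= L%:R :> R by rewrite ler1n.
have Q0 : (0 < Q)%N by lia.
pose P (y : R) := \sum_(k < D) d k.+1 * cos (k.+1%:R * y + th).
pose w (y : R) := grid_weight R L%:R y.
have LA : 0 < L%:R * A by rewrite mulr_gt0.
(* Pointwise inequality of arithmetic and geometric means; the scale L A balances the two sums
   obtained from it. *)
have Young (y : R) : `|P y| <= 2^-1 * (L%:R * A) * w y +
    2^-1 / (L%:R * A) * (P y ^+ 2 + L%:R ^+ 2 * (2 * sin (y / 2) * P y) ^+ 2).
  rewrite /w /grid_weight; set s := 2 * sin (y / 2).
  set W := 1 + L%:R ^+ 2 * s ^+ 2.
  have W0 : 0 < W by rewrite /W ltr_pwDl//; apply: mulr_ge0; exact: sqr_ge0.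
  have -> : P y ^+ 2 + L%:R ^+ 2 * (s * P y) ^+ 2 = W * `|P y| ^+ 2.
    by rewrite real_normK ?num_real// /W; ring.
  set p := `|P y|; have p0 : 0 <= p by exact: normr_ge0.
  have : 0 <= (L%:R * A - W * p) ^+ 2 by exact: sqr_ge0.
  have -> : 2^-1 * (L%:R * A) * W^-1 + 2^-1 / (L%:R * A) * (W * p ^+ 2) =
     p + (L%:R * A - W * p) ^+ 2 / (2 * W * (L%:R * A)).
    by field; rewrite !gt_eqF.
  by move=> h; rewrite lerDl divr_ge0// !mulr_ge0 ?ltW.
apply: (@le_trans _ _ (\sum_(m < Q) (2^-1 * (L%:R * A) * w (grid Q x m) +
   2^-1 / (L%:R * A) * (P (grid Q x m) ^+ 2 +
   L%:R ^+ 2 * (2 * sin (grid Q x m / 2) * P (grid Q x m)) ^+ 2)))).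
  by apply: ler_sum => m _; exact: Young.
rewrite big_split /= -!mulr_sumr big_split /= -mulr_sumr.
have S1 : \sum_(m < Q) P (grid Q x m) ^+ 2 <= Q%:R / 2 * (2 * L%:R * A ^+ 2).
  have -> : \sum_(m < Q) P (grid Q x m) ^+ 2 = Q%:R / 2 * \sum_(k < D) d k.+1 ^+ 2.
    rewrite -(grid_parseval R Q D 2 (fun k => d k.+1) x th)//; last by lia.
    apply: eq_bigr => m _; congr (_ ^+ 2); apply: eq_bigr => k _.
    by rewrite -(natr1 k) divff.
  rewrite ler_wpM2l ?divr_ge0//.
  apply: (@le_trans _ _ (\sum_(k < D) A ^+ 2)).
    apply: ler_sum => k _; rewrite -real_normK ?num_real//.
    by rewrite lerXn2r ?nnegrE// ltW.
  rewrite sumr_const card_ord -(mulr_natl (A ^+ 2)) ler_wpM2r ?sqr_ge0//.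
  by rewrite -natrM ler_nat ltnW.
have S2 : \sum_(m < Q) (2 * sin (grid Q x m / 2) * P (grid Q x m)) ^+ 2 <=
    Q%:R / 2 * (2 * L%:R * (A / L%:R) ^+ 2).
  have -> : \sum_(m < Q) (2 * sin (grid Q x m / 2) * P (grid Q x m)) ^+ 2 =
      Q%:R / 2 * \sum_(k < D.+1) (d k - d k.+1) ^+ 2.
    rewrite -(grid_parseval R Q D.+1 1 (fun k => d k - d k.+1) x (th - pi / 2))//; last by lia.
    by apply: eq_bigr => m _; rewrite /P trig_sum_abel.
  rewrite ler_wpM2l ?divr_ge0//.
  apply: (@le_trans _ _ (\sum_(k < D.+1) (A / L%:R) ^+ 2)).
    apply: ler_sum => k _; rewrite -real_normK ?num_real//.
    by rewrite lerXn2r ?nnegrE// divr_ge0// ltW.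
  rewrite sumr_const card_ord -(mulr_natl ((A / L%:R) ^+ 2)) ler_wpM2r ?sqr_ge0//.
  by rewrite -natrM ler_nat.
have S3 : \sum_(m < Q) w (grid Q x m) <= 5 / 2 * (Q%:R / L%:R).
  apply: grid_weight_sum => //.
  by rewrite -natrM ler_nat.
have h1 : 2^-1 * (L%:R * A) * (\sum_(m < Q) w (grid Q x m)) <= 5 / 4 * (Q%:R * A).
  apply: (@le_trans _ _ (2^-1 * (L%:R * A) * (5 / 2 * (Q%:R / L%:R)))).
    by rewrite ler_wpM2l// mulr_ge0// ltW.
  by rewrite le_eqVlt; apply/orP; left; apply/eqP; field; rewrite gt_eqF.
have h2 : 2^-1 / (L%:R * A) * (\sum_(m < Q) P (grid Q x m) ^+ 2 +
    L%:R ^+ 2 * \sum_(m < Q) (2 * sin (grid Q x m / 2) * P (grid Q x m)) ^+ 2) <= Q%:R * A.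
  apply: (@le_trans _ _ (2^-1 / (L%:R * A) * (Q%:R / 2 * (2 * L%:R * A ^+ 2) +
      L%:R ^+ 2 * (Q%:R / 2 * (2 * L%:R * (A / L%:R) ^+ 2))))).
    rewrite ler_wpM2l ?divr_ge0 ?(ltW LA)// lerD// ler_wpM2l// sqr_ge0.
  by rewrite le_eqVlt; apply/orP; left; apply/eqP; field; rewrite !gt_eqF.
apply: (le_trans (lerD h1 h2)).
have QA : 0 <= Q%:R * A by rewrite mulr_ge0// ltW.
have -> : 3 * Q%:R * A = 5 / 4 * (Q%:R * A) + Q%:R * A + 3 / 4 * (Q%:R * A) by field.
by rewrite lerDl mulr_ge0.
Qed.

(** The grid of the boxes may be too coarse for Parseval at high frequencies; for a nonnegative
    function it can be refined at the cost of more nodes. *)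
Lemma subgrid_sum_le (Q' q : nat) (f : R -> R) (x : R) : (0 < Q')%N -> (0 < q)%N ->
  (forall y, 0 <= f y) -> (forall (n : int) y, f (y + n%:~R * (2 * pi)) = f y) ->
  \sum_(m < Q') f (x - 2 * pi * m%:R / Q'%:R) <=
  \sum_(i < q * Q') f (grid (q * Q') (x + 2 * pi / (q * Q')%:R) i).
Proof.
move=> Q0 q0 f0 fp; set Q := (q * Q')%N.
have QR : Q%:R != 0 :> R by rewrite pnatr_eq0; lia.
have Q'R : Q'%:R != 0 :> R by rewrite pnatr_eq0; lia.
have qR : q%:R != 0 :> R by rewrite pnatr_eq0; lia.
(* The coarse nodes run backwards from x. Starting the fine grid one step after x keeps the index
   below Q also for m = 0, which is reached after a full turn. *)
have gP (m : 'I_Q') : (Q.-1 - q * m < Q)%N by have := ltn_ord m; rewrite /Q; nia.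
pose g (m : 'I_Q') := Ordinal (gP m).
have ginj : injective g.
  move=> m1 m2 /(congr1 val) /= e; apply: val_inj => /=.
  have := ltn_ord m1; have := ltn_ord m2; move: e; rewrite /Q; nia.
have fg (m : 'I_Q') : f (x - 2 * pi * m%:R / Q'%:R) = f (grid Q (x + 2 * pi / Q%:R) (g m)).
  rewrite -(fp 1); congr f; rewrite /grid /g /=.
  have -> : (Q.-1 - q * m)%:R = Q%:R - 1 - q%:R * m%:R :> R.
    have h : (Q.-1 - q * m + q * m + 1 = Q)%N by have := ltn_ord m; rewrite /Q; nia.
    by rewrite -[in RHS]h !natrD natrM; ring.
  by rewrite /Q natrM; field; rewrite Q'R qR.
under eq_bigr do rewrite fg.
rewrite (bigID (fun i => i \in g @: [set: 'I_Q']%SET)) /= big_imset /=; last by move=> m1 m2 _ _; exact: ginj.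
rewrite [X in _ <= X + _](eq_bigl predT); last by move=> m; rewrite !inE.
by rewrite lerDl sumr_ge0.
Qed.

End grid_norm.

(** * Dyadic blocks *)

Section cutoffs.
Variable R : realType.

(** The de la Vallee Poussin multiplier, 1 up to 2^u and linear down to 0 at 2^(u+1). A sharp cut
    would not have differences of order 2^-u, which the grid estimate needs. *)
Definition cutoff (u k : nat) : R := Num.max 0 (Num.min 1 (2 - k%:R / 2 ^+ u)).

Definition dyadic_part (u k : nat) : R :=
  if u is u'.+1 then cutoff u k - cutoff u' k else cutoff 0 k.

Lemma clampE (t : R) :
  Num.max 0 (Num.min 1 t) = if t <= 0 then 0 else if t <= 1 then t else 1.
Proof.
case: ifP => [t0|/negbT]; last rewrite -ltNge => t0.
  by apply/max_idPl; rewrite ge_min t0 orbT.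
case: ifP => [t1|/negbT]; last rewrite -ltNge => t1.
  by rewrite (min_idPr t1); apply/max_idPr; exact: ltW.
by rewrite (min_idPl (ltW t1)); apply/max_idPr; exact: ler01.
Qed.

Lemma cutoff_ge0 u k : 0 <= cutoff u k.
Proof. by rewrite le_max lexx. Qed.

Lemma cutoff_le1 u k : cutoff u k <= 1.
Proof. by rewrite ge_max ler01 ge_min lexx. Qed.

Lemma cutoff1 u k : (k <= 2 ^ u)%N -> cutoff u k = 1.
Proof.
move=> ku; have h : k%:R / 2 ^+ u <= 1 :> R.
  by rewrite ler_pdivrMr ?exprn_gt0// mul1r -natrX ler_nat.
have h1 : 1 <= 2 - k%:R / 2 ^+ u :> R by lra.
by rewrite /cutoff (min_idPl h1); apply/max_idPr; exact: ler01.
Qed.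

Lemma cutoff0 u k : (2 ^ u.+1 <= k)%N -> cutoff u k = 0.
Proof.
move=> ku; have h : 2 <= k%:R / 2 ^+ u :> R.
  by rewrite ler_pdivlMr ?exprn_gt0// -exprS -natrX ler_nat.
have h1 : 2 - k%:R / 2 ^+ u <= 0 :> R by lra.
by rewrite /cutoff; apply/max_idPl; rewrite ge_min h1 orbT.
Qed.

Lemma cutoff_lipschitz u k : `|cutoff u k - cutoff u k.+1| <= 2 ^- u.
Proof.
have -> : 2 ^- u = (2 - k%:R / 2 ^+ u) - (2 - k.+1%:R / 2 ^+ u) :> R.
  by rewrite -(natr1 k) mulrDl; ring.
have : 2 - k.+1%:R / 2 ^+ u <= 2 - k%:R / 2 ^+ u :> R.
  by rewrite lerD2l lerN2 ler_wpM2r ?invr_ge0 ?exprn_ge0// ler_nat.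
rewrite /cutoff !clampE; set s := 2 - k%:R / 2 ^+ u; set t := 2 - k.+1%:R / 2 ^+ u; move: s t => s t st.
rewrite ler_norml; apply/andP.
by do 4 ?[case: ifP => ?]; split; lra.
Qed.

Lemma cutoff_mono u k : cutoff u k <= cutoff u.+1 k.
Proof.
rewrite /cutoff !clampE; have : 2 - k%:R / 2 ^+ u <= 2 - k%:R / 2 ^+ u.+1 :> R.
  rewrite lerD2l lerN2 ler_wpM2l// lef_pV2 ?posrE ?exprn_gt0//.
  by rewrite ler_weXn2l// ler1n.
set s := 2 - k%:R / 2 ^+ u; set t := 2 - k%:R / 2 ^+ u.+1; move: s t => s t st.
by do 4 ?[case: ifP => ?]; lra.
Qed.

Lemma sum_dyadic_part U k : \sum_(u < U.+1) dyadic_part u k = cutoff U k.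
Proof.
elim: U => [|U IH]; first by rewrite big_ord1.
by rewrite big_ord_recr /= IH addrC subrK.
Qed.

Lemma dyadic_part_ge0 u k : 0 <= dyadic_part u k.
Proof. by case: u => [|u]; rewrite /dyadic_part ?subr_ge0 ?cutoff_ge0 ?cutoff_mono. Qed.

Lemma dyadic_part_le1 u k : dyadic_part u k <= 1.
Proof.
case: u => [|u]; rewrite /dyadic_part ?cutoff_le1//.
by have := cutoff_ge0 u k; have := cutoff_le1 u.+1 k; lra.
Qed.

Lemma dyadic_part_low u k : (k <= 2 ^ u)%N -> dyadic_part u.+1 k = 0.
Proof.
move=> ku; rewrite /dyadic_part !cutoff1 ?subrr//.
by rewrite (leq_trans ku)// leq_exp2l.
Qed.

Lemma dyadic_part_high u k : (2 ^ u.+1 <= k)%N -> dyadic_part u k = 0.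
Proof.
case: u => [|u] ku; rewrite /dyadic_part ?cutoff0 ?subrr//.
by rewrite (leq_trans _ ku)// leq_exp2l.
Qed.

Lemma dyadic_part_lipschitz u k :
  `|dyadic_part u k - dyadic_part u k.+1| <= 3 / 2 ^+ u.
Proof.
have p0 v : 0 <= 2 ^- v :> R by rewrite invr_ge0 exprn_ge0.
case: u => [|u]; rewrite /dyadic_part.
  by have := cutoff_lipschitz 0 k; rewrite expr0 invr1; lra.
have -> : cutoff u.+1 k - cutoff u k - (cutoff u.+1 k.+1 - cutoff u k.+1) =
   (cutoff u.+1 k - cutoff u.+1 k.+1) - (cutoff u k - cutoff u k.+1) by ring.
rewrite (le_trans (ler_normB _ _))// (le_trans (lerD (cutoff_lipschitz _ _) (cutoff_lipschitz _ _)))//.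
have -> : 2 ^- u = 2 * 2 ^- u.+1 :> R by rewrite exprS invfM mulrA divff ?mul1r.
by have := p0 u.+1; lra.
Qed.

Lemma exprD1_le (x : R) (M : nat) : 0 <= x <= 1 -> (1 + x) ^+ M <= 1 + (2 ^+ M - 1) * x.
Proof.
move=> /andP[x0 x1]; elim: M => [|M IH]; first by rewrite !expr0 subrr mul0r addr0.
rewrite exprS (le_trans (ler_wpM2l _ IH)) ?addr_ge0//.
have p1 : 1 <= 2 ^+ M :> R by rewrite exprn_ege1// ler1n.
rewrite exprS; set p := 2 ^+ M in p1 *; move: p p1 => p p1.
have : (p - 1) * x * x <= (p - 1) * x * 1.
  by rewrite ler_wpM2l// mulr_ge0//; lra.
by lra.
Qed.

(** After factoring out k^r, the real exponent is raised to the integer M, and (1 + 1/k)^M <= 1 +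
    (2^M - 1)/k by convexity. *)
Lemma powR_succ_le (k M : nat) (r : R) : (0 < k)%N -> 0 <= r -> r <= M%:R ->
  k.+1%:R `^ r - k%:R `^ r <= k%:R `^ r * (2 ^+ M / k%:R).
Proof.
move=> k0 r0 rM; have kR : 0 < k%:R :> R by rewrite ltr0n.
have -> : k.+1%:R = k%:R * (1 + k%:R^-1) :> R.
  by rewrite -(natr1 k) mulrDr mulr1 divff ?gt_eqF.
have ki : 0 <= k%:R^-1 :> R by rewrite invr_ge0.
rewrite powRM ?addr_ge0// -{2}[k%:R `^ r]mulr1 -mulrBr ler_wpM2l ?powR_ge0//.
rewrite lerBlDl; apply: (@le_trans _ _ ((1 + k%:R^-1) `^ M%:R)).
  by rewrite ler_powR// lerDl.
rewrite powR_mulrn ?addr_ge0//.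
apply: (le_trans (exprD1_le _ M _)).
  by rewrite ki /= invf_le1// ler1n.
by rewrite lerD2l ler_wpM2r// gerBl.
Qed.

Lemma sinc_le1 (z : R) : 0 < z -> `|sinc R z| <= 1.
Proof.
move=> z0; rewrite /sinc normrM normfV (gtr0_norm z0) ler_pdivrMr// mul1r.
have [c _] := MVT_segment (ltW z0) (fun x _ => is_derive_sin x)
  (continuous_subspaceT (@continuous_sin R)).
rewrite sin0 !subr0 => ->; rewrite normrM (gtr0_norm z0) -[leRHS]mul1r ler_wpM2r ?(ltW z0)//.
by rewrite ler_norml cos_geN1 cos_le1.
Qed.

Lemma sinc_le_inv (z : R) : 0 < z -> `|sinc R z| <= z^-1.
Proof.
move=> z0; rewrite /sinc normrM normfV (gtr0_norm z0) -[leRHS]mul1r.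
by rewrite ler_wpM2r ?invr_ge0 ?(ltW z0)// ler_norml sin_geN1 sin_le1.
Qed.

Lemma sin_lipschitz (x y : R) : x <= y -> `|sin y - sin x| <= y - x.
Proof.
move=> xy; have [c _ ->] := MVT_segment xy (fun x _ => is_derive_sin x)
  (continuous_subspaceT (@continuous_sin R)).
rewrite normrM (ger0_norm (_ : 0 <= y - x)) ?subr_ge0//.
by rewrite -[leRHS]mul1r ler_wpM2r ?subr_ge0// ler_norml cos_geN1 cos_le1.
Qed.

(** The variation over a step h near z is at most 2 h / (z + h), and z is a multiple of h; so the
    bound does not depend on h. *)
Lemma sinc_lipschitz (k : nat) (h : R) : (0 < k)%N -> 0 < h ->
  `|sinc R (k.+1%:R * h) - sinc R (k%:R * h)| <= 2 / k.+1%:R.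
Proof.
move=> k0 h0; have kR : 0 < k%:R :> R by rewrite ltr0n.
have k1R : 0 < k.+1%:R :> R by rewrite ltr0n.
set z := k%:R * h; have z0 : 0 < z by rewrite mulr_gt0.
have -> : k.+1%:R * h = z + h by rewrite /z -(natr1 k) mulrDl mul1r.
have zh : 0 < z + h by rewrite addr_gt0.
have -> : sinc R (z + h) - sinc R z =
    ((sin (z + h) - sin z) - h * (sin z / z)) / (z + h).
  by rewrite /sinc; field; rewrite !gt_eqF.
have k1E : k.+1%:R = (z + h) / h.
  by rewrite /z -(natr1 k) mulrDl mulfK ?divff ?gt_eqF.
rewrite k1E invf_div (mulrA 2 h) normrM normfV (gtr0_norm zh) ler_wpM2r ?invr_ge0 ?(ltW zh)//.
rewrite (le_trans (ler_normB _ _))//.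
have h1 := sin_lipschitz z (z + h) ltac:(by rewrite lerDl ltW).
rewrite (_ : z + h - z = h) in h1; last by ring.
have h2 : `|h * (sin z / z)| <= h.
  by rewrite normrM (gtr0_norm h0) -[leRHS]mulr1 ler_wpM2l ?(ltW h0)// sinc_le1.
by lra.
Qed.

Lemma exprB_le (x y t : R) (M : nat) : `|x| <= t -> `|y| <= t ->
  `|x ^+ M.+1 - y ^+ M.+1| <= M.+1%:R * t ^+ M * `|x - y|.
Proof.
move=> xt yt; have t0 : 0 <= t by exact: le_trans xt.
rewrite subrXX normrM mulrC ler_wpM2r//.
apply: (le_trans (ler_norm_sum _ _ _)).
apply: (@le_trans _ _ (\sum_(i < M.+1) t ^+ M)); last by rewrite sumr_const card_ord -(mulr_natl (t ^+ M)).
apply: ler_sum => i _; rewrite normrM !normrX.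
have e : M = (M.+1.-1 - i + i)%N by have := ltn_ord i; rewrite /=; lia.
by rewrite [in leRHS]e exprD ler_pM ?exprn_ge0// ?lerXn2r ?nnegrE.
Qed.

End cutoffs.

(** * Dyadic blocks of the derivative of a bump, summed over the boxes of one scale *)

Section blocks.
Variables (R : realType) (r : R) (m : nat).
Hypotheses (r0 : 0 < r) (rm : r + 2 <= m%:R).

(** The m+1 averages spread the support to (m+1) h, and one further h is the margin in
    [bump_sum_cvg0]; (m+2) h is half the side of a box of scale a. *)
Definition bump_width (a : nat) : R := pi / (m.+2%:R * 2 ^+ a.+1).

Lemma bump_width_gt0 a : 0 < bump_width a.
Proof. by rewrite divr_gt0 ?pi_gt0// mulr_gt0 ?exprn_gt0. Qed.

Definition kernel_coef (a k : nat) : R := k%:R `^ r * sinc R (k%:R * bump_width a) ^+ m.+1.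

(** The constant term of the series goes into block 0; the phase r pi / 2 is the one that
    convolution with [F1] takes back. *)
Definition kernel_block (u a : nat) (x : R) : R :=
  2 ^- a * ((u == 0%N)%:R + 2 * \sum_(k < (2 ^ u.+1).-1)
    (dyadic_part R u k.+1 * kernel_coef a k.+1) * cos (k.+1%:R * x + r * pi / 2)).

(** One summand for each factor of a coefficient: the cutoff, the power k^r and the power of
    sinc. *)
Definition block_cst1 : R := 3 + 2 ^+ m.+1 + 4 * m.+1%:R.

(** 48 = 2 * 3 * 8: the cosine normalization, the constant of [grid_norm_le], and the oversampling
    of the grid. The last factor comes from the bound for sinc above the scale. *)
Definition block_cst : R := 48 * block_cst1 * 2 `^ r * (2 * m.+2%:R) ^+ m.

(** Blocks below the scale decay like 2^-r per step, those above at least like 1/2; this is the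
    slower of the two rates. *)
Definition block_rate : R := 2 `^ (- Num.min r 1).

Lemma block_cst1_ge1 : 1 <= block_cst1.
Proof.
have h1 : 0 <= 2 ^+ m.+1 :> R by rewrite exprn_ge0.
have h2 : 0 <= m.+1%:R :> R by [].
rewrite /block_cst1; lra.
Qed.

Lemma pow2r_ge1 : 1 <= 2 `^ r.
Proof. by rewrite -[leLHS](powRr0 2) ler_powR ?ler1n// ltW. Qed.

Lemma block_cst_ge48 : 48 <= block_cst.
Proof.
have h : 1 <= (2 * m.+2%:R) ^+ m :> R by rewrite exprn_ege1// -natrM ler1n.
rewrite /block_cst -[leLHS]mulr1 -[X in X <= _]mulr1 -[X in X <= _]mulr1 -!mulrA ler_wpM2l//.
rewrite ler_pM ?mulr_ge0 ?block_cst1_ge1//.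
by rewrite ler_pM ?pow2r_ge1.
Qed.

Lemma block_rate_gt0 : 0 < block_rate. Proof. by rewrite powR_gt0. Qed.

Lemma block_rate_lt1 : block_rate < 1.
Proof.
have e0 : 0 < Num.min r 1 by rewrite lt_min r0 ltr01.
have h : 1 `^ Num.min r 1 < 2 `^ Num.min r 1 by rewrite gt0_ltr_powR ?nnegrE// ltr1n.
by rewrite /block_rate powRN invf_lt1 ?powR_gt0//; rewrite powR1 in h.
Qed.

Lemma block_rate_half : 2^-1 <= block_rate.
Proof.
rewrite /block_rate powRN lef_pV2 ?posrE ?powR_gt0//.
by rewrite -[leRHS]powRr1// ler_powR ?ler1n// ge_min lexx orbT.
Qed.

Lemma block_rate_pow2r : 1 <= 2 `^ r * block_rate.
Proof.
rewrite /block_rate -powRD ?pnatr_eq0 ?implybT//.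
by rewrite -[leLHS](powRr0 2) ler_powR ?ler1n// subr_ge0 ge_min lexx.
Qed.

(** The product rule for differences gives three terms of order 1/L. Only t^m is claimed, because a
    difference of (m+1)-st powers of sinc keeps just m factors. *)
Lemma block_coef_bound (v a : nat) (t : R) : let u := v.+1 in let L : R := 2 ^+ u in
  0 < t -> t <= 1 -> (forall k : nat, (2 ^ v <= k)%N -> `|sinc R (k%:R * bump_width a)| <= t) ->
  (forall k, `|dyadic_part R u k * kernel_coef a k| <= block_cst1 * (2 * L) `^ r * t ^+ m) /\
  (forall k, `|dyadic_part R u k * kernel_coef a k - dyadic_part R u k.+1 * kernel_coef a k.+1|
     <= block_cst1 * (2 * L) `^ r * t ^+ m / L).
Proof.
move=> u L t0 t1 st; have L0 : 0 < L by rewrite exprn_gt0.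
have C1 := block_cst1_ge1; have C0 : 0 <= block_cst1 by lra.
have tm0 : 0 <= t ^+ m by rewrite exprn_ge0// ltW.
have Pr0 : 0 <= (2 * L) `^ r by exact: powR_ge0.
have A0 : 0 <= block_cst1 * (2 * L) `^ r * t ^+ m by rewrite !mulr_ge0.
have vk k : (2 ^ v <= k)%N -> (0 < k)%N by apply: leq_trans; rewrite expn_gt0.
have pk k : (k <= 2 ^ u.+1)%N -> k%:R `^ r <= (2 * L) `^ r.
  move=> ku; rewrite ge0_ler_powR ?nnegrE ?mulr_ge0 ?(ltW L0) ?(ltW r0)//.
  by rewrite /L -exprS -natrX ler_nat.
have qk k : (2 ^ v <= k)%N -> `|sinc R (k%:R * bump_width a) ^+ m.+1| <= t ^+ m.
  move=> kv; rewrite normrX (@le_trans _ _ (t ^+ m.+1))//.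
    by rewrite lerXn2r ?nnegrE ?(ltW t0)// st.
  by rewrite exprS ler_piMl.
have kL k : (2 ^ v <= k)%N -> k%:R^-1 <= 2 / L.
  move=> kv; have k0 : 0 < k%:R :> R by rewrite ltr0n vk.
  have -> : 2 / L = (2 ^+ v)^-1 by rewrite /L exprS invfM mulrA divff ?mul1r.
  by rewrite lef_pV2 ?posrE ?exprn_gt0// -natrX ler_nat.
have low k : (k <= 2 ^ v)%N -> dyadic_part R u k = 0 by move=> ?; exact: dyadic_part_low.
have high k : (2 ^ u.+1 <= k)%N -> dyadic_part R u k = 0 by move=> ?; exact: dyadic_part_high.
split => k.
  have [kv|vk'] := leqP k (2 ^ v); first by rewrite low// mul0r normr0.
  have [ku|uk] := leqP (2 ^ u.+1) k; first by rewrite high// mul0r normr0.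
  rewrite /kernel_coef !normrM ger0_norm ?dyadic_part_ge0// (ger0_norm (powR_ge0 _ _)).
  rewrite -[leLHS]mul1r -[leRHS]mulrA ler_pM ?mulr_ge0 ?dyadic_part_ge0//.
  rewrite -[leRHS]mul1r ler_pM ?mulr_ge0 ?powR_ge0 ?dyadic_part_ge0 ?dyadic_part_le1//.
  by rewrite ler_pM ?powR_ge0 ?pk ?qk// ltnW.
have [kv|vk'] := ltnP k (2 ^ v).
  by rewrite !low ?(ltnW kv)// !mul0r subrr normr0 divr_ge0// ltW.
have [ku|uk] := leqP (2 ^ u.+1) k.
  by rewrite !high ?(leqW ku)// !mul0r subrr normr0 divr_ge0// ltW.
have k0 := vk _ vk'; have kR : 0 < k%:R :> R by rewrite ltr0n.
rewrite /kernel_coef.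
set e1 := dyadic_part R u k; set e2 := dyadic_part R u k.+1.
set p1 := k%:R `^ r; set p2 := k.+1%:R `^ r.
set q1 := sinc R (k%:R * _) ^+ _; set q2 := sinc R (k.+1%:R * _) ^+ _.
have -> : e1 * (p1 * q1) - e2 * (p2 * q2) =
   (e1 - e2) * (p1 * q1) - e2 * ((p2 - p1) * q1) - e2 * (p2 * (q2 - q1)) by ring.
have p10 : 0 <= p1 by exact: powR_ge0.
have p20 : 0 <= p2 by exact: powR_ge0.
have p1L : p1 <= (2 * L) `^ r by apply: pk; exact: ltnW.
have p2L : p2 <= (2 * L) `^ r by apply: pk.
have e20 : 0 <= e2 by exact: dyadic_part_ge0.
have e21 : e2 <= 1 by exact: dyadic_part_le1.
have q1t : `|q1| <= t ^+ m by exact: qk.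
have p12 : p1 <= p2 by rewrite ge0_ler_powR ?nnegrE ?ler_nat// ltW.
have T1 : `|(e1 - e2) * (p1 * q1)| <= (3 / L) * ((2 * L) `^ r * t ^+ m).
  rewrite !normrM (ger0_norm p10) ler_pM ?mulr_ge0//; first exact: dyadic_part_lipschitz.
  by rewrite ler_pM.
have rm' : r <= m%:R by have := rm; lra.
have T2 : `|e2 * ((p2 - p1) * q1)| <= (2 ^+ m * (2 / L)) * ((2 * L) `^ r * t ^+ m).
  rewrite !normrM (ger0_norm e20) -[leLHS]mul1r.
  rewrite mul1r (@le_trans _ _ (1 * (`|p2 - p1| * `|q1|)))//.
    by rewrite ler_wpM2r// mulr_ge0.
  rewrite mul1r [leRHS]mulrA ler_pM//; rewrite ger0_norm ?subr_ge0//.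
  apply: (le_trans (powR_succ_le R k m r k0 (ltW r0) rm')).
  have kk : 2 ^+ m / k%:R <= 2 ^+ m * (2 / L) by rewrite ler_wpM2l ?exprn_ge0// kL.
  rewrite [leRHS]mulrC; apply: ler_pM => //.
have T3 : `|e2 * (p2 * (q2 - q1))| <= (4 * m.+1%:R / L) * ((2 * L) `^ r * t ^+ m).
  have qd : `|q2 - q1| <= m.+1%:R * t ^+ m * (4 / L).
    apply: (le_trans (exprB_le R _ _ t m _ _)); [by apply: st; exact: leqW|by apply: st|].
    rewrite ler_wpM2l ?mulr_ge0//.
    apply: (le_trans (sinc_lipschitz R k _ k0 (bump_width_gt0 a))).
    have -> : 4 / L = 2 * (2 / L) by rewrite mulrA; congr (_ / _); rewrite -natrM.
    by rewrite ler_wpM2l// kL// leqW.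
  rewrite !normrM (ger0_norm e20) (ger0_norm p20).
  rewrite (@le_trans _ _ (1 * (p2 * `|q2 - q1|)))//.
    by rewrite ler_wpM2r// mulr_ge0.
  rewrite mul1r (@le_trans _ _ ((2 * L) `^ r * (m.+1%:R * t ^+ m * (4 / L))))//.
    by rewrite ler_pM.
  by rewrite le_eqVlt; apply/orP; left; apply/eqP; ring.
rewrite (le_trans (ler_normB _ _))//.
apply: (le_trans (lerD (le_trans (ler_normB _ _) (lerD T1 T2)) T3)).
rewrite le_eqVlt; apply/orP; left; apply/eqP.
by rewrite /block_cst1 exprS; field; rewrite gt_eqF.
Qed.

Lemma kernel_block_periodic u a (n : int) x :
  kernel_block u a (x + n%:~R * (2 * pi)) = kernel_block u a x.
Proof.
rewrite /kernel_block; congr (_ * (_ + 2 * _)); apply: eq_bigr => k _; congr (_ * _).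
rewrite -[RHS](cosD_int2pi _ (k.+1%:Z * n)); congr cos.
by rewrite intrM -pmulrn; ring.
Qed.

Lemma kernel_block_sum (u a : nat) (x : R) :
  \sum_(i < 2 ^ a.+1) `|kernel_block u a (x - 2 * pi * i%:R / (2 ^ a.+1)%:R)| <=
  block_cst * (2 `^ r) ^+ a * block_rate ^+ ((a - u) + (u - a)).
Proof.
have z0 := block_rate_gt0; have z1 := block_rate_lt1.
have C48 := block_cst_ge48; have s1 := pow2r_ge1.
have s0 : 0 < 2 `^ r by lra.
case: u => [|v].
  have b0 y : `|kernel_block 0 a y| <= 2 ^- a * 3.
    rewrite /kernel_block normrM ger0_norm ?invr_ge0 ?exprn_ge0//.
    rewrite ler_wpM2l ?invr_ge0 ?exprn_ge0//.
    rewrite (le_trans (ler_normD _ _))// eqxx normr1 (_ : 3 = 1 + 2) ?lerD2l; last by ring.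
    rewrite normrM normr_nat -[leRHS]mulr1 ler_wpM2l// big_ord1.
    have c1 (t : R) : `|cos t| <= 1 by rewrite ler_norml cos_geN1 cos_le1.
    rewrite /kernel_coef powR1 mul1r !normrM ger0_norm ?dyadic_part_ge0//.
    rewrite -[leRHS]mulr1 ler_pM ?mulr_ge0 ?dyadic_part_ge0//.
    rewrite -[leRHS]mulr1 ler_pM ?dyadic_part_ge0 ?dyadic_part_le1//.
    rewrite normrX exprn_ile1// sinc_le1// mul1r bump_width_gt0//.
  apply: (@le_trans _ _ (\sum_(i < 2 ^ a.+1) 2 ^- a * 3)); first by apply: ler_sum.
  rewrite sumr_const card_ord -[leLHS]mulr_natl natrX exprS.
  have -> : 2 * 2 ^+ a * (2 ^- a * 3) = 6 :> R by field; rewrite expf_neq0.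
  rewrite subn0 sub0n addn0 -mulrA -exprMn.
  have h : 1 <= (2 `^ r * block_rate) ^+ a by rewrite exprn_ege1// block_rate_pow2r.
  apply: (@le_trans _ _ (block_cst * 1)); first lra.
  by rewrite ler_wpM2l//; lra.
set u := v.+1; pose L := (2 ^ u)%N; have L0 : (0 < L)%N by rewrite expn_gt0.
(* With truncated subtraction Q = 8 * 2^max(a, u), the least refinement of this form that satisfies
   8 L <= Q. *)
pose q := (2 ^ (2 + (u - a)))%N; pose Q := (q * 2 ^ a.+1)%N.
have q0 : (0 < q)%N by rewrite expn_gt0.
have QE : Q = (2 ^ (a + (u - a)) * 8)%N.
  by rewrite /Q /q -[8%N]/(2 ^ 3)%N -!expnD; congr (2 ^ _)%N; lia.
have LQ : (8 * L <= Q)%N.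
  by rewrite QE mulnC leq_pmul2r// leq_exp2l//; lia.
have a0 : 0 < 2 ^+ a :> R by rewrite exprn_gt0.
(* From |sinc z| <= min(1, 1/z) at z = k h with k >= 2^(u-1), and pi >= 2. *)
pose t : R := Num.min 1 (m.+2%:R * 2 ^+ a.+1 / 2 ^+ u).
have t0 : 0 < t by rewrite lt_min ltr01 divr_gt0 ?mulr_gt0 ?exprn_gt0.
have t1 : t <= 1 by rewrite ge_min lexx.
have st k : (2 ^ v <= k)%N -> `|sinc R (k%:R * bump_width a)| <= t.
  move=> kv; have k0 : 0 < k%:R :> R by rewrite ltr0n (leq_trans _ kv)// expn_gt0.
  have kh : 0 < k%:R * bump_width a by rewrite mulr_gt0// bump_width_gt0.
  rewrite le_min sinc_le1//=; apply: (le_trans (sinc_le_inv _ _ kh)).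
  rewrite -[leRHS]invrK lef_pV2 ?posrE ?invr_gt0 ?divr_gt0 ?mulr_gt0 ?exprn_gt0 ?pi_gt0//.
  rewrite invf_div /bump_width mulrA ler_wpM2r ?invr_ge0 ?mulr_ge0 ?exprn_ge0//.
  rewrite /u exprS mulrC ler_pM ?exprn_ge0//; last exact: pi_ge2.
  by rewrite -natrX ler_nat.
have [dA ddA] := block_coef_bound v a t t0 t1 st; rewrite -/u in dA ddA.
set A := block_cst1 * _ * _ in dA ddA.
have A0 : 0 < A.
  by rewrite !mulr_gt0 ?exprn_gt0 ?powR_gt0 ?mulr_gt0 ?exprn_gt0// (lt_le_trans _ block_cst1_ge1).
have LE : L%:R = 2 ^+ u :> R by rewrite /L natrX.
have h8 : (0 < 2 ^ u.+1)%N by rewrite expn_gt0.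
apply: (@le_trans _ _ (2 ^- a * 2 * (3 * Q%:R * A))).
  apply: (le_trans (subgrid_sum_le R (2 ^ a.+1) q (fun y => `|kernel_block u a y|) x _ q0 _ _)).
  - by rewrite expn_gt0.
  - by move=> y; exact: normr_ge0.
  - by move=> n y; rewrite kernel_block_periodic.
  rewrite -/Q; set x' := x + _.
  rewrite [leLHS](_ : _ = 2 ^- a * 2 * \sum_(i < Q) `|\sum_(k < (2 ^ u.+1).-1)
     (dyadic_part R u k.+1 * kernel_coef a k.+1) * cos (k.+1%:R * grid R Q x' i + r * pi / 2)|); last first.
    rewrite mulr_sumr; apply: eq_bigr => i _.
    have h2a : 0 <= 2 ^- a * 2 :> R by rewrite mulr_ge0// invr_ge0 ltW.
    by rewrite /kernel_block add0r mulrA normrM (ger0_norm h2a).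
  rewrite ler_wpM2l ?mulr_ge0 ?invr_ge0 ?(ltW a0)//.
  apply: (grid_norm_le R Q (2 ^ u.+1).-1 L (fun k => dyadic_part R u k * kernel_coef a k) A) => //.
  - by rewrite /L -expnS prednK.
  - by rewrite dyadic_part_low ?mul0r.
  - by rewrite prednK// dyadic_part_high ?mul0r.
  - by rewrite LE.
have sA : (2 * 2 ^+ u) `^ r = (2 `^ r) ^+ u.+1.
  by rewrite -exprS -powR_mulrn ?powR_ge0// powRAC powR_mulrn.
have cc0 : 0 <= block_cst1 by have := block_cst1_ge1; lra.
pose s : R := 2 `^ r.
have -> : 2 ^- a * 2 * (3 * Q%:R * A) = 48 * block_cst1 * s * (s ^+ u * 2 ^+ (u - a) * t ^+ m).
  rewrite /A sA QE natrM natrX exprD exprS -/s.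
  by field; rewrite expf_neq0.
rewrite /block_cst -/s.
have mm : 1 <= (2 * m.+2%:R) ^+ m :> R by rewrite exprn_ege1// -natrM ler1n.
have key : s ^+ u * 2 ^+ (u - a) * t ^+ m <=
    (2 * m.+2%:R) ^+ m * (s ^+ a * block_rate ^+ ((a - u) + (u - a))); last first.
  rewrite -[leRHS]mulrA -[leRHS]mulrA ler_wpM2l//.
  by rewrite !mulr_ge0// ltW.
(* Below the scale only k^r matters: s^u = s^a s^-(a-u), and 1/s is at most [block_rate]. Above it,
   t^m supplies 2^(-m w), which must absorb s^w from k^r and 2^w from the refined grid; r + 2 <= m
   still leaves the rate 1/2. *)
have [ua|au] := leqP u a.
  have -> : (u - a = 0)%N by apply/eqP; rewrite subn_eq0.
  rewrite expr0 mulr1 addn0.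
  apply: (@le_trans _ _ (1 * (s ^+ a * block_rate ^+ (a - u)))); last first.
    by rewrite ler_wpM2r// mulr_ge0 ?exprn_ge0 ?ltW.
  rewrite mul1r (@le_trans _ _ (s ^+ u * 1))//.
    by rewrite ler_wpM2l ?exprn_ge0 ?(ltW s0)// exprn_ile1// ltW.
  have -> : s ^+ a = s ^+ u * s ^+ (a - u) by rewrite -exprD subnKC.
  rewrite -[leRHS]mulrA -exprMn ler_wpM2l ?exprn_ge0 ?(ltW s0)//.
  by rewrite exprn_ege1// block_rate_pow2r.
have [w uE] : exists w, u = (a + w)%N by exists (u - a)%N; rewrite subnKC// ltnW.
have -> : (u - a = w)%N by rewrite uE addKn.
have -> : (a - u = 0)%N by apply/eqP; rewrite subn_eq0 ltnW.
rewrite add0n.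
have tw : t <= 2 * m.+2%:R * 2 ^- w.
  rewrite ge_min; apply/orP; right; rewrite uE exprD exprS le_eqVlt; apply/orP; left; apply/eqP.
  by field; rewrite !expf_neq0.
have tmw : t ^+ m <= (2 * m.+2%:R) ^+ m * (2 ^- m) ^+ w.
  apply: (@le_trans _ _ ((2 * m.+2%:R * 2 ^- w) ^+ m)).
    by rewrite lerXn2r ?nnegrE ?(ltW t0)// !mulr_ge0// invr_ge0 exprn_ge0.
  by rewrite exprMn !exprVn -!exprM mulnC.
have s2 : s * 2 * 2 ^- m <= block_rate.
  apply: le_trans block_rate_half.
  rewrite ler_pdivrMr ?exprn_gt0//.
  have : 2 `^ (r + 2) <= 2 `^ m%:R :> R by rewrite ler_powR ?ler1n.
  rewrite powR_mulrn// powRD ?pnatr_eq0 ?implybT// (powR_mulrn 2) // -/s.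
  by rewrite (_ : 2 ^+ 2 = 4 :> R) -?natrX//; lra.
apply: (@le_trans _ _ (s ^+ u * 2 ^+ w * ((2 * m.+2%:R) ^+ m * (2 ^- m) ^+ w))).
  by rewrite ler_wpM2l// mulr_ge0 ?exprn_ge0// ltW.
have -> : s ^+ u * 2 ^+ w * ((2 * m.+2%:R) ^+ m * (2 ^- m) ^+ w) =
   (2 * m.+2%:R) ^+ m * (s ^+ a * (s * 2 * 2 ^- m) ^+ w).
  by rewrite uE exprD !exprMn; ring.
rewrite ler_wpM2l ?(le_trans ler01 mm)// ler_wpM2l ?exprn_ge0 ?(ltW s0)//.
rewrite lerXn2r ?nnegrE ?(ltW z0)//.
by rewrite divr_ge0 ?mulr_ge0 ?exprn_ge0// ltW.
Qed.

End blocks.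

(** * Bumps and their fractional derivatives *)

Section cosine_series.
Variable R : realType.
Local Notation U := (uprob R).

Definition cos_sum (c0 : R) (c : nat -> R) (al : R) (n : nat) (x : R) : R :=
  c0 + \sum_(k < n) c k * cos (k.+1%:R * x + al).

(** The coefficients will be O(k^-3), which makes the convergence uniform and the sum Lipschitz. *)
Definition cos_series c0 c al (x : R) : R := limn (fun n => cos_sum c0 c al n x).

Lemma cvg_norm_le (u : nat -> R) (l b : R) :
  u @ \oo --> l -> (forall n, `|u n| <= b) -> `|l| <= b.
Proof.
move=> ul ub; have h : `|u n| @[n --> \oo] --> `|l| by exact: cvg_norm.
rewrite -(cvg_lim _ h)//; apply: limr_le; first by apply/cvg_ex; eexists; exact: h.
exact: nearW.
Qed.

Lemma cos_norm_le1 (x : R) : `|cos x| <= 1.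
Proof. by rewrite ler_norml cos_geN1 cos_le1. Qed.

Lemma inv_sqr_tail (n m : nat) :
  \sum_(n <= k < m) (k.+1%:R ^+ 2)^-1 <= 2 / n.+1%:R :> R.
Proof.
have [mn|nm] := leqP m n; first by rewrite big_geq// divr_ge0.
pose t (k : nat) : R := - (2 / k.+1%:R).
apply: (@le_trans _ _ (\sum_(n <= k < m) (t k.+1 - t k))).
  apply: ler_sum => k _; rewrite /t.
  have k1 : 0 < k.+1%:R :> R by [].
  have e : k.+2%:R = k.+1%:R + 1 :> R by rewrite natr1.
  have aux (a : R) : 0 < a -> (a ^+ 2)^-1 <= - (2 / (a + 1)) - - (2 / a) \/ a < 1.
    move=> a0; have [a1|] := leP 1 a; last by right.
    left; have -> : - (2 / (a + 1)) - - (2 / a) = 2 / (a * (a + 1)).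
      by field; rewrite !gt_eqF// addr_gt0.
    rewrite -[leLHS]mul1r ler_pdivrMr ?exprn_gt0// mulrAC ler_pdivlMr ?mulr_gt0 ?addr_gt0//.
    by rewrite mul1r expr2 mulrCA mulrDr mulr1; nra.
  rewrite e; have [//|h] := aux _ k1.
  by have : 1 <= k.+1%:R :> R by [rewrite ler1n]; rewrite leNgt h.
rewrite telescope_sumr ?(ltnW nm)// /t opprK addrC gerDl oppr_le0 divr_ge0//.
Qed.

Variables (c0 : R) (c : nat -> R) (al B : R).
Hypothesis B0 : 0 <= B.
Hypothesis cB : forall k, `|c k| <= B / k.+1%:R ^+ 3.

Lemma cos_coef_le k : `|c k| <= B / k.+1%:R ^+ 2.
Proof.
apply: (le_trans (cB k)); rewrite ler_wpM2l// lef_pV2 ?posrE ?exprn_gt0//.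
by rewrite ler_weXn2l// ler1n.
Qed.

Lemma cos_coef_tail n m : \sum_(n <= k < m) `|c k| <= 2 * B / n.+1%:R.
Proof.
apply: (@le_trans _ _ (\sum_(n <= k < m) B * (k.+1%:R ^+ 2)^-1)).
  by apply: ler_sum => k _; exact: cos_coef_le.
rewrite -mulr_sumr (le_trans (ler_wpM2l B0 (inv_sqr_tail n m)))//.
by rewrite mulrA (mulrC B).
Qed.

Lemma cos_coef_sum n : \sum_(k < n) `|c k| <= 2 * B.
Proof. by rewrite -(big_mkord xpredT (fun k => `|c k|)) (le_trans (cos_coef_tail 0 n))// divr1. Qed.

Lemma inv_nat_cvg0 (a : R) : (fun n : nat => a / n.+1%:R) @ \oo --> 0.
Proof.
rewrite -[X in _ --> X](mulr0 a); apply: cvgMr.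
exact: cvg_harmonic.
Qed.

Lemma cos_series_tail (x : R) :
  (fun n => cos_sum c0 c al n x) @ \oo --> cos_series c0 c al x /\
  forall n, `|cos_series c0 c al x - cos_sum c0 c al n x| <= 2 * B / n.+1%:R.
Proof.
apply: cauchy_tail; last exact: inv_nat_cvg0.
move=> n m nm; rewrite /cos_sum opprD addrACA subrr add0r.
rewrite -!(big_mkord xpredT (fun k => c k * cos (k.+1%:R * x + al))).
rewrite (big_cat_nat (leq0n n) nm)/= addrAC subrr add0r.
rewrite (le_trans (ler_norm_sum _ _ _))// (le_trans _ (cos_coef_tail n m))//.
by apply: ler_sum => k _; rewrite normrM ler_piMr// cos_norm_le1.
Qed.

Lemma cos_series_cvg (x : R) :
  (fun n => cos_sum c0 c al n x) @ \oo --> cos_series c0 c al x.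
Proof. exact: (cos_series_tail x).1. Qed.

Lemma cos_sum_le n (x : R) : `|cos_sum c0 c al n x| <= `|c0| + 2 * B.
Proof.
rewrite (le_trans (ler_normD _ _))// lerD2l (le_trans (ler_norm_sum _ _ _))//.
apply: le_trans (cos_coef_sum n); apply: ler_sum => k _.
by rewrite normrM ler_piMr// cos_norm_le1.
Qed.

Lemma cos_series_le (x : R) : `|cos_series c0 c al x| <= `|c0| + 2 * B.
Proof. by apply: cvg_norm_le (cos_series_cvg x) _ => n; exact: cos_sum_le. Qed.

Lemma cos_series_lipschitz (x y : R) :
  `|cos_series c0 c al x - cos_series c0 c al y| <= 2 * B * `|x - y|.
Proof.
apply: cvg_norm_le (cvgB (cos_series_cvg x) (cos_series_cvg y)) _ => n.
rewrite !fctE /cos_sum opprD addrACA subrr add0r -sumrB.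
rewrite (le_trans (ler_norm_sum _ _ _))//.
apply: (@le_trans _ _ (\sum_(k < n) (B * (k.+1%:R ^+ 2)^-1) * `|x - y|)); last first.
  rewrite -mulr_suml ler_wpM2r// -mulr_sumr -(big_mkord xpredT (fun k => (k.+1%:R ^+ 2)^-1)).
  by rewrite (le_trans (ler_wpM2l B0 (inv_sqr_tail 0 n)))// divr1 mulrC.
apply: ler_sum => k _; rewrite -mulrBr normrM.
have k0 : 0 < k.+1%:R :> R by [].
have cl (s t : R) : `|cos s - cos t| <= `|s - t|.
  have e (u : R) : cos u = sin (pi / 2 - u).
    by rewrite sinB sin_pihalf cos_pihalf mul1r mul0r subr0.
  rewrite !e; have [st|ts] := leP s t.
    have := sin_lipschitz R (pi / 2 - t) (pi / 2 - s).
    rewrite lerD2l lerN2 => /(_ st) /le_trans; apply.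
    by rewrite distrC (le_trans _ (ler_norm _))//; lra.
  have := sin_lipschitz R (pi / 2 - s) (pi / 2 - t).
  rewrite lerD2l lerN2 => /(_ (ltW ts)); rewrite distrC => /le_trans; apply.
  by rewrite (le_trans _ (ler_norm _))//; lra.
apply: (@le_trans _ _ ((B / k.+1%:R ^+ 3) * (k.+1%:R * `|x - y|))).
  apply: ler_pM => //; apply: (le_trans (cl _ _)).
  by rewrite opprD addrACA subrr addr0 -mulrBr normrM normr_nat.
by rewrite le_eqVlt; apply/orP; left; apply/eqP; field; rewrite gt_eqF.
Qed.

Lemma cos_series_continuous : continuous (cos_series c0 c al).
Proof.
move=> x; apply/cvgrPdist_le => e e0; near=> y.
apply: (le_trans (cos_series_lipschitz x y)).
have h : `|x - y| <= e / (2 * B + 1).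
  near: y; apply: cvgr_dist_le; first exact: cvg_id.
  by rewrite divr_gt0// ltr_wpDl// mulr_ge0.
have B1 : 0 < 2 * B + 1 by rewrite ltr_wpDl// mulr_ge0.
apply: (le_trans (ler_wpM2l _ h)); first by rewrite mulr_ge0.
by rewrite mulrA ler_pdivrMr// mulrDr mulr1 mulrC lerDl ltW.
Unshelve. all: by end_near. Qed.

Lemma cos_series_bmf : bounded_mfun _ (measurableTypeR R) R (cos_series c0 c al).
Proof.
split; first by apply: continuous_measurable_fun; exact: cos_series_continuous.
by exists (`|c0| + 2 * B); exact: cos_series_le.
Qed.

Lemma cos_series_periodic (n : int) (x : R) :
  cos_series c0 c al (x + n%:~R * (2 * pi)) = cos_series c0 c al x.
Proof.
rewrite /cos_series.
suff -> : (fun m => cos_sum c0 c al m (x + n%:~R * (2 * pi))) = (fun m => cos_sum c0 c al m x) by [].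
apply/funext => m; congr (_ + _); apply: eq_bigr => k _; congr (_ * _).
rewrite -[RHS](cosD_int2pi _ (k.+1%:Z * n)); congr cos.
by rewrite intrM -pmulrn; ring.
Qed.

(** The cutoff is 1 up to 2^n > n, so the smoothed and the plain partial sum differ by damped terms
    beyond n only. *)
Lemma cos_series_cutoff (n : nat) (x : R) :
  `|c0 + \sum_(k < (2 ^ n.+1).-1) cutoff R n k.+1 * c k * cos (k.+1%:R * x + al)
    - cos_series c0 c al x| <= 4 * B / n.+1%:R.
Proof.
set N := (2 ^ n.+1).-1; have nN : (n <= N)%N.
  by rewrite /N -ltnS prednK ?expn_gt0// ltnW// ltn_expl.
have n2 : (n < 2 ^ n)%N by exact: ltn_expl.
have [_ /(_ n) tl] := cos_series_tail x.
set T := c0 + _; have h : `|T - cos_sum c0 c al n x| <= 2 * B / n.+1%:R.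
  have -> : T - cos_sum c0 c al n x = \sum_(n <= k < N) cutoff R n k.+1 * c k * cos (k.+1%:R * x + al).
    rewrite /T /cos_sum opprD addrACA subrr add0r.
    rewrite -(big_mkord xpredT (fun k => c k * cos (k.+1%:R * x + al))).
    rewrite -(big_mkord xpredT (fun k => cutoff R n k.+1 * c k * cos (k.+1%:R * x + al))).
    rewrite (big_cat_nat (leq0n n) nN)/= [X in X + _ - _](_ : _ = \sum_(0 <= k < n) c k * cos (k.+1%:R * x + al)).
      by rewrite addrAC subrr add0r.
    apply: eq_big_nat => k /andP[_ kn].
    by rewrite cutoff1 ?mul1r// (leq_trans kn)// ltnW.
  rewrite (le_trans (ler_norm_sum _ _ _))// (le_trans _ (cos_coef_tail n N))//.
  apply: ler_sum => k _; rewrite normrM (le_trans (ler_piMr _ (cos_norm_le1 _)))//.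
  rewrite normrM ger0_norm ?cutoff_ge0// ler_piMl// cutoff_le1//.
rewrite (_ : T - _ = (T - cos_sum c0 c al n x) - (cos_series c0 c al x - cos_sum c0 c al n x)); last by ring.
rewrite (le_trans (ler_normB _ _))// (le_trans (lerD h tl))//.
by rewrite -mulrDl le_eqVlt; apply/orP; left; apply/eqP; congr (_ / _); ring.
Qed.

Lemma cos_series_mean (t : R) : \int[U]_x cos_series c0 c al (x - t) = c0.
Proof.
have e1 n x : cos_sum c0 c al n (x - t) =
    c0 + \sum_(k < n) c k * cos (k.+1%:Z%:~R * x + (al - k.+1%:R * t)).
  congr (_ + _); apply: eq_bigr => k _; congr (_ * cos _).
  by rewrite -pmulrn; ring.
have bc k : bounded_mfun _ (measurableTypeR R) R
    (fun x => c k * cos (k.+1%:Z%:~R * x + (al - k.+1%:R * t))).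
  by apply: bmfZ; exact: bmf_cos.
have e n : \int[U]_x cos_sum c0 c al n (x - t) = c0.
  under eq_Rintegral do rewrite e1.
  rewrite bmf_RintegralD; [|exact: bmf_cst|by apply: bmf_sum].
  rewrite bmf_Rintegral_cst bmf_Rintegral_sum// big1 ?addr0// => k _.
  by rewrite bmf_RintegralZ ?cos_mean0 ?mulr0//; exact: bmf_cos.
have [] := Rintegral_dominated _ _ _ U (fun n x => cos_sum c0 c al n (x - t))
    (fun x => cos_series c0 c al (x - t)) (fun=> `|c0| + 2 * B).
- move=> n; under eq_fun do rewrite e1.
  have [] // : bounded_mfun _ (measurableTypeR R) R (fun x =>
      c0 + \sum_(k < n) c k * cos (k.+1%:Z%:~R * x + (al - k.+1%:R * t))).
  by apply: bmfD; [exact: bmf_cst|exact: bmf_sum].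
- by have [] := bmf_shift _ _ t cos_series_bmf.
- by apply: aeW => x; exact: cos_series_cvg.
- by apply: bmf_integrable; exact: bmf_cst.
- by apply: aeW => x n; exact: cos_sum_le.
move=> _; under eq_fun do rewrite e.
by move=> /cvg_lim <- //; rewrite lim_cst.
Qed.

End cosine_series.

(** * The bump, its derivative of order r, and their relation by convolution *)

Section bump_kernel.
Variables (R : realType) (r : R) (m : nat).
Hypotheses (r0 : 0 < r) (rm : r + 2 <= m%:R).
Local Notation U := (uprob R).
Local Notation h := (bump_width R m).

Definition bump_coef (a k : nat) : R := 2 ^- a * 2 * sinc R (k.+1%:R * h a) ^+ m.+1.
Definition bump_kernel_coef (a k : nat) : R := 2 ^- a * 2 * kernel_coef R r m a k.+1.

(* [bump a] is supported (modulo 2 pi) in |x| <= pi / 2^(a+1); [bump_kernel a]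
   is its derivative of order [r], so that convolution with [F1 r] maps it back
   to [bump a]. *)
Definition bump (a : nat) : R -> R := cos_series R (2 ^- a) (bump_coef a) 0.
Definition bump_kernel (a : nat) : R -> R :=
  cos_series R (2 ^- a) (bump_kernel_coef a) (r * pi / 2).

Definition bump_cst (a : nat) : R := 2 ^- a * 2 * h a ^- m.+1.

Lemma bump_cst_ge0 a : 0 <= bump_cst a.
Proof.
rewrite /bump_cst !mulr_ge0 ?invr_ge0 ?exprn_ge0//.
by rewrite ltW// bump_width_gt0.
Qed.

(** From |sinc z| <= 1/z the coefficient is at most h^-(m+1) k^(r - m - 1); the condition r + 2 <= m
    is what turns this into k^-3. *)
Lemma kernel_coef_le a k : `|kernel_coef R r m a k.+1| <= h a ^- m.+1 / k.+1%:R ^+ 3.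
Proof.
have h0 := bump_width_gt0 R m a; have k0 : 0 < k.+1%:R :> R by [].
rewrite /kernel_coef normrM (ger0_norm (powR_ge0 _ _)) normrX.
have s1 : `|sinc R (k.+1%:R * h a)| ^+ m.+1 <= (k.+1%:R * h a)^-1 ^+ m.+1.
  have kh : 0 < k.+1%:R * h a by rewrite mulr_gt0.
  by apply: lerXn2r; rewrite ?nnegrE ?sinc_le_inv// invr_ge0 ltW.
apply: (le_trans (ler_wpM2l (powR_ge0 _ _) s1)).
rewrite exprVn exprMn invfM mulrA mulrC ler_wpM2l ?invr_ge0 ?exprn_ge0 ?(ltW h0)//.
rewrite ler_pdivrMr ?exprn_gt0// mulrC ler_pdivlMr ?exprn_gt0//.
have : k.+1%:R `^ (r + 2) <= k.+1%:R `^ m%:R :> R by rewrite ler_powR// ler1n.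
rewrite powR_mulrn// powRD ?pnatr_eq0 ?implybT// (powR_mulrn 2)// => hk.
by rewrite !exprS mulrCA ler_wpM2l// expr0 mulr1 -expr2.
Qed.

Lemma bump_kernel_coef_le a k : `|bump_kernel_coef a k| <= bump_cst a / k.+1%:R ^+ 3.
Proof.
rewrite /bump_kernel_coef /bump_cst normrM ger0_norm ?mulr_ge0 ?invr_ge0 ?exprn_ge0//.
by rewrite -[leRHS]mulrA ler_wpM2l ?mulr_ge0 ?invr_ge0 ?exprn_ge0// kernel_coef_le.
Qed.

Lemma bump_coef_le a k : `|bump_coef a k| <= bump_cst a / k.+1%:R ^+ 3.
Proof.
apply: le_trans (bump_kernel_coef_le a k).
rewrite /bump_coef /bump_kernel_coef !(normrM (2 ^- a * 2)) ler_wpM2l//.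
rewrite /kernel_coef normrM ler_peMl//.
rewrite (ger0_norm (powR_ge0 _ _)) -[leLHS](powRr0 k.+1%:R).
by rewrite ler_powR ?ler1n// ltW.
Qed.

Lemma bump_kernel_bmf a : bounded_mfun _ (measurableTypeR R) R (bump_kernel a).
Proof. exact: cos_series_bmf _ _ _ _ _ (bump_cst_ge0 a) (bump_kernel_coef_le a). Qed.

Lemma bump_bmf a : bounded_mfun _ (measurableTypeR R) R (bump a).
Proof. exact: cos_series_bmf _ _ _ _ _ (bump_cst_ge0 a) (bump_coef_le a). Qed.

Lemma bump_conv a (t x : R) :
  \int[U]_y (bump_kernel a (y - t) * F1 r (x - y)) = bump a (x - t).
Proof.
have B0 := bump_cst_ge0 a; have kB := bump_kernel_coef_le a; have bB := bump_coef_le a.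
(* The convolution formula was proved for x in one period; both sides are periodic. *)
have [n hn] := modulo_2pi _ x; set x0 := x - _ in hn.
have xE : x = x0 + n%:~R * (2 * pi) by rewrite /x0 subrK.
have e1 y : F1 r (x - y) = F1 r (x0 - y) by rewrite xE addrAC F1_periodic.
under eq_Rintegral do rewrite e1.
have -> : bump a (x - t) = bump a (x0 - t).
  by rewrite xE addrAC /bump (cos_series_periodic R _ _ _ n).
have bK := bmf_shift _ _ t (bump_kernel_bmf a).
have := series_conv_F1 R r r0 (2 ^- a) (bump_kernel_coef a)
  (fun k => r * pi / 2 - k.+1%:R * t) (2 * bump_cst a) x0 (fun y => bump_kernel a (y - t)) hn bK
  (cos_coef_sum R _ _ B0 kB).
move=> H; apply: (cvg_unique _ (H _) _) => //.
  move=> y; have := cos_series_cvg R (2 ^- a) (bump_kernel_coef a) (r * pi / 2) _ B0 kB (y - t).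
  rewrite (eq_cvg _ _ (g := fun n => 2 ^- a + \sum_(k < n) bump_kernel_coef a k *
      cos (k.+1%:R * y + (r * pi / 2 - k.+1%:R * t)))) => // N.
  congr (_ + _); apply: eq_bigr => k _; by congr (_ * cos _); ring.
have := cos_series_cvg R (2 ^- a) (bump_coef a) 0 _ B0 bB (x0 - t).
rewrite (eq_cvg _ _ (g := fun n => 2 ^- a + \sum_(k < n) bump_kernel_coef a k *
    k.+1%:R `^ (- r) * cos (k.+1%:R * x0 + (r * pi / 2 - k.+1%:R * t) - r * pi / 2))) => // N.
congr (_ + _); apply: eq_bigr => k _.
rewrite /bump_coef /bump_kernel_coef /kernel_coef powRN.
have kr : k.+1%:R `^ r != 0 by rewrite gt_eqF// powR_gt0.
have -> : k.+1%:R * x0 + (r * pi / 2 - k.+1%:R * t) - r * pi / 2 = k.+1%:R * (x0 - t) + 0 by ring.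
have aux (A p s c : R) : p != 0 -> A * s * c = A * (p * s) * p^-1 * c by move=> pn; field.
exact: aux.
Qed.

Lemma bump_even a x : bump a (- x) = bump a x.
Proof.
rewrite /bump /cos_series.
suff -> : (fun n => cos_sum R (2 ^- a) (bump_coef a) 0 n (- x)) =
    (fun n => cos_sum R (2 ^- a) (bump_coef a) 0 n x) by [].
apply/funext => n; congr (_ + _); apply: eq_bigr => k _.
by rewrite !addr0 mulrN cosN.
Qed.

Lemma bump_eq0 a x : pi / 2 ^+ a.+1 <= `|x| <= 2 * pi - pi / 2 ^+ a.+1 -> bump a x = 0.
Proof.
move=> hx; have B0 := bump_cst_ge0 a; have bB := bump_coef_le a.
have -> : bump a x = bump a `|x|.
  by case: (ger0P x) => _ //; rewrite bump_even.
have h0 := bump_width_gt0 R m a.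
have hE : m.+1%:R * h a + h a = pi / 2 ^+ a.+1.
  have -> : m.+1%:R * h a + h a = m.+2%:R * h a by rewrite -(natr1 m.+1) mulrDl mul1r.
  have aux (A p : R) : A != 0 -> A * (pi / (A * p)) = pi / p.
    by move=> An; rewrite invfM mulrCA (mulrA A) divff// mul1r.
  exact: aux.
(* The margin is taken equal to the width itself, so the excluded neighbourhood has radius (m+2)
   h. *)
have [C [C0 hC]] := bump_sum_cvg0 R (h a) h0 m (h a) h0.
have xb N : `|bump_sum R (h a) m.+1 N `|x| | <= C / N.+1%:R by apply: hC; rewrite hE.
have cv := cos_series_cvg R (2 ^- a) (bump_coef a) 0 _ B0 bB `|x|.
have e N : cos_sum R (2 ^- a) (bump_coef a) 0 N `|x| = 2 ^- a * 2 * bump_sum R (h a) m.+1 N `|x|.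
  rewrite /cos_sum /bump_sum mulrDr mulr_sumr; congr (_ + _); first by field; rewrite expf_neq0.
  by apply: eq_bigr => k _; rewrite /bump_coef addr0; ring.
rewrite /bump; apply/eqP; rewrite -normr_le0; apply/ler_addgt0Pr => e' e'0; rewrite add0r.
have lim0 := inv_nat_cvg0 R (2 ^- a * 2 * C).
have [N0 _ hN0] : \forall n \near \oo, 2 ^- a * 2 * C / n.+1%:R < e'.
  by apply: (cvgr_lt 0 lim0).
have cvs : (fun n => cos_sum R (2 ^- a) (bump_coef a) 0 (n + N0)%N `|x|) @ \oo -->
    cos_series R (2 ^- a) (bump_coef a) 0 `|x|.
  by rewrite (@cvg_shiftn N0 R (fun n => cos_sum R (2 ^- a) (bump_coef a) 0 n `|x|)).
apply: (cvg_norm_le _ _ _ _ cvs) => n; rewrite e normrM.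
rewrite ger0_norm ?mulr_ge0 ?invr_ge0 ?exprn_ge0//.
apply: (le_trans _ (ltW (hN0 (n + N0)%N (leq_addl _ _)))).
have A0 : 0 <= 2 ^- a * 2 :> R by rewrite mulr_ge0// invr_ge0 exprn_ge0.
by rewrite -(mulrA (2 ^- a * 2) C); exact: ler_wpM2l.
Qed.

Lemma bump_mean a (t : R) : \int[U]_x bump a (x - t) = 2 ^- a.
Proof. exact: cos_series_mean (bump_cst_ge0 a) (bump_coef_le a) t. Qed.

Lemma bump_kernel_blocks a n x :
  `|\sum_(u < n.+1) kernel_block R r m u a x - bump_kernel a x| <= 4 * bump_cst a / n.+1%:R.
Proof.
have := cos_series_cutoff R (2 ^- a) (bump_kernel_coef a) (r * pi / 2) _
  (bump_cst_ge0 a) (bump_kernel_coef_le a) n x.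
rewrite -/(bump_kernel a); set T := _ + \sum_(k < _) _.
suff -> : \sum_(u < n.+1) kernel_block R r m u a x = T by [].
set N := (2 ^ n.+1).-1.
have e (u : 'I_n.+1) : kernel_block R r m u a x = 2 ^- a * ((u == 0%N :> nat)%:R +
    2 * \sum_(k < N) dyadic_part R u k.+1 * kernel_coef R r m a k.+1 *
      cos (k.+1%:R * x + r * pi / 2)).
  rewrite /kernel_block; congr (_ * (_ + 2 * _)).
  have uN : ((2 ^ u.+1).-1 <= N)%N.
    by rewrite /N -!subn1 leq_sub2r// leq_exp2l//; exact: ltn_ord.
  rewrite -(big_mkord xpredT (fun k => dyadic_part R u k.+1 * kernel_coef R r m a k.+1 * cos (k.+1%:R * x + r * pi / 2))).
  rewrite -[RHS](big_mkord xpredT (fun k => dyadic_part R u k.+1 * kernel_coef R r m a k.+1 * cos (k.+1%:R * x + r * pi / 2))).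
  rewrite [RHS](big_cat_nat (leq0n _) uN)/= [X in _ + X]big_nat [X in _ + X]big1 ?addr0// => k /andP[uk _].
  rewrite dyadic_part_high ?mul0r//.
  by rewrite -(@prednK (2 ^ u.+1)) ?expn_gt0// ltnS.
under eq_bigr do rewrite e.
rewrite -mulr_sumr big_split /= -mulr_sumr exchange_big /=.
have -> : \sum_(u < n.+1) (u == 0%N :> nat)%:R = 1 :> R.
  by rewrite big_ord_recl /= big1 ?addr0// => u _.
rewrite mulrDr mulr1 /T mulrA mulr_sumr; congr (_ + _); apply: eq_bigr => k _.
by rewrite -!mulr_suml sum_dyadic_part /bump_kernel_coef; ring.
Qed.

Lemma bump_kernel_blocks_cvg a x :
  (fun n => \sum_(u < n.+1) kernel_block R r m u a x) @ \oo --> bump_kernel a x.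
Proof.
apply/cvgrPdist_le => e e0; near=> n.
rewrite distrC (le_trans (bump_kernel_blocks a n x))// ltW//.
near: n; exact: (cvgr_lt 0 (inv_nat_cvg0 R (4 * bump_cst a))).
Unshelve. all: by end_near. Qed.

End bump_kernel.

(** * Boxes and nets *)

Section boxes.
Variables (R : realType) (r : R) (m d n : nat).
Hypotheses (r0 : 0 < r) (rm : r + 2 <= m%:R) (d0 : (0 < d)%N).
Local Notation E := (euclidean R d).

(** Midpoint of the k-th interval between consecutive zeros k pi / 2^a of sin(2^a x). *)
Definition center (a k : nat) : R := (2 * k%:R + 1) * (pi / 2 ^+ a.+1).

Lemma half_side_gt0 a : 0 < pi / 2 ^+ a.+1 :> R.
Proof. by rewrite divr_gt0 ?pi_gt0 ?exprn_gt0. Qed.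

Lemma centerE a k : center a k = pi / 2 ^+ a.+1 + 2 * pi * k%:R / (2 ^ a.+1)%:R.
Proof. by rewrite /center natrX; ring. Qed.

Lemma center_bounds a k : (k < 2 ^ a.+1)%N ->
  pi / 2 ^+ a.+1 <= center a k <= 2 * pi - pi / 2 ^+ a.+1.
Proof.
move=> ka; have h := half_side_gt0 a; rewrite /center.
have -> : 2 * pi - pi / 2 ^+ a.+1 = (2 * (2 ^ a.+1)%:R - 1) * (pi / 2 ^+ a.+1) :> R.
  by rewrite natrX; field; rewrite expf_neq0.
rewrite -{1}[pi / _]mul1r !ler_pM2r//.
have k0 : 0 <= k%:R :> R by [].
have : k.+1%:R <= (2 ^ a.+1)%:R :> R by rewrite ler_nat.
by rewrite -(natr1 k) => h2; apply/andP; split; lra.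
Qed.

Lemma bump_neq0_near a k (y : R) : 0 <= y < 2 * pi -> (k < 2 ^ a.+1)%N ->
  bump R m a (y - center a k) != 0 -> `|y - center a k| < pi / 2 ^+ a.+1.
Proof.
move=> /andP[y0 y2] /center_bounds/andP[c1 c2]; apply: contraNlt => h.
apply/eqP; apply: (bump_eq0 R r m r0 rm a); rewrite h /=.
by rewrite ler_norml; apply/andP; split; lra.
Qed.

Lemma center_inj a k k' (y : R) : `|y - center a k| < pi / 2 ^+ a.+1 ->
  `|y - center a k'| < pi / 2 ^+ a.+1 -> k = k'.
Proof.
have h := half_side_gt0 a => h1 h2.
have : `|center a k - center a k'| < 2 * (pi / 2 ^+ a.+1).
  rewrite (_ : center a k - center a k' = (y - center a k') - (y - center a k)); last by ring.
  by rewrite (le_lt_trans (ler_normB _ _))//; lra.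
have -> : center a k - center a k' = 2 * (k%:R - k'%:R) * (pi / 2 ^+ a.+1).
  by rewrite /center; ring.
rewrite normrM (gtr0_norm h) ltr_pM2r// normrM normr_nat -[ltRHS]mulr1 ltr_pM2l//.
have -> : k%:R - k'%:R = (k%:Z - k'%:Z)%:~R :> R by rewrite rmorphB/= -!pmulrn.
rewrite -intr_norm (_ : 1 = 1%:~R)// ltr_int; lia.
Qed.

Lemma sin_natpi (k : nat) : sin (k%:R * pi) = 0 :> R.
Proof.
elim: k => [|k IHk]; first by rewrite mul0r sin0.
by rewrite -(natr1 k) mulrDl mul1r sinD sinpi IHk mul0r mulr0 addr0.
Qed.

Lemma sin_near_center_neq0 a k (y : R) : `|y - center a k| < pi / 2 ^+ a.+1 ->
  sin (2 ^+ a * y) != 0.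
Proof.
have p0 : 0 < 2 ^+ a :> R by rewrite exprn_gt0.
have c : 2 ^+ a * center a k = k%:R * pi + pi / 2.
  by rewrite /center exprS; field; rewrite expf_neq0.
have w : 2 ^+ a * (pi / 2 ^+ a.+1) = pi / 2 :> R.
  by rewrite exprS; field; rewrite expf_neq0.
move=> h; have : `|2 ^+ a * y - (k%:R * pi + pi / 2)| < pi / 2.
  by rewrite -c -mulrBr normrM (gtr0_norm p0) -w ltr_pM2l.
set z := 2 ^+ a * y; rewrite ltr_norml => /andP[h1 h2].
apply/eqP => s0; have : 0 < sin (z - k%:R * pi) by apply: sin_gt0_pi; apply/andP; split; lra.
by rewrite sinB s0 sin_natpi mul0r mulr0 subrr ltxx.
Qed.

(** Every s_j is at most n, so one index type serves all scales and the scale only restricts the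
    range of each coordinate. *)
Definition box (s : 'I_d -> nat) : {set {ffun 'I_d -> 'I_(2 ^ n.+1)}} :=
  [set f : {ffun 'I_d -> 'I_(2 ^ n.+1)} | [forall j, (f j < 2 ^ (s j).+1)%N]].

Lemma in_box s (f : {ffun 'I_d -> 'I_(2 ^ n.+1)}) :
  (f \in box s) = [forall j, (f j < 2 ^ (s j).+1)%N].
Proof. by rewrite /box inE. Qed.

Lemma sum_box_prod (s : 'I_d -> nat) (F : 'I_d -> nat -> R) :
  (forall j, (s j <= n)%N) ->
  \sum_(f in box s) \prod_j F j (f j) = \prod_j \sum_(k < 2 ^ (s j).+1) F j k.
Proof.
move=> sn; transitivity (\prod_j \sum_(k < 2 ^ n.+1 | (k < 2 ^ (s j).+1)%N) F j k); last first.
  apply: eq_bigr => j _; have le : (2 ^ (s j).+1 <= 2 ^ n.+1)%N by rewrite leq_exp2l// ltnS.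
  by rewrite (big_ord_widen _ (F j) le).
rewrite bigA_distr_big_dep; apply: eq_bigl => f; rewrite in_box.
by apply/forallP/familyP => h j; exact: h j.
Qed.

Lemma card_box (s : 'I_d -> nat) : (\sum_j s j = n)%N -> #|box s| = (2 ^ (n + d))%N.
Proof.
move=> sn; have sj j : (s j <= n)%N by rewrite -sn (bigD1 j)//= leq_addr.
apply/eqP; rewrite -(eqr_nat R) -sum1_card natr_sum.
rewrite (eq_bigr (fun f : {ffun 'I_d -> 'I_(2 ^ n.+1)} => \prod_(j < d) (fun _ _ => 1) j (nat_of_ord (f j)))); last first.
  by move=> f _; rewrite big1.
rewrite (sum_box_prod s (fun _ _ => 1)) //.
rewrite (eq_bigr (fun j => 2 ^+ (s j).+1)); last first.
  by move=> j _; rewrite sumr_const card_ord natrX.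
have -> : \prod_(j < d) 2 ^+ (s j).+1 = 2 ^+ (\sum_(j < d) (s j).+1) :> R.
  by rewrite expr_sum.
rewrite (eq_bigr (fun j => s j + 1)%N); last by move=> j _; rewrite addn1.
by rewrite big_split /= sn sum1_card card_ord natrX.
Qed.

Definition tensor (H : nat -> R -> R) (s : 'I_d -> nat) (f : {ffun 'I_d -> 'I_(2 ^ n.+1)}) (x : E) : R :=
  \prod_(j < d) H (s j) (tnth x j - center (s j) (f j)).

Variables (M : nat) (xi : 'I_M -> E).

(** Defined by vanishing of the bump rather than by position of the knots: f then vanishes at the
    knots by construction, and the geometry of the boxes enters only in counting. *)
Definition free (s : 'I_d -> nat) : {set {ffun 'I_d -> 'I_(2 ^ n.+1)}} :=
  [set f in box s | [forall i, tensor (bump R m) s f (xi i) == 0]].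

Lemma in_free s (f : {ffun 'I_d -> 'I_(2 ^ n.+1)}) :
  (f \in free s) = (f \in box s) && [forall i, tensor (bump R m) s f (xi i) == 0].
Proof. by rewrite /free inE. Qed.

Lemma card_free (s : 'I_d -> nat) : (0 < n)%N -> (\sum_j s j = n)%N ->
  is_net n n.-1 (range xi) -> (2 ^ n <= #|free s|)%N.
Proof.
move=> n0 sn [Xt net].
pose NF := [set f in box s | [exists i, tensor (bump R m) s f (xi i) != 0]].
have inNF f : (f \in NF) = (f \in box s) && [exists i, tensor (bump R m) s f (xi i) != 0].
  by rewrite inE.
have split_box : #|box s| = (#|free s| + #|NF|)%N.
  rewrite -(cardsID NF (box s)) addnC; congr (_ + _)%N; apply: eq_card => f.
    rewrite finset.in_setD in_free inNF; case: (f \in box s) => //=.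
    by rewrite andbT negb_exists; apply: eq_forallb => i; rewrite negbK.
  by rewrite finset.in_setI inNF; case: (f \in box s).
have near f i : f \in box s -> tensor (bump R m) s f (xi i) != 0 ->
    forall j, `|tnth (xi i) j - center (s j) (f j)| < pi / 2 ^+ (s j).+1.
  move=> fb t0 j; apply: bump_neq0_near; first exact: (Xt (xi i) (imageT xi i) j).
    by move: fb; rewrite in_box => /forallP.
  by move: t0; rewrite /tensor => /prodf_neq0 /(_ j erefl).
(* As d >= 1, at least 2^(n+1) - 2^(n-1) boxes remain, and 2^(n-1) <= 2^n. *)
suff : (#|NF| <= 2 ^ n.-1)%N.
  have := card_box s sn; rewrite split_box => e NFle.
  have h1 : (2 * 2 ^ n <= 2 ^ (n + d))%N by rewrite -expnS leq_exp2l// -addn1 leq_add2l.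
  have h2 : (2 ^ n.-1 <= 2 ^ n)%N by rewrite leq_exp2l// leq_pred.
  have h3 : (2 * 2 ^ n <= #|free s| + 2 ^ n)%N.
    by rewrite (leq_trans h1)// -e leq_add2l (leq_trans NFle).
  by move: h3; rewrite mul2n -addnn leq_add2r.
pose idx f : option 'I_M := [pick i | tensor (bump R m) s f (xi i) != 0].
have idxP f : f \in NF -> exists i, idx f = Some i /\ tensor (bump R m) s f (xi i) != 0.
  rewrite inNF => /andP[_ /existsP ex]; rewrite /idx; case: pickP => [i hi|no].
    by exists i.
  by case: ex => i; rewrite no.
have /pcard_leP[phi] := net s sn.
(* The injection is applied to the knot and not to its index, since the family of knots may have
   repetitions. The default 0 is never taken on [NF]. *)
pose g f : nat := if idx f is Some i then phi (xi i) else 0%N.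
have XW k h : h \in box s -> tensor (bump R m) s h (xi k) != 0 ->
    (range xi `\` zeros_w s) (xi k).
  move=> hb hk; split; first by exists k.
  rewrite /zeros_w /w /=; apply/eqP/prodf_neq0 => j _.
  exact: sin_near_center_neq0 (near h k hb hk j).
have ginj : {in NF &, injective g}.
  move=> f f' fN f'N; have [i [ei ti]] := idxP _ fN; have [i' [ei' ti']] := idxP _ f'N.
  have fb : f \in box s by move: fN; rewrite inNF => /andP[].
  have fb' : f' \in box s by move: f'N; rewrite inNF => /andP[].
  rewrite /g ei ei' => e.
  have xx : xi i = xi i'.
    have := @inj _ _ _ phi; move=> /(_ (xi i) (xi i')).
    by rewrite !inE; apply => //; [exact: (XW i f)|exact: (XW i' f')].
  apply/ffunP => j; apply: val_inj => /=.
  have h1 := near f i fb ti j; have h2 := near f' i' fb' ti' j.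
  by rewrite -xx in h2; exact: center_inj h1 h2.
have glt f : f \in NF -> (g f < 2 ^ n.-1)%N.
  move=> fN; have [i [ei ti]] := idxP _ fN; rewrite /g ei.
  have fb : f \in box s by move: fN; rewrite inNF => /andP[].
  by have := @funS _ _ _ _ phi (xi i) (XW i f fb ti).
pose t f : 'I_(2 ^ n.-1).-1.+1 := inord (g f).
have N0 : (0 < 2 ^ n.-1)%N by rewrite expn_gt0.
have tinj : {in NF &, injective t}.
  move=> f f' fN f'N /(congr1 val); rewrite /= !inordK ?prednK ?glt// => e.
  exact: ginj.
by rewrite -(card_in_imset tinj) (leq_trans (max_card _))// card_ord prednK.
Qed.

End boxes.

(** * Moments of the tensor sums *)

Section kernel_moments.
Variables (R : realType) (r : R) (m d n : nat).
Hypotheses (r0 : 0 < r) (rm : r + 2 <= m%:R).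
Local Notation E := (euclidean R d).
Local Notation mu := (torus_prob R d).
Local Notation C := (block_cst R r m).
Local Notation S := (2 `^ r).
Local Notation z := (block_rate R r).

Lemma kernel_block_shift u a c (x : R) : kernel_block R r m u a (x - c) =
  2 ^- a * (u == 0%N)%:R * cos (0%:Z%:~R * x + 0) + \sum_(k < (2 ^ u.+1).-1)
   (2 ^- a * 2 * (dyadic_part R u k.+1 * kernel_coef R r m a k.+1)) *
     cos (k.+1%:Z%:~R * x + (r * pi / 2 - k.+1%:R * c)).
Proof.
rewrite mul0r addr0 cos0 mulr1 /kernel_block mulrDr; congr (_ + _).
rewrite mulrA mulr_sumr; apply: eq_bigr => k _; rewrite mulrA; congr (_ * cos _).
by rewrite -pmulrn; ring.
Qed.

Lemma kernel_block_low u a c :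
  trig R (fun k => (`|k| < 2 ^ u.+1)%N) (fun x => kernel_block R r m u a (x - c)).
Proof.
rewrite (funext (kernel_block_shift _ a c)).
apply: (trigD R _ _ _ _ (trig_cos R _ _ _ _ _) (trig_sum R _ _ _ _ _ _)) => //=.
  by rewrite expn_gt0.
move=> k _; apply: trig_cos => /=; have := ltn_ord k.
by rewrite -ltnS prednK// expn_gt0.
Qed.

Lemma kernel_block_high v a c :
  trig R (fun k => (2 ^ v <= `|k|)%N) (fun x => kernel_block R r m v.+1 a (x - c)).
Proof.
rewrite (funext (kernel_block_shift _ a c)).
apply: (trigD R _ (fun=> 0) _ _ (trig0 R _ _ _) (trig_sum R _ _ _ _ _ _)) => //=; last first.
  by move=> x; rewrite mulr0 mul0r.
move=> k _; have [kv|vk] := leqP k.+1 (2 ^ v).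
  by apply: trig0 => x; have /= -> := dyadic_part_low R v k.+1 kv; rewrite mul0r mulr0 mul0r.
by apply: trig_cos => /=; exact: ltnW.
Qed.

(* Blocks are indexed relative to [a] (and vanish when [a + w < n]): for a fixed
   [w] the frequencies then grow with [a], which makes the boxes of different
   scales lacunary. *)
Definition shifted_block (a w : nat) (x : R) : R :=
  if (n <= a + w)%N then kernel_block R r m (a + w - n) a x else 0.

Lemma trig_true (Q : int -> bool) f : trig R Q f -> trig R xpredT f.
Proof. exact: trig_sub. Qed.

Lemma shifted_block_trig a w c : trig R xpredT (fun x => shifted_block a w (x - c)).
Proof.
rewrite /shifted_block; case: leqP => _; last exact: trig0.
exact: trig_true (kernel_block_low _ _ _).
Qed.

Lemma shifted_block_sum (a w : nat) (x : R) :
  \sum_(k < 2 ^ a.+1) `|shifted_block a w (x - center R a k)| <=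
  C * S ^+ a * z ^+ ((n - w) + (w - n)).
Proof.
have z0 := block_rate_gt0 R r; have C48 := block_cst_ge48 R r m r0.
rewrite /shifted_block; case: leqP => nw; last first.
  rewrite big1; last by move=> k _; rewrite normr0.
  have C0 : 0 <= C by lra.
  by rewrite mulr_ge0 ?(mulr_ge0 C0) ?exprn_ge0 ?powR_ge0 ?(ltW z0).
have -> : ((n - w) + (w - n) = (a - (a + w - n)) + (a + w - n - a))%N by lia.
apply: le_trans (kernel_block_sum R r m r0 rm (a + w - n) a (x - pi / 2 ^+ a.+1)).
rewrite le_eqVlt; apply/orP; left; apply/eqP; apply: eq_bigr => k _.
by rewrite centerE opprD addrA.
Qed.

Variables (k l kap : nat).
Hypotheses (kl : (2 * k).+2 = (2 ^ l)%N) (kk : ((2 * k).+1 * 4 <= 2 ^ kap)%N).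
Variables (I : finType) (lv : I -> 'I_d -> nat) (ix : 'I_d -> I -> nat) (J : seq 'I_d).
Variable Om : I -> {set {ffun 'I_d -> 'I_(2 ^ n.+1)}}.
Hypotheses (lvn : forall i, (\sum_j lv i j = n)%N)
  (lvJ : forall i j, j \in J -> lv i j = (kap * ix j i)%N)
  (ixJ : forall i i', (forall j, j \in J -> ix j i = ix j i') -> i = i')
  (OmB : forall i, Om i \subset box d n (lv i)).

Let lvle i j : (lv i j <= n)%N. Proof. by rewrite -(lvn i) (bigD1 j)//= leq_addr. Qed.

Definition block_tensor (V : nat) (w : {ffun 'I_d -> 'I_V}) (i : I) (x : E) : R :=
  \sum_(f in Om i) \prod_j shifted_block (lv i j) (w j) (tnth x j - center R (lv i j) (f j)).

Definition block_norm (V : nat) (w : {ffun 'I_d -> 'I_V}) : R :=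
  C ^+ d * S ^+ n * \prod_j z ^+ ((n - w j) + (w j - n)).

Lemma block_norm_gt0 V (w : {ffun 'I_d -> 'I_V}) : 0 < block_norm V w.
Proof.
have z0 := block_rate_gt0 R r; have C48 := block_cst_ge48 R r m r0.
rewrite /block_norm !mulr_gt0 ?exprn_gt0 ?powR_gt0//; first lra.
by apply: prodr_gt0 => j _; rewrite exprn_gt0.
Qed.

(** With absolute values the arbitrary set of boxes may be enlarged to all of them, and then the sum
    factors into one-dimensional ones. The powers of 2^r multiply to 2^(rn), because the levels sum
    to n. *)
Lemma block_tensor_le V (w : {ffun 'I_d -> 'I_V}) i x : `|block_tensor V w i x| <= block_norm V w.
Proof.
rewrite /block_tensor (le_trans (ler_norm_sum _ _ _))//.
under eq_bigr do rewrite normr_prod.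
pose F (j : 'I_d) (k : nat) := `|shifted_block (lv i j) (w j) (tnth x j - center R (lv i j) k)|.
apply: (@le_trans _ _ (\sum_(f in box d n (lv i)) \prod_j F j (f j))).
  rewrite [leRHS](bigID (fun f => f \in Om i)) /=.
  rewrite [X in _ <= X + _](eq_bigl (fun f => f \in Om i)); last first.
    move=> f; case: (boolP (f \in Om i)) => fO; rewrite ?andbF// andbT.
    exact: (fintype.subsetP (OmB i)).
  rewrite lerDl sumr_ge0// => f _; apply: prodr_ge0 => j _; exact: normr_ge0.
rewrite sum_box_prod//.
have -> : block_norm V w = \prod_j (C * S ^+ lv i j * z ^+ ((n - w j) + (w j - n))).
  by rewrite /block_norm 2!big_split /= prodr_const card_ord -[X in _ = _ * X * _]expr_sum lvn.
apply: ler_prod => j _; rewrite sumr_ge0//=; last by move=> q _; exact: normr_ge0.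
exact: shifted_block_sum.
Qed.

Lemma block_tensor_span (P : 'I_d -> int -> bool) V (w : {ffun 'I_d -> 'I_V}) i :
  (forall j c, trig R (P j) (fun x => shifted_block (lv i j) (w j) (x - c))) ->
  tspan R d P (block_tensor V w i).
Proof.
move=> h; apply: tspan_sum => f _.
apply: (tspan_prod R d P (fun j y => shifted_block (lv i j) (w j) (y - center R (lv i j) (f j)))).
by move=> j; exact: h.
Qed.

Lemma block_tensor_moment V (w : {ffun 'I_d -> 'I_V}) : (0 < #|I|)%N ->
  moment_bound _ _ _ mu k (fun x => \sum_i block_tensor V w i x)
    (type2_cst R k ^+ size J * (#|I|%:R * block_norm V w ^+ 2)).
Proof.
move=> I0; have A0 := block_norm_gt0 V w.
have bt i : bounded_mfun _ E R (block_tensor V w i).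
  apply: (tspan_bmf R d (fun _ => xpredT)); apply: block_tensor_span => j c.
  exact: shifted_block_trig.
have := moment_bound_lacunary R d I (block_tensor V w) k (block_norm V w ^+ 2) ix J [set: I]%SET.
rewrite cardsT.
have -> : (fun x => \sum_(i in [set: I]%SET) block_tensor V w i x) =
    (fun x => \sum_i block_tensor V w i x).
  by apply/funext => x; apply: eq_bigl => i; rewrite finset.in_setT.
apply => //.
- by rewrite exprn_gt0.
- move=> i; rewrite /moment_bound.
  rewrite -[leRHS](bmf_Rintegral_cst _ _ _ mu); apply: bmf_Rintegral_le.
  + exact: bmfX.
  + exact: bmf_cst.
  + move=> x; have -> : (2 * k).+2 = (2 * k.+1)%N by rewrite mulnS.
    rewrite exprM; apply: lerXn2r; rewrite ?nnegrE ?sqr_ge0// -[leLHS]real_normK ?num_real//.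
    by apply: lerXn2r; rewrite ?nnegrE ?(ltW A0)// block_tensor_le.
- move=> j K jJ.
  (* Levels below K are at most K - 1, so their blocks have frequencies below 2^(u+1). The value D =
     0 covers the cases where there is no lower level or all lower blocks vanish. *)
  pose u := (kap * K.-1 + w j - n)%N.
  pose D := if (0 < K)%N && (n <= kap * K.-1 + w j)%N then (2 ^ u.+1)%N else 0%N.
  exists D; split => [i iK|i iK]; apply: block_tensor_span => j' c.
    rewrite /low_freq; have [->|_] := eqVneq j' j; last first.
      exact: trig_true (shifted_block_trig _ _ _).
    rewrite /= /shifted_block lvJ//; case: leqP => h; last exact: trig0.
    apply: trig_sub (kernel_block_low _ _ _) => q /=.
    have iK1 : (kap * ix j i <= kap * K.-1)%N by rewrite leq_mul2l; apply/orP; right; lia.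
    rewrite /D (_ : (0 < K)%N) ?(leq_ltn_trans _ iK)//=.
    rewrite (leq_trans h) ?leq_add2r//= => /leq_trans; apply.
    by rewrite leq_exp2l// ltnS /u leq_sub2r// leq_add2r.
  rewrite /high_freq; have [->|_] := eqVneq j' j; last first.
    exact: trig_true (shifted_block_trig _ _ _).
  rewrite /= /D; case: ifP => [/andP[K0 h]|_]; last first.
    rewrite muln0; exact: trig_true (shifted_block_trig _ _ _).
  rewrite /shifted_block lvJ// iK; case: leqP => h'; last exact: trig0.
  have kap0 : (0 < kap)%N by case: (kap) kk => //; rewrite expn0; lia.
  (* At level K the block starts at frequency 2^(u + kap - 1), so the required gap (2k+1) 2^(u+1) <=
     2^(u + kap - 1) is exactly the condition on [kap]. *)
  have e : (kap * K + w j - n = (u + kap.-1).+1)%N.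
    have : (kap * K = kap * K.-1 + kap)%N by rewrite -[in LHS](prednK K0) mulnS addnC.
    by rewrite /u; lia.
  rewrite e; apply: trig_sub (kernel_block_high _ _ _) => q /=; apply: leq_trans.
  rewrite expnD expnS mulnCA -(leq_pmul2r (_ : 0 < 2)%N)//.
  have := kk; rewrite -(prednK kap0) expnS => kk'.
  have : ((2 * k).+1 * 2 <= 2 ^ kap.-1)%N by lia.
  move: (2 ^ u)%N (2 ^ kap.-1)%N => A B; nia.
- by move=> i i' _ _; exact: ixJ.
Qed.

Lemma sum_rate_le (V : nat) : \sum_(w < V) z ^+ ((n - w) + (w - n)) <= 2 / (1 - z).
Proof.
have z0 := block_rate_gt0 R r; have z1 := block_rate_lt1 R r r0.
have geo N : \sum_(j < N) z ^+ j <= (1 - z)^-1.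
  have zn : `|z| < 1 by rewrite gtr0_norm.
  rewrite -[leRHS]mul1r; apply: le_trans (geometric_le_lim N ler01 z0 zn).
  by rewrite /series /= big_mkord; apply: ler_sum => j _; rewrite mul1r.
have -> : 2 / (1 - z) = (1 - z)^-1 + (1 - z)^-1 by ring.
apply: (@le_trans _ _ (\sum_(w < n + V) z ^+ ((n - w) + (w - n)))).
  rewrite -!(big_mkord xpredT (fun w => z ^+ ((n - w) + (w - n)))).
  rewrite [leRHS](big_cat_nat (leq0n V) (leq_addl n V)) /= lerDl sumr_ge0// => w _.
  by rewrite exprn_ge0// ltW.
rewrite big_split_ord /=; apply: lerD.
  rewrite (reindex_inj rev_ord_inj) /=.
  apply: le_trans (geo n.+1); rewrite big_ord_recl /= expr0.
  apply: (@le_trans _ _ (\sum_(i < n) z ^+ (lift ord0 i))); last by rewrite lerDr.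
  apply: ler_sum => i _; rewrite lift0.
  by have -> : (n - (n - i.+1) + (n - i.+1 - n) = i.+1)%N by have := ltn_ord i; lia.
apply: le_trans (geo V); apply: ler_sum => i _.
by have -> : (n - (n + i) + (n + i - n) = i)%N by lia.
Qed.

Definition kernel_norm : R := C ^+ d * S ^+ n * (2 / (1 - z)) ^+ d.

Lemma sum_block_norm_le V : \sum_w block_norm V w <= kernel_norm.
Proof.
have z0 := block_rate_gt0 R r; have z1 := block_rate_lt1 R r r0.
have C48 := block_cst_ge48 R r m r0.
rewrite /block_norm -mulr_sumr /kernel_norm ler_wpM2l ?mulr_ge0 ?exprn_ge0 ?powR_ge0//; first lra.
rewrite -(bigA_distr_bigA (fun (j : 'I_d) (w : 'I_V) => z ^+ ((n - w) + (w - n)))) /=.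
rewrite prodr_const card_ord lerXn2r ?nnegrE ?sum_rate_le//.
  by rewrite sumr_ge0// => w _; rewrite exprn_ge0// ltW.
by rewrite divr_ge0// subr_ge0 ltW.
Qed.

(** Jensen's inequality replaces Minkowski's: the sum over w is a convex combination of the
    quotients G_w / lam_w with weights proportional to [block_norm], and all these quotients obey
    the same moment bound. *)
Lemma blocks_moment V : (0 < V)%N -> (0 < #|I|)%N ->
  moment_bound _ _ _ mu k (fun x => \sum_(w : {ffun 'I_d -> 'I_V}) \sum_i block_tensor V w i x)
    (type2_cst R k ^+ size J * (#|I|%:R * kernel_norm ^+ 2)).
Proof.
move=> V0 I0; set G := fun (w : {ffun 'I_d -> 'I_V}) x => \sum_i block_tensor V w i x.
set T0 := type2_cst R k ^+ size J.
have T0p : 0 < T0 by rewrite exprn_gt0// (lt_le_trans ltr01 (type2_cst_ge1 _ _)).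
have bG w : bounded_mfun _ E R (G w).
  apply: bmf_sum => i _; apply: (tspan_bmf R d (fun _ => xpredT)).
  by apply: block_tensor_span => j c; exact: shifted_block_trig.
pose W := \sum_w block_norm V w.
have W0 : 0 < W.
  case: V V0 G bG @W => // V _ G bG W.
  rewrite /W (bigD1 [ffun=> ord0])//= ltr_pwDl ?block_norm_gt0// sumr_ge0// => w _.
  by rewrite ltW// block_norm_gt0.
pose lam w := block_norm V w / W.
have lam0 w : 0 < lam w by rewrite divr_gt0// block_norm_gt0.
have lam1 : \sum_w lam w = 1 by rewrite -mulr_suml divff// gt_eqF.
apply: (@moment_boundW R d k _ (T0 * (#|I|%:R * W ^+ 2))).
- exact: mulr_ge0 (ltW T0p) (mulr_ge0 (ler0n _ _) (sqr_ge0 _)).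
- have WK := sum_block_norm_le V.
  apply: ler_wpM2l; first exact: ltW.
  apply: ler_wpM2l; first by [].
  by apply: lerXn2r => //; rewrite nnegrE ?(ltW W0)// (le_trans (ltW W0)).
rewrite /moment_bound.
apply: (@le_trans _ _ (\int[mu]_x \sum_w lam w * (lam w ^- (2 * k).+2 * G w x ^+ (2 * k).+2))).
  apply: bmf_Rintegral_le.
  - by apply: bmfX; apply: bmf_sum => w _; exact: bG.
  - by apply: bmf_sum => w _; apply: bmfZ; apply: bmfZ; exact: bmfX.
  move=> x; have := exp2n_wsum_le R _ lam (fun w => G w x / lam w) l (fun w => ltW (lam0 w)) lam1.
  rewrite -kl; congr (_ ^+ _ <= _); apply: eq_bigr => w _.
    by rewrite mulrCA divff ?mulr1// gt_eqF.
  by rewrite expr_div_n [X in _ * X]mulrC.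
rewrite bmf_Rintegral_sum; last by move=> w _; apply: bmfZ; apply: bmfZ; exact: bmfX.
apply: (@le_trans _ _ (\sum_w lam w * (T0 * (#|I|%:R * W ^+ 2)) ^+ k.+1)); last first.
  by rewrite -mulr_suml lam1 mul1r.
apply: ler_sum => w _.
rewrite bmf_RintegralZ; last by apply: bmfZ; exact: bmfX.
rewrite bmf_RintegralZ; last exact: bmfX.
rewrite ler_wpM2l ?(ltW (lam0 w))//.
rewrite mulrC ler_pdivrMr ?exprn_gt0//.
apply: (le_trans (block_tensor_moment V w I0)).
have -> : (2 * k).+2 = (2 * k.+1)%N by lia.
rewrite exprM -exprMn le_eqVlt; apply/orP; left; apply/eqP; congr (_ ^+ _).
by rewrite -/T0 /lam; field; rewrite gt_eqF.
Qed.

End kernel_moments.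

(** * From finitely many blocks to the full derivative *)

Section kernel_limit.
Variables (R : realType) (r : R) (m d n : nat).
Hypotheses (r0 : 0 < r) (rm : r + 2 <= m%:R).
Local Notation E := (euclidean R d).
Local Notation mu := (torus_prob R d).

Lemma sum_shifted_block a N (x : R) : (a <= n)%N ->
  \sum_(w < N + (n - a)) shifted_block R r m n a w x = \sum_(u < N) kernel_block R r m u a x.
Proof.
move=> an; rewrite -(big_mkord xpredT (fun w => shifted_block R r m n a w x)).
rewrite (big_cat_nat (leq0n (n - a)) (leq_addl _ _)) /= big_nat_cond big1 ?add0r.
  rewrite -{1}(add0n (n - a)%N) big_addn addnK big_mkord; apply: eq_bigr => u _.
  by rewrite /shifted_block (_ : (a + (u + (n - a)) = n + u)%N) ?leq_addr ?addKn//; lia.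
by move=> w; rewrite andbT => /andP[_ wn]; rewrite /shifted_block; case: leqP => //; lia.
Qed.

Lemma shifted_block_cvg a (x : R) : (a <= n)%N ->
  (fun V => \sum_(w < V) shifted_block R r m n a w x) @ \oo --> bump_kernel R r m a x.
Proof.
move=> an; rewrite -(@cvg_shiftn (n - a).+1).
rewrite (_ : (fun _ => _) = (fun N => \sum_(u < N.+1) kernel_block R r m u a x)).
  exact: bump_kernel_blocks_cvg.
by apply/funext => N; rewrite addnS -addSn sum_shifted_block.
Qed.

(** A bound uniform in V, for dominated convergence; 6 = 4 + 2 adds the error of the truncation to
    the size of the series. *)
Lemma sum_shifted_block_le a V (x : R) : (a <= n)%N ->
  `|\sum_(w < V) shifted_block R r m n a w x| <= 2 ^- a + 6 * bump_cst R m a.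
Proof.
move=> an; have B0 := bump_cst_ge0 R m a.
have a0 : 0 <= 2 ^- a :> R by rewrite invr_ge0 exprn_ge0.
have [Vn|nV] := leqP V (n - a).
  rewrite big1 ?normr0; first lra.
  by move=> w _; have wV := ltn_ord w; rewrite /shifted_block; case: leqP => //; lia.
have -> : (V = (V - (n - a)).-1.+1 + (n - a))%N by lia.
rewrite sum_shifted_block//; set N := _.-1.
have h1 := bump_kernel_blocks R r m rm a N x.
have h2 := cos_series_le R (2 ^- a) (bump_kernel_coef R r m a) (r * pi / 2) _ B0
  (bump_kernel_coef_le R r m rm a) x.
have h3 : 4 * bump_cst R m a / N.+1%:R <= 4 * bump_cst R m a.
  by rewrite ler_pdivrMr// ler_peMr ?ler1n//; lra.
rewrite (ger0_norm a0) -/(bump_kernel R r m a) in h2.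
have := ler_normD (\sum_(u < N.+1) kernel_block R r m u a x - bump_kernel R r m a x)
  (bump_kernel R r m a x).
rewrite subrK => /le_trans; apply; apply: (le_trans (lerD (le_trans h1 h3) h2)).
by rewrite le_eqVlt; apply/orP; left; apply/eqP; ring.
Qed.

Variables (I : finType) (lv : I -> 'I_d -> nat).
Variable Om : I -> {set {ffun 'I_d -> 'I_(2 ^ n.+1)}}.
Hypothesis lvle : forall i j, (lv i j <= n)%N.

Definition tensor_sum (H : nat -> R -> R) (x : E) : R :=
  \sum_i \sum_(f in Om i) tensor R d n H (lv i) f x.

Lemma blocks_sumE V x :
  \sum_(w : {ffun 'I_d -> 'I_V}) \sum_i block_tensor R r m d n I lv Om V w i x =
  tensor_sum (fun a y => \sum_(w < V) shifted_block R r m n a w y) x.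
Proof.
rewrite exchange_big; apply: eq_bigr => i _.
rewrite exchange_big; apply: eq_bigr => f _.
by rewrite /tensor bigA_distr_bigA.
Qed.

Lemma blocks_sum_cvg x :
  (fun V => \sum_(w : {ffun 'I_d -> 'I_V}) \sum_i block_tensor R r m d n I lv Om V w i x) @ \oo -->
  tensor_sum (bump_kernel R r m) x.
Proof.
rewrite (funext (fun V => blocks_sumE V x)).
apply: cvg_big => [|i _]; first exact: add_continuous.
apply: cvg_big => [|f _]; first exact: add_continuous.
apply: cvg_big => [|j _]; first exact: mul_continuous.
exact: shifted_block_cvg.
Qed.

Lemma blocks_sum_le V x :
  `|\sum_(w : {ffun 'I_d -> 'I_V}) \sum_i block_tensor R r m d n I lv Om V w i x| <=
  \sum_i \sum_(f in Om i) \prod_j (2 ^- lv i j + 6 * bump_cst R m (lv i j)).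
Proof.
rewrite blocks_sumE (le_trans (ler_norm_sum _ _ _))//; apply: ler_sum => i _.
rewrite (le_trans (ler_norm_sum _ _ _))//; apply: ler_sum => f _.
rewrite normr_prod; apply: ler_prod => j _; rewrite normr_ge0/=.
exact: sum_shifted_block_le.
Qed.

Lemma bmf_blocks V : bounded_mfun _ E R
  (fun x => \sum_(w : {ffun 'I_d -> 'I_V}) \sum_i block_tensor R r m d n I lv Om V w i x).
Proof.
apply: bmf_sum => w _; apply: bmf_sum => i _; apply: (tspan_bmf R d (fun _ => xpredT)).
by apply: block_tensor_span => j c; exact: shifted_block_trig.
Qed.

Lemma moment_bound_limit k A :
  (forall V, (0 < V)%N -> moment_bound _ _ _ mu k
    (fun x => \sum_(w : {ffun 'I_d -> 'I_V}) \sum_i block_tensor R r m d n I lv Om V w i x) A) ->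
  moment_bound _ _ _ mu k (tensor_sum (bump_kernel R r m)) A.
Proof.
move=> mb; pose B := \sum_i \sum_(f in Om i) \prod_j (2 ^- lv i j + 6 * bump_cst R m (lv i j)).
have mlim : measurable_fun [set: E] (tensor_sum (bump_kernel R r m)).
  apply: (measurable_fun_cvg (h := fun V x => \sum_(w : {ffun 'I_d -> 'I_V})
      \sum_i block_tensor R r m d n I lv Om V w i x)) => [V|x _].
    by have [] := bmf_blocks V.
  exact: blocks_sum_cvg.
have [] := Rintegral_dominated _ _ _ mu
  (fun V x => (\sum_(w : {ffun 'I_d -> 'I_V})
     \sum_i block_tensor R r m d n I lv Om V w i x) ^+ (2 * k).+2)
  (fun x => tensor_sum (bump_kernel R r m) x ^+ (2 * k).+2) (fun=> B ^+ (2 * k).+2).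
- by move=> V; have [] := bmfX _ _ _ _ (2 * k).+2 (bmf_blocks V).
- exact: measurable_funX.
- apply: aeW => x; exact: (cvg_comp _ _ (blocks_sum_cvg x) (@exprn_continuous R (2 * k).+2 _)).
- by apply: bmf_integrable; exact: bmf_cst.
- apply: aeW => x V; rewrite normrX lerXn2r ?nnegrE ?blocks_sum_le//.
  by rewrite (le_trans _ (blocks_sum_le 0 x)).
move=> _ cv; rewrite /moment_bound.
apply: (ler_cvg_to cv (cvg_cst _)); near=> V; apply: mb.
by near: V; exact: nbhs_infty_gt.
Unshelve. all: by end_near. Qed.

End kernel_limit.

(** * Mean, regularity and convolution of tensor sums *)

Section tensor_sums.
Variables (R : realType) (d n : nat).
Local Notation E := (euclidean R d).
Local Notation mu := (torus_prob R d).
Variables (I : finType) (lv : I -> 'I_d -> nat).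
Variable Om : I -> {set {ffun 'I_d -> 'I_(2 ^ n.+1)}}.
Local Notation tsum := (tensor_sum R d n I lv Om).

(** The third argument of [H] lets one statement serve both the mean of a tensor sum and its
    convolution with [F]. *)
Lemma tensor_sum_Rintegral (H : nat -> R -> R -> R) (w : E) :
  (forall a t j, (uprob R).-integrable [set: measurableTypeR R]
     (EFin \o (fun y => H a (y - t) (tnth w j - y)))) ->
  let h x := \sum_i \sum_(f in Om i)
     \prod_j H (lv i j) (tnth x j - center R (lv i j) (f j)) (tnth w j - tnth x j) in
  mu.-integrable [set: E] (EFin \o h) /\
  \int[mu]_x h x = \sum_i \sum_(f in Om i)
     \prod_j \int[uprob R]_y H (lv i j) (y - center R (lv i j) (f j)) (tnth w j - y).
Proof.
move=> iH h.
have tt i (f : {ffun 'I_d -> 'I_(2 ^ n.+1)}) := torus_tensor R d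
  (fun j y => H (lv i j) (y - center R (lv i j) (f j)) (tnth w j - y)) (fun j => iH _ _ j).
have ts i := Rintegral_bigsum _ _ _ mu _ (index_enum _) (fun f => f \in Om i) _
  (fun f _ => (tt i f).1).
have [h1 h2] := Rintegral_bigsum _ _ _ mu _ (index_enum I) xpredT _ (fun i _ => (ts i).1).
split => //; rewrite h2; apply: eq_bigr => i _; rewrite (ts i).2; apply: eq_bigr => f _.
exact: (tt i f).2.
Qed.

Lemma tensor_sum_bmf (H : nat -> R -> R) :
  (forall a, bounded_mfun _ (measurableTypeR R) R (H a)) -> bounded_mfun _ E R (tsum H).
Proof.
move=> bH; apply: bmf_sum => i _; apply: bmf_sum => f _; rewrite /tensor.
elim: (index_enum 'I_d) => [|j s IHs].
  by under eq_fun do rewrite big_nil; exact: bmf_cst.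
under eq_fun do rewrite big_cons; apply: bmfM => //.
have [mf [M fM]] := bmf_shift _ _ (center R (lv i j) (f j)) (bH (lv i j)).
split; last by exists M => x; exact: fM.
by apply: (measurableT_comp mf); exact: measurable_tnth.
Qed.

Lemma tensor_sum_periodic (H : nat -> R -> R) :
  (forall a x, H a (x + 2 * pi) = H a x) -> Defs.periodic (tsum H).
Proof.
move=> pH j x; apply: eq_bigr => i _; apply: eq_bigr => f _; apply: eq_bigr => j' _.
rewrite tnth_mktuple; case: eqP => _; last by rewrite mulr0n addr0.
by rewrite mulr1n addrAC pH.
Qed.

Lemma tensor_sum_continuous (H : nat -> R -> R) :
  (forall a, continuous (H a)) -> continuous_on_space (tsum H).
Proof.
move=> cH v; have vF := nbhs_filter v.
apply: (cvg_big add_continuous vF) => i _; apply: (cvg_big add_continuous vF) => f _.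
apply: (cvg_big mul_continuous vF) => j _; rewrite tnth_mktuple.
under eq_fun do rewrite tnth_mktuple.
apply: (@cvg_comp _ _ _ (fun u : 'rV[R]_d => u ord0 j - center R (lv i j) (f j)) (H (lv i j))
  _ _ _ _ (cH _ _)).
by apply: cvgB; [exact: coord_continuous|exact: cvg_cst].
Qed.

Variables (r : R) (m : nat).
Hypotheses (r0 : 0 < r) (rm : r + 2 <= m%:R).

Lemma integrable_bump_kernel_F1 a (t x : R) :
  (uprob R).-integrable [set: measurableTypeR R]
    (EFin \o (fun y => bump_kernel R r m a (y - t) * F1 r (x - y))).
Proof.
have [q hq] := modulo_2pi _ x; set x0 := x - _ in hq.
rewrite (_ : (fun y : R => _) = (fun y => bump_kernel R r m a (y - t) * F1 r (x0 - y))).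
  exact: (integrable_F1_mul R r r0 x0 _ hq (bmf_shift _ _ t (bump_kernel_bmf R r m rm a))).
apply/funext => y; rewrite -[in LHS](subrK (q%:~R * (2 * pi)) x) -/x0.
by rewrite addrAC F1_periodic.
Qed.

Lemma convolution_tensor_sum (b : R) x :
  convolution (fun y => b * tsum (bump_kernel R r m) y) (F r) x = b * tsum (bump R m) x.
Proof.
have [iK eK] := tensor_sum_Rintegral (fun a y z => bump_kernel R r m a y * F1 r z) x
  (fun a t j => integrable_bump_kernel_F1 a t (tnth x j)).
transitivity (b * \sum_i \sum_(f in Om i) \prod_j \int[uprob R]_y
    (bump_kernel R r m (lv i j) (y - center R (lv i j) (f j)) * F1 r (tnth x j - y))).
  rewrite -eK -RintegralZl//; apply: eq_Rintegral => y _.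
  rewrite -mulrA; congr (_ * _); rewrite /tensor_sum mulr_suml; apply: eq_bigr => i _.
  rewrite mulr_suml; apply: eq_bigr => f _; rewrite /tensor /F -big_split /=.
  by apply: eq_bigr => j _; rewrite tnth_mktuple.
congr (_ * _); apply: eq_bigr => i _; apply: eq_bigr => f _; apply: eq_bigr => j _.
exact: bump_conv.
Qed.

Lemma bump_tensor_sum_mean : (forall i, (\sum_j lv i j = n)%N) ->
  \int[mu]_x tsum (bump R m) x = \sum_i #|Om i|%:R * 2 ^- n.
Proof.
move=> lvn.
have [_] := tensor_sum_Rintegral (fun a y _ => bump R m a y) [tuple 0 | j < d]
  (fun a t j => bmf_integrable _ _ _ (uprob R) _ (bmf_shift _ _ t (bump_bmf R r m r0 rm a))).
move=> ->; apply: eq_bigr => i _; rewrite -sumr_const mulr_suml; apply: eq_bigr => f _.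
rewrite mul1r -[in RHS](lvn i) -exprVn expr_sum; apply: eq_bigr => j _.
by rewrite (bump_mean R r m r0 rm) exprVn.
Qed.

End tensor_sums.

(** * The extremal function *)

Lemma Lnorm_half_le1 (d : measure_display) (T : measurableType d) (R : realType)
    (P : probability T R) (k : nat) (p : R) (f : T -> R) :
  bounded_mfun d T R f -> 1 <= p -> p <= (2 * k).+2%:R -> moment_bound d T R P k f 1 ->
  ('N[P]_p%:E [EFin \o (fun x => 2^-1 * f x)%R] <= 1)%E.
Proof.
move=> bf p1 pk mf; have p0 : 0 < p by lra.
(* [|f / 2|^p <= (1 + f^(2k+2)) / 2] *)
have bg : bounded_mfun d T R (fun x => 2^-1 * (1 + f x ^+ (2 * k).+2)).
  by apply: bmfZ; apply: bmfD; [exact: bmf_cst|exact: bmfX].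
have bh : bounded_mfun d T R (fun x => 2^-1 * f x) by exact: bmfZ.
have g1 : (\int[P]_x (2^-1 * (1 + f x ^+ (2 * k).+2))%R%:E <= 1)%E.
  rewrite -[leLHS]fineK; last first.
    by apply: integrable_fin_num => //; exact: (bmf_integrable _ _ _ P _ bg).
  rewrite lee_fin -[X in X <= _]/(\int[P]_x (2^-1 * (1 + f x ^+ (2 * k).+2))).
  rewrite bmf_RintegralZ; last by apply: bmfD; [exact: bmf_cst|exact: bmfX].
  rewrite bmf_RintegralD; [|exact: bmf_cst|exact: bmfX].
  by rewrite bmf_Rintegral_cst; move: mf; rewrite /moment_bound expr1n; lra.
have le1 : (\int[P]_x (`|(2^-1 * f x)%R%:E| `^ p) <= 1)%E.
  apply: le_trans g1; apply: ge0_le_integral => //.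
  - by move=> x _; exact: poweR_ge0.
  - apply: (@measurableT_comp _ _ _ _ _ _ (fun y => (y `^ p)%E)) => //.
      exact: measurable_poweR.
    by apply: measurableT_comp => //; apply: measurableT_comp => //; have [] := bh.
  - by apply: measurableT_comp => //; have [] := bg.
  move=> x _; rewrite /= lee_fin normrM (ger0_norm (_ : 0 <= 2^-1))// powRM//.
  apply: ler_pM; rewrite ?powR_ge0//.
    by apply: ge1r_powR => //; apply/andP; split; lra.
  rewrite -[X in _ <= 1 + X]ger0_norm; last first.
    have -> : (2 * k).+2 = (2 * k.+1)%N by rewrite mulnS.
    by rewrite exprM exprn_ge0// sqr_ge0.
  rewrite normrX -powR_mulrn//; have [f1|/ltW f1] := leP `|f x| 1.
    have one : 1 `^ p = 1 :> R by rewrite powR1.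
    by rewrite (@le_trans _ _ 1) ?lerDl ?powR_ge0// -[leRHS]one ge0_ler_powR ?nnegrE ?(ltW p0).
  by rewrite (@le_trans _ _ (`|f x| `^ (2 * k).+2%:R))// ?lerDr// ler_powR.
have int0 : (0 <= \int[P]_x (`|(2^-1 * f x)%R%:E| `^ p))%E.
  by apply: integral_ge0 => x _; exact: poweR_ge0.
have one : (1 `^ p^-1 = 1 :> \bar R)%E by rewrite poweR_EFin powR1.
rewrite unlock /= -[leRHS]one; apply: gt0_ler_poweR => //.
- by rewrite invr_ge0 ltW.
- by rewrite in_itv /= int0 leey.
- by rewrite in_itv /= lee_fin ler01 leey.
Qed.

(** * The family of scales *)

Section levels.
Variables (e n kap : nat).
Local Notation q := (n %/ (kap * e.+1))%N.

(* Multiples of [kap] make the frequencies lacunary in all coordinates but the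
   last one, which completes the sum to [n]. *)
Definition level (i : {ffun 'I_e -> 'I_q.+1}) (j : 'I_e.+1) : nat :=
  if unlift ord_max j is Some j' then (kap * i j')%N else (n - \sum_j' kap * i j')%N.

Lemma sum_level i : (\sum_j level i j = n)%N.
Proof.
rewrite big_ord_recr /= {2}/level unlift_none.
rewrite (eq_bigr (fun j' : 'I_e => kap * i j')%N); last first.
  move=> j' _; have -> : widen_ord (leqnSn e) j' = lift ord_max j'.
    by apply: val_inj; exact/esym/lift_max.
  by rewrite /level liftK.
(* The truncated subtraction in the last coordinate is exact, since e * kap * q <= n. *)
rewrite subnKC//; apply: (@leq_trans (\sum_(j' < e) kap * q)).
  by apply: leq_sum => j' _; rewrite leq_mul2l -ltnS ltn_ord orbT.
rewrite sum_nat_const card_ord mulnA (mulnC e).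
apply: (@leq_trans (kap * e.+1 * q)); first by rewrite leq_mul2r leq_mul2l leqnSn !orbT.
by rewrite mulnC leq_trunc_div.
Qed.

Lemma level_lift i j : level i (lift ord_max j) = (kap * i j)%N.
Proof. by rewrite /level liftK. Qed.

End levels.

(** [moment_bound] controls the squared norm, hence the square root; the factor 2 is the one from
    [Lnorm_half_le1]. Each of the [N] levels has at least 2^n free boxes, each with a bump of mean
    2^-n. *)
Lemma extremal_function (R : realType) (r p : R) (m e n k l kap M : nat)
    (xi : 'I_M -> euclidean R e.+1) :
  0 < r -> r + 2 <= m%:R -> 1 <= p -> p <= (2 * k).+2%:R -> (2 * k).+2 = (2 ^ l)%N ->
  ((2 * k).+1 * 4 <= 2 ^ kap)%N -> (0 < n)%N -> is_net n n.-1 (range xi) ->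
  let N : R := ((n %/ (kap * e.+1)).+1 ^ e)%N%:R in
  exists f, [/\ @Wclass R e.+1 r p f, continuous_on_space f, forall i, f (xi i) = 0 &
    N / (2 * (Num.sqrt (type2_cst R k ^+ e * N) * kernel_norm R r m e.+1 n)) <=
    \int[torus_prob R e.+1]_x f x].
Proof.
move=> r0 rm p1 pk kl kk n0 net N.
have kap0 : (0 < kap)%N by case: (kap) kk => //; rewrite expn0; lia.
pose I := {ffun 'I_e -> 'I_(n %/ (kap * e.+1)).+1}.
pose lv : I -> 'I_e.+1 -> nat := level e n kap.
pose Om (i : I) := free R m e.+1 n M xi (lv i).
pose J := [seq lift ord_max j | j : 'I_e].
pose ix (j : 'I_e.+1) (i : I) : nat := if unlift ord_max j is Some j' then i j' else 0%N.
have sJ : size J = e by rewrite size_map size_enum_ord.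
have cI : #|I|%:R = N by rewrite /I card_ffun !card_ord.
have N0 : 0 < N by rewrite ltr0n expn_gt0.
have I0 : (0 < #|I|)%N by rewrite -(ltr0n R) cI.
have lvn i : (\sum_j lv i j = n)%N by exact: sum_level.
have lvle i j : (lv i j <= n)%N by rewrite -(lvn i) (bigD1 j)//= leq_addr.
have lvJ i j : j \in J -> lv i j = (kap * ix j i)%N.
  by move=> /fintype.imageP[j' _ ->]; rewrite /lv level_lift /ix liftK.
have ixJ i i' : (forall j, j \in J -> ix j i = ix j i') -> i = i'.
  move=> h; apply/ffunP => j; apply: val_inj.
  by have := h (lift ord_max j) (fintype.image_f _ _); rewrite /ix liftK; apply.
have OmB i : Om i \subset box e.+1 n (lv i).
  by apply/fintype.subsetP => f; rewrite /Om in_free => /andP[].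
have := moment_bound_limit R r m e.+1 n r0 rm I lv Om lvle k _
  (fun V V0 => blocks_moment R r m e.+1 n r0 rm k l kap kl kk I lv ix J Om lvn lvJ ixJ OmB V V0 I0).
rewrite sJ cI; set K := tensor_sum _ _ _ _ _ _ _; set G := kernel_norm _ _ _ _ _ => mK.
have C48 := block_cst_ge48 R r m r0; have z1 := block_rate_lt1 R r r0.
have T1 := type2_cst_ge1 R k.
have T0 : 0 < type2_cst R k ^+ e * N by rewrite mulr_gt0 ?exprn_gt0//; lra.
have G0 : 0 < G.
  have C0 : 0 < block_cst R r m by lra.
  by rewrite /G /kernel_norm mulr_gt0 ?(mulr_gt0 (exprn_gt0 _ C0)) ?exprn_gt0 ?powR_gt0
    ?divr_gt0 ?subr_gt0.
set rho := Num.sqrt _ * G; have rho0 : 0 < rho by rewrite mulr_gt0 ?sqrtr_gt0.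
have bK : bounded_mfun _ _ _ K by apply: tensor_sum_bmf => a; exact: bump_kernel_bmf.
pose b := 2^-1 / rho; exists (fun x => b * tensor_sum R e.+1 n I lv Om (bump R m) x); split.
- split.
    move=> j x; rewrite tensor_sum_periodic//.
    by move=> a y; rewrite -[2 * pi]mul1r /bump (cos_series_periodic R _ _ _ 1).
  exists (fun x => b * K x); split.
  + move=> j x; rewrite /K tensor_sum_periodic//.
    by move=> a y; rewrite -[2 * pi]mul1r /bump_kernel (cos_series_periodic R _ _ _ 1).
  + by have [] := bmfZ _ _ _ b _ bK.
  + rewrite (_ : (fun x => b * K x) = (fun x => 2^-1 * (rho^-1 * K x))); last first.
      by apply/funext => x; rewrite mulrA.
    apply: (Lnorm_half_le1 _ _ _ _ k) => //; first exact: bmfZ.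
    rewrite /moment_bound; under eq_Rintegral do rewrite exprMn.
    rewrite bmf_RintegralZ; last exact: bmfX.
    rewrite expr1n exprVn mulrC ler_pdivrMr ?exprn_gt0// mul1r.
    apply: (le_trans mK); have -> : (2 * k).+2 = (2 * k.+1)%N by rewrite mulnS.
    have -> : type2_cst R k ^+ e * (N * G ^+ 2) = rho ^+ 2.
      by rewrite [RHS]exprMn sqr_sqrtr ?(ltW T0)// mulrA.
    by rewrite -exprM.
  + by apply: aeW => x; rewrite convolution_tensor_sum.
- have cont : continuous_on_space (tensor_sum R e.+1 n I lv Om (bump R m)).
    apply: tensor_sum_continuous => a.
    exact: cos_series_continuous _ _ _ _ _ (bump_cst_ge0 R m a) (bump_coef_le R r m r0 rm a).
  by move=> v; exact: cvgM (cvg_cst b) (cont v).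
- move=> i; rewrite /tensor_sum big1 ?mulr0// => i' _; rewrite big1// => f.
  by rewrite /Om in_free => /andP[_ /forallP/(_ i)/eqP].
rewrite bmf_RintegralZ; last by apply: tensor_sum_bmf => a; exact: (bump_bmf _ r).
rewrite (bump_tensor_sum_mean _ _ _ _ _ _ r)// (_ : N / _ = b * N); last first.
  by rewrite /b invfM; ring.
rewrite ler_wpM2l ?divr_ge0 ?(ltW rho0)// -cI -sum1_card natr_sum; apply: ler_sum => i _.
rewrite -[leLHS](divff (_ : 2 ^+ n != 0 :> R)) ?expf_neq0// ler_wpM2r ?invr_ge0 ?exprn_ge0//.
by rewrite -natrX ler_nat; exact: (card_free R r m e.+1 n r0 rm).
Qed.

Theorem theorem4p2 (R : realType) (d : nat) (p r : R)
  (hd : (0 < d)%N) (hp : 1 <= p) (hr : 0 < r) :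
  exists2 c : R, 0 < c &
    forall (n m : nat) (xi : 'I_m -> euclidean R d) (lambda : 'I_m -> R),
      (0 < n)%N -> is_net n n.-1 (range xi) ->
      ((c * (2 `^ (- (r * n%:R)) * n%:R `^ ((d%:R - 1) / 2)))%:E
        <= cubature_error (@Wclass R d r p) xi lambda)%E.
Proof.
case: d hd => [//|e] _.
(* The order of the moment is 2k + 2 = 2^l >= p, and [kap] = l + 2 gives 4 (2k + 1) <= 4 * 2^l =
   2^kap. *)
pose m := Num.bound (r + 2); pose l := (Num.bound p).+1.
have rm : r + 2 <= m%:R by rewrite ltW// archi_boundP// addr_ge0// ltW.
pose k := (2 ^ l.-1).-1; pose kap := l.+2.
have kl : ((2 * k).+2 = 2 ^ l)%N.
  have : (0 < 2 ^ l.-1)%N by rewrite expn_gt0.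
  by rewrite /k /l /= expnS; lia.
have kk : ((2 * k).+1 * 4 <= 2 ^ kap)%N by rewrite /kap 2!expnS -kl; lia.
have pk : p <= (2 * k).+2%:R.
  rewrite kl (le_trans (ltW (archi_boundP (le_trans ler01 hp))))// ler_nat.
  by rewrite ltnW// (leq_trans (ltn_expl _ (ltnSn 1)))// leq_exp2l// leqnSn.
have C48 := block_cst_ge48 R r m hr; have z1 := block_rate_lt1 R r hr.
have T1 := type2_cst_ge1 R k.
set C := block_cst R r m in C48; set z := block_rate R r in z1; set T := type2_cst R k in T1.
have sT : 0 < Num.sqrt (T ^+ e) by rewrite sqrtr_gt0 exprn_gt0//; lra.
pose X := C ^+ e.+1 * (2 / (1 - z)) ^+ e.+1.
have X0 : 0 < X.
  have C0 : 0 < C by lra.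
  by rewrite /X (mulr_gt0 (exprn_gt0 _ C0))// exprn_gt0// divr_gt0// subr_gt0.
pose sK : R := Num.sqrt ((kap * e.+1) ^ e)%N%:R.
have sK0 : 0 < sK by rewrite sqrtr_gt0 ltr0n expn_gt0 muln_gt0.
have c0 : 0 < (2 * Num.sqrt (T ^+ e) * X * sK)^-1.
  by rewrite invr_gt0 (mulr_gt0 (mulr_gt0 (mulr_gt0 _ sT) X0) sK0).
exists (2 * Num.sqrt (T ^+ e) * X * sK)^-1 => //.
move=> n M xi lambda n0 net.
have [f [Wf cf f0 fint]] := extremal_function R r p m e n k l kap M xi hr rm hp pk kl kk n0 net.
apply: (@le_trans _ _ (`|\int[torus_prob R e.+1]_x f x - cubature xi lambda f|%:E)); last first.
  by apply: ereal_sup_ubound; exists f.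
rewrite /cubature big1 ?subr0; last by move=> j _; rewrite f0 mulr0.
rewrite lee_fin; apply: le_trans (ler_norm _); apply: le_trans fint.
set q := (n %/ _).+1; pose sN : R := Num.sqrt (q ^ e)%N%:R.
have sN0 : 0 < sN by rewrite sqrtr_gt0 ltr0n expn_gt0.
have S0 : 0 < (2 `^ r) ^+ n :> R by rewrite exprn_gt0// powR_gt0.
(* Division with remainder gives n <= kap (e+1) q; the e-th power and a square root turn this into
   n^(e/2), where e = d - 1. The case e = 0 is separate because comparing powers needs a positive
   exponent. *)
have nE : n%:R `^ ((e.+1%:R - 1) / 2) <= sK * sN.
  rewrite -(natr1 e) addrK powRrM powR_mulrn// powR12_sqrt ?exprn_ge0//.
  have nq : (n <= kap * e.+1 * q)%N by rewrite mulnC ltnW// ltn_ceil// muln_gt0.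
  rewrite -sqrtrM// ler_wsqrtr// -natrX -natrM ler_nat -expnMn.
  by have [->//|e0] := posnP e; rewrite leq_exp2r.
have -> : (q ^ e)%N%:R / (2 * (Num.sqrt (T ^+ e * (q ^ e)%N%:R) * kernel_norm R r m e.+1 n)) =
    (2 * Num.sqrt (T ^+ e) * X * sK)^-1 * (((2 `^ r) ^+ n)^-1 * (sK * sN)).
  rewrite sqrtrM; last by rewrite exprn_ge0//; lra.
  have -> : Num.sqrt (q ^ e)%N%:R = sN by [].
  have -> : (q ^ e)%N%:R = sN ^+ 2 by rewrite sqr_sqrtr.
  rewrite /kernel_norm -/C -/z.
  have -> : C ^+ e.+1 * (2 `^ r) ^+ n * (2 / (1 - z)) ^+ e.+1 = X * (2 `^ r) ^+ n.
    by rewrite /X mulrAC.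
  have fieldE (a b c x y : R) : 0 < a -> 0 < b -> 0 < c -> 0 < x -> 0 < y ->
      y ^+ 2 / (2 * (a * y * (x * b))) = (2 * a * x * c)^-1 * (b^-1 * (c * y)).
    by move=> *; field; rewrite !gt_eqF.
  exact: fieldE.
rewrite (ler_wpM2l (ltW c0))//.
rewrite powRN powRrM powR_mulrn ?powR_ge0// ler_wpM2l// invr_ge0 ltW//.
Qed.
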